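(* For all $t\in(0,T]$ it holds $$\partial_t\nabla^2_{\xi\xi}\mathcal V(t,0,0)=\nabla^2_{\xi\xi}\mathcal V(t,0,0)B(t)+B(t)^\top\nabla^2_{\xi\xi}\mathcal V(t,0,0)-\nabla^2_{\xi\xi}\mathcal V(t,0,0)FF^\top\nabla^2_{\xi\xi}\mathcal V(t,0,0)+\alpha C^\top C,$$ where $B(t)=-A-G(\tilde x(t)\otimes I_n)-G(I_n\otimes\tilde x(t))$.
   Context: Fixed data: $T>0$, $\alpha>0$, $A\in\mathbb R^{n\times n}$, $G\in\mathbb R^{n\times n^2}$, $F\in\mathbb R^{n\times m}$, $C\in\mathbb R^{r\times n}$, $x_0\in\mathbb R^n$; $\otimes$ is the Kronecker product, $I_n$ the identity matrix, $\|\cdot\|$ the Euclidean norm. It is assumed that $\dot x=Ax+G(x\otimes x)$, $x(0)=x_0$, has a unique solution $\tilde x\in H^1(0,T;\mathbb R^n)$ on $[0,T]$ (the nominal trajectory). $V_t$ is $H^1(0,t;\mathbb R^n)$ with norm $\max(\|\cdot\|_{H^1},\|\cdot\|_{L^\infty})$. Products of Banach spaces carry the maximum norm, and $\mathcal U_\epsilon(x)$ is the open ball of radius $\epsilon$ around $x$. Optimal control problem: for $t\in(0,T]$, $\xi\in\mathbb R^n$, $\omega\in L^2(0,t;\mathbb R^r)$, minimize $$J(x,v;t,\omega)=\tfrac12\|x(0)-x_0\|^2+\tfrac12\int_0^t\|v\|^2+\alpha\|\omega-C(x-\tilde x)\|^2\,ds$$ over $(x,v)\in V_t\times L^2(0,t;\mathbb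 R^m)$ subject to $\dot x=Ax+G(x\otimes x)+Fv$ a.e. on $[0,t]$ and $x(t)=\tilde x(t)+\xi$. Value function: $\mathcal V(t,\xi,\omega)$ is the infimum of this problem for $t\in(0,T]$ (equal to $+\infty$ if no admissible pair exists), and $\mathcal V(0,\xi,\omega)=\tfrac12\|\xi\|^2$. There is $\delta_4>0$ independent of $t$ such that for every $t\in(0,T]$ the problem has exactly one solution for every $(\xi,\omega)\in\mathcal U_{\delta_4}(0)\subset\mathbb R^n\times L^2(0,t;\mathbb R^r)$, and $\mathcal V(t,\cdot,\cdot)$ is $C^\infty$ there. $\nabla^2_{\xi\xi}\mathcal V(t,0,0)$ is the Hessian with respect to $\xi$ at $\xi=0$, $\omega=0$. The time derivative at $t=T$ is one-sided. *)

(* Defs.v *)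
From HB Require Import structures.
From mathcomp Require Import all_boot all_order all_algebra.
From mathcomp Require Import all_classical all_reals all_analysis.
From mathcomp Require Export mxtens.
Set Implicit Arguments.
Unset Strict Implicit.
Unset Printing Implicit Defensive.
Import Order.TTheory GRing.Theory Num.Theory.
Import numFieldNormedType.Exports.

Local Open Scope classical_set_scope.
Local Open Scope ring_scope.

Definition normsq (R : realType) (k : nat) (x : 'cV[R]_k) : R :=
  \sum_i x i 0 ^+ 2.

Definition enorm (R : realType) (k : nat) (x : 'cV[R]_k) : R :=
  Num.sqrt (normsq x).

(* Elements of L^2(0,t;R^k) and H^1(0,t;R^k) are represented by total functions
   on R, of which only the restriction to [0,t] matters (up to a.e. equality in
   the case of L^2). *)
Definition is_L2 (R : realType) (k : nat) (t : R) (w : R -> 'cV[R]_k) : Prop :=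
  forall i,
    measurable_fun `[0, t] (fun s => w s i 0) /\
    lebesgue_measure.-integrable `[0, t] (fun s => (w s i 0 ^+ 2)%:E).

Definition L2norm (R : realType) (k : nat) (t : R) (w : R -> 'cV[R]_k) : R :=
  Num.sqrt (\int[lebesgue_measure]_(s in `[0, t]) normsq (w s)).

(* x is the continuous representative of an element of H^1(0,t;R^k) with weak
   derivative dx: x is absolutely continuous and dx is square integrable. *)
Definition is_H1 (R : realType) (k : nat) (t : R) (x dx : R -> 'cV[R]_k)
    : Prop :=
  is_L2 t dx /\
  forall s, 0 <= s <= t -> forall i,
    x s i 0 = x 0 i 0 + \int[lebesgue_measure]_(u in `[0, s]) dx u i 0.

Definition H1_solution (R : realType) (k : nat) (t : R)
    (f : R -> 'cV[R]_k -> 'cV[R]_k) (x : R -> 'cV[R]_k) : Prop :=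
  exists2 dx, is_H1 t x dx &
    {ae lebesgue_measure, forall s : R, 0 <= s <= t -> dx s = f s (x s)}.

(* f is C^oo on the open subset U of the space L, a linear subspace of X with
   (semi)norm N.  D x [:: h1; ...; hk] is the k-th Frechet derivative of f at x
   in the directions h1, ..., hk: it is a bounded k-linear form, and the
   (k+1)-st derivative is the derivative of the k-th one in operator norm.  When
   N is a seminorm this is smoothness on the quotient by its kernel. *)
Definition smooth_on (R : realType) (X : lmodType R) (L : set X) (N : X -> R)
    (U : set X) (f : X -> R) : Prop :=
  exists D : X -> seq X -> R,
  [/\ forall x, U x -> D x [::] = f x,
      forall x, U x -> forall us vs (a : R) u v,
        (forall w, w \in us ++ vs -> L w) -> L u -> L v ->
        D x (us ++ (a *: u + v) :: vs) =
          a * D x (us ++ u :: vs) + D x (us ++ v :: vs),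
      forall x, U x -> forall k : nat, exists M : R, forall us,
        size us = k -> (forall w, w \in us -> L w) ->
        `|D x us| <= M * \prod_(u <- us) N u
    & forall x, U x -> forall (k : nat) (e : R), 0 < e ->
      exists2 d : R, 0 < d &
        forall h, L h -> N h < d -> U (x + h) -> forall us,
          size us = k -> (forall w, w \in us -> L w) ->
          `|D (x + h) us - D x us - D x (h :: us)|
            <= e * N h * \prod_(u <- us) N u].

Definition hessian (R : realType) (k : nat) (f : 'cV[R]_k -> R)
    (x : 'cV[R]_k) : 'M[R]_k :=
  \matrix_(i, j) 'D_(delta_mx i 0) ('D_(delta_mx j 0) f) x.

Definition has_deriv_within (R : realType) (k l : nat) (D : set R)
    (P : R -> 'M[R]_(k, l)) (t : R) (dP : 'M[R]_(k, l)) : Prop :=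
  (s - t)^-1 *: (P s - P t) @[s --> within D t^'] --> dP.

Section ocp.
Context {R : realType} {n m r : nat}.
Context (alpha : R) (A : 'M[R]_n) (G : 'M[R]_(n, n * n)) (F : 'M[R]_(n, m)).
Context (C : 'M[R]_(r, n)) (x0 : 'cV[R]_n) (xt : R -> 'cV[R]_n).

Definition drift (x : 'cV[R]_n) : 'cV[R]_n := A *m x + G *m (x *t x).

Definition nominal (T : R) (x : R -> 'cV[R]_n) : Prop :=
  H1_solution T (fun _ => drift) x /\ x 0 = x0.

(* B(t) of the Riccati equation; the casts identify 1 * n and n * 1 with n. *)
Definition Bmx (t : R) : 'M[R]_n :=
  - A - G *m castmx (erefl, mul1n n) (xt t *t (1%:M : 'M[R]_n))
      - G *m castmx (erefl, muln1 n) ((1%:M : 'M[R]_n) *t xt t).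

Definition cost (t : R) (w : R -> 'cV[R]_r)
    (p : (R -> 'cV[R]_n) * (R -> 'cV[R]_m)) : R :=
  2^-1 * normsq (p.1 0 - x0) +
  2^-1 * \int[lebesgue_measure]_(s in `[0, t])
    (normsq (p.2 s) + alpha * normsq (w s - C *m (p.1 s - xt s))).

Definition admissible (t : R) (xi : 'cV[R]_n)
    : set ((R -> 'cV[R]_n) * (R -> 'cV[R]_m)) :=
  [set p | [/\ is_L2 t p.2,
               H1_solution t (fun s y => drift y + F *m p.2 s) p.1
             & p.1 t = xt t + xi]].

Definition ocp_solution (t : R) (xi : 'cV[R]_n) (w : R -> 'cV[R]_r)
    (p : (R -> 'cV[R]_n) * (R -> 'cV[R]_m)) : Prop :=
  admissible t xi p /\
  forall q, admissible t xi q -> cost t w p <= cost t w q.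

Definition ocp_exactly_one (t : R) (xi : 'cV[R]_n) (w : R -> 'cV[R]_r) : Prop :=
  exists2 p, ocp_solution t xi w p &
    forall q, ocp_solution t xi w q ->
      (forall s, 0 <= s <= t -> q.1 s = p.1 s) /\
      {ae lebesgue_measure, forall s : R, 0 <= s <= t -> q.2 s = p.2 s}.

Definition value (t : R) (xi : 'cV[R]_n) (w : R -> 'cV[R]_r) : \bar R :=
  if 0 < t then ereal_inf [set (cost t w p)%:E | p in admissible t xi]
  else (2^-1 * normsq xi)%:E.

Definition data_space (t : R) : set ('cV[R]_n * (R -> 'cV[R]_r)) :=
  [set p | is_L2 t p.2].

Definition data_norm (t : R) (p : 'cV[R]_n * (R -> 'cV[R]_r)) : R :=
  Num.max (enorm p.1) (L2norm t p.2).

Definition data_ball (t delta : R) : set ('cV[R]_n * (R -> 'cV[R]_r)) :=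
  [set p | data_space t p /\ data_norm t p < delta].

Definition value_hessian (t : R) : 'M[R]_n :=
  hessian (fun xi => fine (value t xi (fun=> 0))) 0.

End ocp.

(* Main.v *)
(* Write V(t, xi) for the value with omega = 0.  As V(t, .) is smooth and
   nonnegative and vanishes at 0, V(t, xi) = xi^T P(t) xi / 2 + o(|xi|^2) with P(t)
   symmetric and positive semidefinite.  With y = x - xt, dynamic programming on
   [s, t] reads
     V(t, xi) = inf V(s, y(s)) + 1/2 \int_s^t |v|^2 + alpha |C y|^2,
   and y(s) = xi + (t - s) B(t) xi - F \int_s^t v + O((t - s)^(3/2) |xi|) when the
   energy of v is O(|xi|^2).  Along an optimal trajectory, completing the square in
   \int_s^t v bounds V(t, xi) from below; the constant control v = F^T P(s) xi, whose
   trajectory is obtained by Picard iteration backwards from t, gives the matching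
   upper bound.  Scaling xi to 0 at fixed s < t yields
     P(t) - P(s) = (t - s) (P(s) B(t) + B(t)^T P(s) - P(s) F F^T P(s) + alpha C^T C)
                   + O((t - s)^(3/2)),
   uniformly as long as P stays bounded, and the control v = 0 shows that it does.
   In particular the Riccati equation never has to be solved. *)
Require Import Defs.
From HB Require Import structures.
From mathcomp Require Import all_boot all_order all_algebra.
From mathcomp Require Import all_classical all_reals all_analysis.
From mathcomp Require Import measurable_realfun.
From mathcomp Require Import ring lra.
Set Implicit Arguments.
Unset Strict Implicit.
Unset Printing Implicit Defensive.
Import Order.TTheory GRing.Theory Num.Theory.
Import numFieldNormedType.Exports.
Local Open Scope classical_set_scope.
Local Open Scope ring_scope.

(** * The sup norm and the Euclidean norm *)

Section norms.
Context {R : realType}.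

(** The value is known to be smooth only at each fixed time, and the radius of its Taylor expansion
    may shrink as the time varies. This is why [xi] tends to 0 before [t - s] does: what survives
    are constants that depend only on a bound [K] for [P]. The exponent 3/2 comes from
    Cauchy-Schwarz: a control of L^2 norm O(|xi|) moves the state by O((t - s)^(1/2) |xi|), and the
    nominal trajectory enters through its Hölder-1/2 continuity. Any exponent above 1 yields the
    derivative. The two bounds are not symmetric. On an optimal trajectory the displacement y(s) -
    xi is only O((t - s)^(1/2) |xi|), so its quadratic form under P(s) is as large as the main term
    and can be discarded only because P(s) is positive semidefinite. Under a constant control the
    displacement is O((t - s) |xi|) and its quadratic form is negligible. The lower bound also
    requires P(t) to be bounded, in order to control the energy of the optimal control. The
    right-hand side pairs P(s) with B(t), so on both sides of a given time it has to be moved to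
    that time by its Lipschitz continuity in the matrix and its Hölder continuity in time. *)

Lemma ler_mx_norm {k l} (M : 'M[R]_(k, l)) i j : `|M i j| <= `|M|.
Proof.
rewrite [leRHS]/Num.norm/= mx_normrE; apply/bigmax_geP; right => /=.
by exists (i, j).
Qed.

Lemma mx_norm_le {k l} (M : 'M[R]_(k, l)) (c : R) : 0 <= c ->
  (forall i j, `|M i j| <= c) -> `|M| <= c.
Proof.
move=> c0 Mc; rewrite /Num.norm/= mx_normrE; apply/bigmax_leP; split=> [//|[i j] _].
exact: Mc.
Qed.

Lemma ler_norm_mulmx {k l p} (M : 'M[R]_(k, l)) (N : 'M[R]_(l, p)) :
  `|M *m N| <= l%:R * `|M| * `|N|.
Proof.
apply: mx_norm_le => [|i j]; first by rewrite !mulr_ge0.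
rewrite mxE (le_trans (ler_norm_sum _ _ _))//.
have -> : l%:R * `|M| * `|N| = \sum_(a < l) `|M| * `|N|.
  by rewrite sumr_const card_ord -[RHS]mulr_natl mulrA.
by apply: ler_sum => a _; rewrite normrM ler_pM// ler_mx_norm.
Qed.

Lemma ler_norm_tens {k l p q} (M : 'M[R]_(k, l)) (N : 'M[R]_(p, q)) :
  `|M *t N| <= `|M| * `|N|.
Proof.
apply: mx_norm_le => [|i j]; first by rewrite mulr_ge0.
by rewrite mxE normrM ler_pM// ler_mx_norm.
Qed.

Lemma norm_trmx {k l} (M : 'M[R]_(k, l)) : `|M^T| = `|M|.
Proof.
apply/eqP; rewrite eq_le; apply/andP; split; apply: mx_norm_le => // i j.
  by rewrite mxE ler_mx_norm.
by have := ler_mx_norm M^T j i; rewrite mxE.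
Qed.

Lemma normsq_ge0 {k} (x : 'cV[R]_k) : 0 <= normsq x.
Proof. by apply: sumr_ge0 => i _; rewrite sqr_ge0. Qed.

Lemma normsqE {k} (x : 'cV[R]_k) : normsq x = (x^T *m x) 0 0.
Proof. by rewrite mxE; apply: eq_bigr => i _; rewrite mxE expr2. Qed.

Lemma normsqN {k} (x : 'cV[R]_k) : normsq (- x) = normsq x.
Proof. by apply: eq_bigr => i _; rewrite mxE sqrrN. Qed.

Lemma normsq0 {k} : normsq (0 : 'cV[R]_k) = 0.
Proof. by apply: big1 => i _; rewrite mxE expr0n. Qed.

Lemma normsq_le {k} (x : 'cV[R]_k) : normsq x <= k%:R * `|x| ^+ 2.
Proof.
have -> : k%:R * `|x| ^+ 2 = \sum_(a < k) `|x| ^+ 2.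
  by rewrite sumr_const card_ord -[RHS]mulr_natl.
apply: ler_sum => i _; rewrite -real_normK ?num_real//.
by rewrite lerXn2r ?nnegrE// ler_mx_norm.
Qed.

Lemma normsq_entry_le {k} (x : 'cV[R]_k) i : (x i 0) ^+ 2 <= normsq x.
Proof.
rewrite /normsq (bigD1 i)//= lerDl; apply: sumr_ge0 => j _; exact: sqr_ge0.
Qed.

Lemma normsq_norm_le {k} (x : 'cV[R]_k) : `|x| ^+ 2 <= normsq x.
Proof.
rewrite -[leRHS]sqr_sqrtr ?normsq_ge0// lerXn2r ?nnegrE ?sqrtr_ge0//.
apply: mx_norm_le => [|i j]; first exact: sqrtr_ge0.
by rewrite (ord1 j) -sqrtr_sqr ler_wsqrtr// normsq_entry_le.
Qed.

Lemma normsq_normB {k} (x y : 'cV[R]_k) :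
  `|normsq x - normsq y| <= k%:R * (`|x| + `|y|) * `|x - y|.
Proof.
have -> : k%:R * (`|x| + `|y|) * `|x - y| =
    \sum_(a < k) (`|x| + `|y|) * `|x - y|.
  by rewrite sumr_const card_ord -[RHS]mulr_natl mulrA.
rewrite /normsq -sumrB (le_trans (ler_norm_sum _ _ _))//.
apply: ler_sum => i _; rewrite subr_sqr normrM mulrC ler_pM//.
  rewrite (le_trans (ler_normD _ _))// lerD// ler_mx_norm//.
by have := ler_mx_norm (x - y) i 0; rewrite !mxE.
Qed.

(** The constant [k + 1] in place of the sharp square root of [k] is positive even for [k = 0], so
    that radii can be divided by it. *)
Lemma enorm_le {k} (x : 'cV[R]_k) : enorm x <= (k%:R + 1) * `|x|.
Proof.
rewrite /enorm -[leRHS]ger0_norm ?mulr_ge0 ?addr_ge0// -sqrtr_sqr ler_wsqrtr//.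
rewrite (le_trans (normsq_le x))// exprMn ler_wpM2r ?sqr_ge0//.
by have := ler0n R k; nra.
Qed.

End norms.

(** * Integrals over compact intervals *)

Section integrals.
Context {R : realType}.
Local Notation mu := (@lebesgue_measure R).
Implicit Types (a b c : R) (f g : R -> R).

Definition integ a b f := mu.-integrable `[a, b] (EFin \o f).

Lemma integS {a b} a' b' {f} : a <= a' -> b' <= b -> integ a b f -> integ a' b' f.
Proof.
move=> aa bb; apply: integrableS => // x /=; rewrite !in_itv/= => /andP[ax xb].
by rewrite (le_trans aa)//= (le_trans xb).
Qed.

Lemma integ_measurable a b f : integ a b f -> measurable_fun `[a, b] f.
Proof. by move=> /(measurable_int mu) /measurable_EFinP. Qed.

Lemma integD a b f g : integ a b f -> integ a b g -> integ a b (fun r => f r + g r).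
Proof. by move=> fi gi; apply: (integrableD _ fi gi). Qed.

Lemma integB a b f g : integ a b f -> integ a b g -> integ a b (fun r => f r - g r).
Proof. by move=> fi gi; apply: (integrableB _ fi gi). Qed.

Lemma integZ a b k f : integ a b f -> integ a b (fun r => k * f r).
Proof. by move=> fi; apply: (integrableZl _ k fi). Qed.

Lemma integ_bounded a b f M : measurable_fun `[a, b] f ->
  (forall r, a <= r <= b -> `|f r| <= M) -> integ a b f.
Proof.
move=> mf fM; apply: measurable_bounded_integrable => //.
  by rewrite /= lebesgue_measure_itv/=; case: ifP => //; rewrite ltry.
exists M; split; first exact: num_real.
move=> x Mx r /=; rewrite in_itv/= => /fM /le_trans; apply; exact: ltW.
Qed.

Lemma integ_cst a b k : integ a b (fun=> k).
Proof. by apply: (@integ_bounded a b _ `|k|). Qed.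

Lemma integ_sum a b (I : Type) (s : seq I) (f : I -> R -> R) :
  (forall i, integ a b (f i)) -> integ a b (fun r => \sum_(i <- s) f i r).
Proof.
move=> fi; elim: s => [|i s ih].
  by under [X in integ _ _ X]eq_fun do rewrite big_nil; exact: integ_cst.
by under [X in integ _ _ X]eq_fun do rewrite big_cons; exact: integD.
Qed.

Lemma integ_le a b f g : measurable_fun `[a, b] f -> integ a b g ->
  (forall r, a <= r <= b -> `|f r| <= g r) -> integ a b f.
Proof.
move=> mf gi fg; apply: (le_integrable _ _ _ gi) => //.
  exact/measurable_EFinP.
move=> r /=; rewrite in_itv/= => /fg fgr; rewrite lee_fin.
by rewrite (le_trans fgr)// ler_norm.
Qed.

(** On an interval of finite length the bound |f| <= 1 + f^2 suffices. *)
Lemma integ_sqr a b f : measurable_fun `[a, b] f ->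
  integ a b (fun r => f r ^+ 2) -> integ a b f.
Proof.
move=> mf f2; apply: (integ_le (g := fun r => 1 + f r ^+ 2) mf).
  exact/integD/f2/integ_cst.
move=> r _; rewrite ler_norml; nra.
Qed.

Lemma integ_sqrD a b f g : measurable_fun `[a, b] f -> measurable_fun `[a, b] g ->
  integ a b (fun r => f r ^+ 2) -> integ a b (fun r => g r ^+ 2) ->
  integ a b (fun r => (f r + g r) ^+ 2).
Proof.
move=> mf mg f2 g2; apply: (integ_le (g := fun r => 2 * (f r ^+ 2 + g r ^+ 2))).
- by apply: measurable_funX; exact: measurable_funD.
- exact/integZ/integD.
- by move=> r _; rewrite ger0_norm ?sqr_ge0//; have := sqr_ge0 (f r - g r); nra.
Qed.

Lemma Rint_split a b c f : a <= c -> c <= b -> integ a b f ->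
  \int[mu]_(r in `[a, b]) f r =
  \int[mu]_(r in `[a, c]) f r + \int[mu]_(r in `[c, b]) f r.
Proof.
move=> ac cb fi.
have := Rintegral_itvB (x := c) fi; rewrite !bnd_simp => /(_ ac cb).
rewrite Rintegral_itv_obnd_cbnd.
  by move=> <-; rewrite addrC subrK.
apply: integrableS fi => // r /=; rewrite !in_itv/= => /andP[cr ->].
by rewrite (le_trans ac (ltW cr)).
Qed.

Lemma Rint_cst a b k : a <= b -> \int[mu]_(r in `[a, b]) k = (b - a) * k.
Proof.
move=> ab; rewrite Rintegral_cst//= lebesgue_measure_itv/= lte_fin mulrC.
case: ltP => //= ba; have -> : a = b by apply/eqP; rewrite eq_le ab.
by rewrite subrr.
Qed.

Lemma Rint_le a b f g : integ a b f -> integ a b g ->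
  (forall r, a <= r <= b -> f r <= g r) ->
  \int[mu]_(r in `[a, b]) f r <= \int[mu]_(r in `[a, b]) g r.
Proof.
by move=> fi gi fg; apply: le_Rintegral => // r /=; rewrite in_itv/=; exact: fg.
Qed.

Lemma Rint_norm_le a b f M : a <= b -> integ a b f ->
  (forall r, a <= r <= b -> `|f r| <= M) ->
  `|\int[mu]_(r in `[a, b]) f r| <= (b - a) * M.
Proof.
move=> ab fi fM; rewrite ler_norml -mulrN -!Rint_cst//; apply/andP; split.
  by apply: Rint_le => //; [exact: integ_cst|move=> r /fM; rewrite ler_norml => /andP[]].
by apply: Rint_le => //; [exact: integ_cst|move=> r /fM; rewrite ler_norml => /andP[]].
Qed.

Lemma Rint_ge0 a b f : (forall r, a <= r <= b -> 0 <= f r) ->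
  0 <= \int[mu]_(r in `[a, b]) f r.
Proof. by move=> f0; apply: Rintegral_ge0 => r /=; rewrite in_itv/=; exact: f0. Qed.

Lemma Rint_eq a b f g : (forall r, a <= r <= b -> f r = g r) ->
  \int[mu]_(r in `[a, b]) f r = \int[mu]_(r in `[a, b]) g r.
Proof. by move=> fg; apply: eq_Rintegral => r; rewrite inE/= in_itv/=; exact: fg. Qed.

Lemma Rint_pt a f : \int[mu]_(r in `[a, a]) f r = 0.
Proof. by rewrite set_itv1 Rintegral_set1. Qed.

Lemma Rint_sum a b (I : Type) (s : seq I) (f : I -> R -> R) :
  (forall i, integ a b (f i)) ->
  \int[mu]_(r in `[a, b]) (\sum_(i <- s) f i r) =
  \sum_(i <- s) \int[mu]_(r in `[a, b]) f i r.
Proof.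
move=> fi; elim: s => [|i s ih].
  rewrite big_nil; under eq_Rintegral do rewrite big_nil.
  by rewrite Rintegral_cst// mul0r.
rewrite big_cons -ih -RintegralD//; [|exact: fi|exact: integ_sum].
by under eq_Rintegral do rewrite big_cons.
Qed.

(* The integral of [(f - c)^2] is nonnegative, where [c] is the mean of [f]. *)
Lemma Rint_CS a b f : a <= b -> integ a b f -> integ a b (fun r => f r ^+ 2) ->
  (\int[mu]_(r in `[a, b]) f r) ^+ 2 <=
  (b - a) * \int[mu]_(r in `[a, b]) (f r ^+ 2).
Proof.
rewrite le_eqVlt => /predU1P[<- _ _|ab fi f2]; first by rewrite Rint_pt expr0n subrr mul0r.
set J := \int[mu]_(r in _) f r; set J2 := \int[mu]_(r in _) _.
have ba0 : 0 < b - a by rewrite subr_gt0.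
pose c := J / (b - a).
have : 0 <= \int[mu]_(r in `[a, b]) (f r - c) ^+ 2.
  by apply: Rint_ge0 => r _; exact: sqr_ge0.
have -> : \int[mu]_(r in `[a, b]) (f r - c) ^+ 2 =
    J2 - 2 * c * J + (b - a) * c ^+ 2.
  rewrite -Rint_cst ?ltW// -RintegralZl// -RintegralB//; last exact: integZ.
  rewrite -RintegralD//; [|by apply: integB => //; exact: integZ|exact: integ_cst].
  by apply: Rint_eq => r _; ring.
have -> : J2 - 2 * c * J + (b - a) * c ^+ 2 = J2 - J ^+ 2 / (b - a).
  by rewrite /c; field; rewrite gt_eqF.
by rewrite subr_ge0 ler_pdivrMr// mulrC.
Qed.

Lemma ae_imply (P Q : R -> Prop) : (forall r, P r -> Q r) ->
  {ae mu, forall r, P r} -> {ae mu, forall r, Q r}.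
Proof.
move=> PQ [N [mN N0 PN]]; exists N; split => // r /= nQ; apply: PN => /= Pr.
exact/nQ/PQ.
Qed.

Lemma Rint_ae a b f g : measurable_fun `[a, b] f -> measurable_fun `[a, b] g ->
  {ae mu, forall r, a <= r <= b -> f r = g r} ->
  \int[mu]_(r in `[a, b]) f r = \int[mu]_(r in `[a, b]) g r.
Proof.
move=> mf mg fg; congr fine; apply: ae_eq_integral => //.
- exact/measurable_EFinP.
- exact/measurable_EFinP.
by apply: ae_imply fg => r fgr /=; rewrite in_itv/= => /fgr ->.
Qed.

End integrals.

(** * Componentwise integrals of vector-valued functions *)

Section vector_integrals.
Context {R : realType}.
Local Notation mu := (@lebesgue_measure R).
Implicit Types (a b c : R).

Definition vint k a b (h : R -> 'cV[R]_k) : 'cV[R]_k :=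
  \col_i \int[mu]_(r in `[a, b]) h r i 0.

Definition vinteg k a b (h : R -> 'cV[R]_k) := forall i, integ a b (fun r => h r i 0).

Definition vmeas k a b (h : R -> 'cV[R]_k) :=
  forall i, measurable_fun `[a, b] (fun r => h r i 0).

Definition vL2 k a b (h : R -> 'cV[R]_k) :=
  vmeas a b h /\ forall i, integ a b (fun r => h r i 0 ^+ 2).

Lemma vintegS k a b a' b' (h : R -> 'cV[R]_k) : a <= a' -> b' <= b ->
  vinteg a b h -> vinteg a' b' h.
Proof. by move=> aa bb hi i; exact: integS (hi i). Qed.

Lemma vmeasS k a b a' b' (h : R -> 'cV[R]_k) : a <= a' -> b' <= b ->
  vmeas a b h -> vmeas a' b' h.
Proof.
move=> aa bb hi i; apply: measurable_funS (hi i) => // x /=.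
by rewrite !in_itv/= => /andP[ax xb]; rewrite (le_trans aa)//= (le_trans xb).
Qed.

Lemma vL2S k a b a' b' (h : R -> 'cV[R]_k) : a <= a' -> b' <= b ->
  vL2 a b h -> vL2 a' b' h.
Proof.
move=> aa bb [hm hi]; split; first exact: vmeasS hm.
by move=> i; exact: integS (hi i).
Qed.

Lemma vL2_vinteg k a b (h : R -> 'cV[R]_k) : vL2 a b h -> vinteg a b h.
Proof. by move=> [hm hi] i; exact: integ_sqr. Qed.

Lemma vL2D k a b (f g : R -> 'cV[R]_k) : vL2 a b f -> vL2 a b g ->
  vL2 a b (fun r => f r + g r).
Proof.
move=> [fm fi] [gm gi]; split=> i /=.
  by under [X in measurable_fun _ X]eq_fun do rewrite mxE; exact: measurable_funD.
under [X in integ _ _ X]eq_fun do rewrite mxE.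
exact: integ_sqrD.
Qed.

Lemma vmeas_bounded_vL2 k a b (h : R -> 'cV[R]_k) M : vmeas a b h ->
  (forall r, a <= r <= b -> `|h r| <= M) -> vL2 a b h.
Proof.
move=> hm hM; split=> // i; apply: (@integ_bounded _ _ _ _ (M ^+ 2)).
  exact: measurable_funX.
move=> r /hM hr; rewrite normrX lerXn2r ?nnegrE//; first exact: le_trans hr.
exact: le_trans (ler_mx_norm _ _ _) hr.
Qed.

Lemma vmeasD k a b (f g : R -> 'cV[R]_k) : vmeas a b f -> vmeas a b g ->
  vmeas a b (fun r => f r + g r).
Proof. by move=> fm gm i /=; under [X in measurable_fun _ X]eq_fun do rewrite mxE; exact: measurable_funD. Qed.

Lemma vmeasB k a b (f g : R -> 'cV[R]_k) : vmeas a b f -> vmeas a b g ->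
  vmeas a b (fun r => f r - g r).
Proof. by move=> fm gm i /=; under [X in measurable_fun _ X]eq_fun do rewrite !mxE; exact: measurable_funB. Qed.

Lemma vmeas_cst k a b (c : 'cV[R]_k) : vmeas a b (fun=> c).
Proof. by move=> i; exact: measurable_cst. Qed.

Lemma vmeas_mulmx k l a b (M : 'M[R]_(k, l)) (h : R -> 'cV[R]_l) :
  vmeas a b h -> vmeas a b (fun r => M *m h r).
Proof.
move=> hm i /=; under [X in measurable_fun _ X]eq_fun do rewrite mxE.
by apply: measurable_sum => j; exact: measurable_funM.
Qed.

Lemma vmeas_tens k a b (h : R -> 'cV[R]_k) :
  vmeas a b h -> vmeas a b (fun r => h r *t h r : 'cV[R]_(k * k)).
Proof.
move=> hm i /=; under [X in measurable_fun _ X]eq_fun do rewrite mxE.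
apply: measurable_funM.
  by rewrite (ord1 (@mxtens_unindex 1 1 _).1); exact: hm.
by rewrite (ord1 (@mxtens_unindex 1 1 _).2); exact: hm.
Qed.

Lemma vL2_normsq k a b (h : R -> 'cV[R]_k) :
  vL2 a b h -> integ a b (fun r => normsq (h r)).
Proof. by move=> [hm hi]; apply: integ_sum. Qed.

Lemma vL2_mulmx k l a b (M : 'M[R]_(k, l)) (h : R -> 'cV[R]_l) :
  vL2 a b h -> vL2 a b (fun r => M *m h r).
Proof.
move=> hL; have [hm hi] := hL; split; first exact: vmeas_mulmx.
move=> i; have mM := @vmeas_mulmx _ _ a b M h hm.
apply: (integ_le (g := fun r => (l%:R * `|M|) ^+ 2 * normsq (h r))).
- by apply: measurable_funX; exact: mM.
- exact/integZ/vL2_normsq.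
- move=> r _; rewrite ger0_norm ?sqr_ge0//.
  rewrite (le_trans (_ : _ <= `|M *m h r| ^+ 2))//.
    by rewrite -real_normK ?num_real// lerXn2r ?nnegrE// ler_mx_norm.
  rewrite (le_trans (_ : _ <= (l%:R * `|M| * `|h r|) ^+ 2))//.
    by rewrite lerXn2r ?nnegrE ?mulr_ge0// ler_norm_mulmx.
  by rewrite exprMn ler_wpM2l ?sqr_ge0// normsq_norm_le.
Qed.

Lemma vint_pt k a (h : R -> 'cV[R]_k) : vint a a h = 0.
Proof. by apply/colP => i; rewrite !mxE Rint_pt. Qed.

Lemma vintD k a b (f g : R -> 'cV[R]_k) : vinteg a b f -> vinteg a b g ->
  vint a b (fun r => f r + g r) = vint a b f + vint a b g.
Proof.
move=> fi gi; apply/colP => i; rewrite !mxE -RintegralD//; last exact: gi.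
  by apply: Rint_eq => r _; rewrite mxE.
exact: fi.
Qed.

Lemma vintB k a b (f g : R -> 'cV[R]_k) : vinteg a b f -> vinteg a b g ->
  vint a b (fun r => f r - g r) = vint a b f - vint a b g.
Proof.
move=> fi gi; apply/colP => i; rewrite !mxE -RintegralB//; last exact: gi.
  by apply: Rint_eq => r _; rewrite !mxE.
exact: fi.
Qed.

Lemma vint_cst k a b (c : 'cV[R]_k) : a <= b -> vint a b (fun=> c) = (b - a) *: c.
Proof. by move=> ab; apply/colP => i; rewrite !mxE Rint_cst. Qed.

Lemma vint_mulmx k l a b (M : 'M[R]_(k, l)) (h : R -> 'cV[R]_l) : vinteg a b h ->
  vint a b (fun r => M *m h r) = M *m vint a b h.
Proof.
move=> hi; apply/colP => i; rewrite !mxE.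
under eq_Rintegral do rewrite mxE.
rewrite Rint_sum; last by move=> j; exact/integZ/hi.
by apply: eq_bigr => j _; rewrite mxE RintegralZl//; exact: hi.
Qed.

Lemma vinteg_mulmx k l a b (M : 'M[R]_(k, l)) (h : R -> 'cV[R]_l) : vinteg a b h ->
  vinteg a b (fun r => M *m h r).
Proof.
move=> hi i /=; under [X in integ _ _ X]eq_fun do rewrite mxE.
by apply: integ_sum => j; exact/integZ/hi.
Qed.

Lemma vintegD k a b (f g : R -> 'cV[R]_k) : vinteg a b f -> vinteg a b g ->
  vinteg a b (fun r => f r + g r).
Proof.
move=> fi gi i /=; under [X in integ _ _ X]eq_fun do rewrite mxE.
exact: integD (fi i) (gi i).
Qed.

Lemma vintegB k a b (f g : R -> 'cV[R]_k) : vinteg a b f -> vinteg a b g ->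
  vinteg a b (fun r => f r - g r).
Proof.
move=> fi gi i; under [X in integ _ _ X]eq_fun do rewrite !mxE.
exact: integB (fi i) (gi i).
Qed.

Lemma vint_split k a b c (h : R -> 'cV[R]_k) : a <= c -> c <= b -> vinteg a b h ->
  vint a b h = vint a c h + vint c b h.
Proof. by move=> ac cb hi; apply/colP => i; rewrite !mxE; apply: Rint_split. Qed.

Lemma vint_norm_le k a b (h : R -> 'cV[R]_k) M : a <= b -> vinteg a b h -> 0 <= M ->
  (forall r, a <= r <= b -> `|h r| <= M) -> `|vint a b h| <= (b - a) * M.
Proof.
move=> ab hi M0 hM; apply: mx_norm_le => [|i j]; first by rewrite mulr_ge0 ?subr_ge0.
rewrite mxE; apply: Rint_norm_le => // r /hM; apply: le_trans; exact: ler_mx_norm.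
Qed.

Lemma vint_eq k a b (f g : R -> 'cV[R]_k) :
  (forall r, a <= r <= b -> f r = g r) -> vint a b f = vint a b g.
Proof. by move=> fg; apply/colP => i; rewrite !mxE; apply: Rint_eq => r /fg ->. Qed.

Lemma vint_ae k a b (f g : R -> 'cV[R]_k) : vmeas a b f -> vmeas a b g ->
  {ae mu, forall r, a <= r <= b -> f r = g r} -> vint a b f = vint a b g.
Proof.
move=> fm gm fg; apply/colP => i; rewrite !mxE; apply: Rint_ae => //.
by apply: ae_imply fg => r h /h ->.
Qed.

Lemma normsq_vint k a b (h : R -> 'cV[R]_k) : a <= b -> vL2 a b h ->
  normsq (vint a b h) <= (b - a) * \int[mu]_(r in `[a, b]) normsq (h r).
Proof.
move=> ab hL; have hi := vL2_vinteg hL; case: hL => hm h2.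
rewrite /normsq Rint_sum; last by move=> j; exact: h2.
rewrite mulr_sumr; apply: ler_sum => i _; rewrite mxE.
by apply: Rint_CS => //; exact: hi.
Qed.

End vector_integrals.

(** * The drift, and Picard iteration *)

Section drift_estimates.
Context {R : realType} {n : nat}.
Variables (A : 'M[R]_n) (G : 'M[R]_(n, n * n)).

Definition quad (x y : 'cV[R]_n) : 'cV[R]_n := G *m (x *t y).

Lemma quadDl x y z : quad (x + y) z = quad x z + quad y z.
Proof.
rewrite /quad -mulmxDr; congr (_ *m _); apply/matrixP => i j.
by rewrite !mxE mulrDl.
Qed.

Lemma quadDr x y z : quad z (x + y) = quad z x + quad z y.
Proof.
rewrite /quad -mulmxDr; congr (_ *m _); apply/matrixP => i j.
by rewrite !mxE mulrDr.
Qed.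

Lemma quadNl x z : quad (- x) z = - quad x z.
Proof.
rewrite /quad -mulmxN; congr (_ *m _); apply/matrixP => i j.
by rewrite !mxE mulNr.
Qed.

Lemma quadNr x z : quad z (- x) = - quad z x.
Proof.
rewrite /quad -mulmxN; congr (_ *m _); apply/matrixP => i j.
by rewrite !mxE mulrN.
Qed.

(** The dimension factors in [lipA] and [lipG] come from the sup norm, which is submultiplicative
    only up to the inner dimension of the product. *)
Definition lipA := n%:R * `|A|.
Definition lipG := (n * n)%:R * `|G|.

Lemma lipA_ge0 : 0 <= lipA. Proof. by rewrite mulr_ge0. Qed.
Lemma lipG_ge0 : 0 <= lipG. Proof. by rewrite mulr_ge0. Qed.

Lemma norm_quad x y : `|quad x y| <= lipG * `|x| * `|y|.
Proof.
rewrite /quad (le_trans (ler_norm_mulmx _ _))// -[leRHS]mulrA ler_wpM2l ?lipG_ge0//.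
exact: (ler_norm_tens x y).
Qed.

(** [Bmx] is minus the derivative of [drift] at [xt t]. In each Kronecker product with the identity,
    a row has a single column where the identity factor is nonzero, and that column picks the entry
    of [xi] appearing in the tensor product. *)
Lemma BmxM (xt : R -> 'cV[R]_n) t xi :
  Bmx A G xt t *m xi = - (A *m xi + quad (xt t) xi + quad xi (xt t)).
Proof.
have tl (z : 'cV[R]_n) :
    castmx (erefl, mul1n n) (z *t (1%:M : 'M[R]_n)) *m xi = z *t xi.
  apply/matrixP => i j; rewrite !mxE (bigD1 (mxtens_unindex i).2)// big1; last first.
    move=> k /andP[_ ki]; rewrite castmxE cast_ord_id !mxE.
    rewrite [X in (_ == X)](_ : _ = k); first by rewrite eq_sym (negbTE ki) mulr0n mulr0 mul0r.
    by apply: val_inj => /=; rewrite modn_small.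
  rewrite [LHS]addr0 castmxE cast_ord_id !mxE.
  rewrite [X in (_ == X)](_ : _ = (mxtens_unindex i).2); last first.
    by apply: val_inj => /=; rewrite modn_mod.
  rewrite eqxx mulr1n mulr1; congr (z _ _ * xi _ _); by rewrite [LHS]ord1 [RHS]ord1.
have tr (z : 'cV[R]_n) :
    castmx (erefl, muln1 n) ((1%:M : 'M[R]_n) *t z) *m xi = xi *t z.
  apply/matrixP => i j; rewrite !mxE (bigD1 (mxtens_unindex i).1)// big1; last first.
    move=> k /andP[_ ki]; rewrite castmxE cast_ord_id !mxE.
    rewrite [X in (_ == X)](_ : _ = k); first by rewrite eq_sym (negbTE ki) mulr0n !mul0r.
    by apply: val_inj => /=; rewrite divn1.
  rewrite [LHS]addr0 castmxE cast_ord_id !mxE.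
  rewrite [X in (_ == X)](_ : _ = (mxtens_unindex i).1); last first.
    by apply: val_inj => /=; rewrite divn1.
  rewrite eqxx mulr1n mul1r mulrC; congr (xi _ _ * z _ _); by rewrite [LHS]ord1 [RHS]ord1.
by rewrite /Bmx !mulmxBl mulNmx -!mulmxA tl tr !opprD.
Qed.

Local Notation drift := (drift A G).

Lemma drift_sub p q :
  drift p - drift q = A *m (p - q) + quad (p - q) p + quad q (p - q).
Proof.
rewrite /Defs.drift -/(quad p p) -/(quad q q) mulmxBr quadDl quadNl quadDr quadNr.
by apply/colP => i; rewrite !mxE; ring.
Qed.

Lemma drift_lip p q : `|drift p - drift q| <= (lipA + lipG * (`|p| + `|q|)) * `|p - q|.
Proof.
rewrite drift_sub (le_trans (ler_normD _ _))//.
rewrite (le_trans (lerD (ler_normD _ _) (lexx _)))//.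
have h1 := ler_norm_mulmx A (p - q); rewrite -/lipA in h1.
have h2 := norm_quad (p - q) p; have h3 := norm_quad q (p - q).
by rewrite (le_trans (lerD (lerD h1 h2) h3))// le_eqVlt; apply/orP; left; apply/eqP; ring.
Qed.

(** The base point [z] is kept apart from [xt t] because [z] will be [xt r] at an intermediate time
    while [B] is frozen at [t]. The three errors are [h] against [xi], [z] against [xt t], and the
    quadratic remainder. *)
Lemma drift_linearize (xt : R -> 'cV[R]_n) t z h xi :
  `|drift (z + h) - drift z + Bmx A G xt t *m xi| <=
  (lipA + 2 * lipG * `|z|) * `|h - xi| + 2 * lipG * `|z - xt t| * `|xi|
  + lipG * `|h| ^+ 2.
Proof.
have -> : drift (z + h) - drift z + Bmx A G xt t *m xi =
    A *m (h - xi) + quad z (h - xi) + quad (h - xi) z +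
    (quad (z - xt t) xi + quad xi (z - xt t)) + quad h h.
  rewrite drift_sub BmxM (addrC z) addrK quadDr mulmxBr !quadDl !quadDr !quadNl !quadNr.
  by apply/colP => i; rewrite !mxE; ring.
have h1 := ler_norm_mulmx A (h - xi); rewrite -/lipA in h1.
have h2 := norm_quad z (h - xi); have h3 := norm_quad (h - xi) z.
have h4 := norm_quad (z - xt t) xi; have h5 := norm_quad xi (z - xt t).
have h6 := norm_quad h h.
rewrite (le_trans (ler_normD _ _))// (le_trans (lerD (ler_normD _ _) h6))//.
rewrite (le_trans (lerD (lerD (ler_normD _ _) (ler_normD _ _)) (lexx _)))//.
rewrite (le_trans (lerD (lerD (lerD (ler_normD _ _) h3) (lerD h4 h5)) (lexx _)))//.
rewrite (le_trans (lerD (lerD (lerD (lerD h1 h2) (lexx _)) (lexx _)) (lexx _)))//.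
by rewrite le_eqVlt; apply/orP; left; apply/eqP; ring.
Qed.

Lemma vmeas_drift a b (h : R -> 'cV[R]_n) : vmeas a b h ->
  vmeas a b (fun r => drift (h r)).
Proof.
move=> hm; apply: vmeasD; first exact: vmeas_mulmx.
by apply: vmeas_mulmx; exact: vmeas_tens.
Qed.

End drift_estimates.

Section picard.
Context {R : realType}.

Lemma within_continuous_measurable a b (f : R -> R) :
  (forall e, 0 < e -> exists2 d, 0 < d &
    forall u v, a <= u <= b -> a <= v <= b -> `|u - v| < d -> `|f u - f v| < e) ->
  measurable_fun `[a, b] f.
Proof.
move=> fc; apply: subspace_continuous_measurable_fun => //.
apply/subspace_continuousP => x /=; rewrite in_itv/= => xab.
apply/cvgrPdist_lt => e /fc[d d0 fd]; near=> y.
apply: fd => //; near: y.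
- by apply: withinT.
- by apply: cvg_within; exact: nbhsx_ballx.
Unshelve. all: by end_near. Qed.

(** The sequences a_k - 2 * 2^-k and a_k + 2 * 2^-k are monotone in opposite directions, so they
    enclose the limit and give the error bound at the same time. *)
Lemma geometric_cvg (a : nat -> R) : (forall k, `|a k.+1 - a k| <= 2^-1 ^+ k) ->
  exists l, a @ \oo --> l /\ forall k, `|l - a k| <= 2 * 2^-1 ^+ k.
Proof.
move=> ha.
have g0 : (fun k => 2 * 2^-1 ^+ k : R) @ \oo --> 0.
  rewrite -[X in _ --> X](mulr0 2); apply: cvgM; first exact: cvg_cst.
  by apply: cvg_expr; rewrite ger0_norm ?invr_ge0// invf_lt1// ltr1n.
pose b k := a k - 2 * 2^-1 ^+ k; pose c k := a k + 2 * 2^-1 ^+ k.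
have bnd : nondecreasing_seq b.
  apply/nondecreasing_seqP => k; have := ha k; rewrite /b ler_norml exprS; lra.
have cni : nonincreasing_seq c.
  apply/nonincreasing_seqP => k; have := ha k; rewrite /c ler_norml exprS; lra.
have bc k : b k <= c 0%N.
  rewrite (le_trans (_ : _ <= c k))//; last exact: cni.
  rewrite /b /c lerD2l; have : 0 <= 2^-1 ^+ k :> R by rewrite exprn_ge0// invr_ge0.
  lra.
have bub : has_ubound (range b) by exists (c 0%N) => _ [k _ <-].
have bl := nondecreasing_cvgn bnd bub; set l := sup _ in bl.
have al : a @ \oo --> l.
  have H : (fun k => b k + 2 * 2^-1 ^+ k) @ \oo --> l + 0 by exact: cvgD bl g0.
  have E : (fun k => b k + 2 * 2^-1 ^+ k) = a by apply/funext => k; rewrite /b subrK.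
  by move: H; rewrite E addr0.
have cl : c @ \oo --> l by rewrite -[l]addr0; exact: cvgD al g0.
exists l; split => // k; rewrite ler_norml.
have := nondecreasing_cvgn_le bnd (cvgP _ bl) k; rewrite (cvg_lim _ bl)//.
have := nonincreasing_cvgn_ge cni (cvgP _ cl) k; rewrite (cvg_lim _ cl)//.
rewrite /b /c; lra.
Unshelve. all: by end_near. Qed.

Lemma geometric_le0 (c x y : R) : (forall k, x <= y + c * 2^-1 ^+ k) -> x <= y.
Proof.
move=> h; have g0 : (fun k => y + c * 2^-1 ^+ k : R) @ \oo --> y.
  rewrite -[X in _ --> X]addr0 -[X in _ --> _ + X](mulr0 c).
  apply: cvgD; first exact: cvg_cst.
  apply: cvgM; first exact: cvg_cst.
  by apply: cvg_expr; rewrite ger0_norm ?invr_ge0// invf_lt1// ltr1n.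
by apply: (cvgr_to_ge g0); near=> k.
Unshelve. all: by end_near. Qed.

(** A bounded integrand makes the integral Lipschitz in its lower limit, hence measurable. *)
Lemma vmeas_vint k s t (h : R -> 'cV[R]_k) M : vmeas s t h ->
  (forall r, s <= r <= t -> `|h r| <= M) -> vmeas s t (fun u => vint u t h).
Proof.
move=> hm hM i; have [st|ts] := leP s t; last first.
  by rewrite set_itv_ge -?leNgt ?bnd_simp -?ltNge//; exact: measurable_fun_set0.
have M0 : 0 <= M by rewrite (le_trans _ (hM s _))// lexx.
have hi : vinteg s t h := vL2_vinteg (vmeas_bounded_vL2 hm hM).
have key u v : s <= u -> u <= v -> v <= t ->
    `|vint u t h i 0 - vint v t h i 0| <= (v - u) * M.
  move=> su uv vt; rewrite (@vint_split _ _ u t v)//; last exact: vintegS hi.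
  rewrite [X in `|X - _|]mxE addrK (le_trans (ler_mx_norm _ _ _))//.
  apply: vint_norm_le => //; first exact: vintegS hi.
  by move=> r /andP[ur rv]; apply: hM; rewrite (le_trans su)//= (le_trans rv).
apply: within_continuous_measurable => e e0; exists (e / (M + 1)).
  by rewrite divr_gt0// ltr_wpDl.
move=> u v /andP[su ut] /andP[sv vt]; rewrite ltr_pdivlMr ?ltr_wpDl// => uv.
wlog uv' : u v su ut sv vt uv / u <= v.
  move=> H; case: (leP u v) => [|/ltW] ?; first exact: H.
  by rewrite distrC; apply: H => //; rewrite distrC.
rewrite (le_lt_trans (key _ _ su uv' vt))//.
by move: uv; rewrite distrC ger0_norm ?subr_ge0//; nra.
Qed.

(** The iteration runs on measurable functions with values in the unit ball around [p]. The
    condition on [M + L] keeps this set invariant, the one on [L] makes a step contract by 1/2, and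
    the limit is measurable as a pointwise limit. *)
Lemma picard n (f : 'cV[R]_n -> 'cV[R]_n) p s t L M : s <= t -> 0 <= L -> 0 <= M ->
  (forall h, vmeas s t h -> vmeas s t (fun r => f (h r))) ->
  (forall q q', `|q - p| <= 1 -> `|q' - p| <= 1 -> `|f q - f q'| <= L * `|q - q'|) ->
  `|f p| <= M -> (t - s) * (M + L) <= 1 -> (t - s) * L <= 2^-1 ->
  exists x, [/\ vmeas s t x, forall u, s <= u <= t -> `|x u - p| <= 1 &
    forall u, s <= u <= t -> p - x u = vint u t (fun r => f (x r))].
Proof.
move=> st L0 M0 fm flip fpM stML stL.
have fb q : `|q - p| <= 1 -> `|f q| <= M + L.
  move=> qp; rewrite -[f q](subrK (f p)) addrC (le_trans (ler_normD _ _))// lerD//.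
  rewrite (le_trans (flip _ _ qp _)) ?subrr ?normr0//.
  by rewrite -[leRHS]mulr1 ler_wpM2l.
pose step (x : R -> 'cV[R]_n) u := p - vint u t (fun r => f (x r)).
pose inv x := vmeas s t x /\ forall u, s <= u <= t -> `|x u - p| <= 1.
have fxi x : inv x -> vinteg s t (fun r => f (x r)).
  move=> [xm xb]; apply/vL2_vinteg/(vmeas_bounded_vL2 (M := M + L)); first exact: fm.
  by move=> r /xb; exact: fb.
have tu u : s <= u <= t -> 0 <= t - u <= t - s by lra.
have stepi x : inv x -> inv (step x).
  move=> xi; have [xm xb] := xi; split.
    apply: vmeasB; first exact: vmeas_cst.
    by apply: (vmeas_vint (M := M + L)); [exact: fm|move=> r /xb; exact: fb].
  move=> u sut; rewrite /step addrAC subrr add0r normrN.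
  rewrite (le_trans (@vint_norm_le _ _ _ _ _ (M + L) _ _ _ _))//.
  - by case/andP: sut.
  - by apply: vintegS (fxi _ xi) => //; case/andP: sut.
  - exact: addr_ge0.
  - move=> r /andP[ur rt]; apply: fb; apply: xb; rewrite rt andbT.
    by case/andP: sut => su _; exact: le_trans ur.
  - rewrite (le_trans _ stML)// ler_wpM2r ?addr_ge0//.
    by have /andP[] := tu u sut.
have stepc x y c : 0 <= c -> inv x -> inv y ->
    (forall u, s <= u <= t -> `|x u - y u| <= c) ->
    forall u, s <= u <= t -> `|step x u - step y u| <= 2^-1 * c.
  move=> c0 xi yi xyc u sut; have /andP[tu0 tus] := tu u sut.
  have /andP[su ut] := sut.
  have xi' := @vintegS _ _ s t u t _ su (lexx t) (fxi _ xi).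
  have yi' := @vintegS _ _ s t u t _ su (lexx t) (fxi _ yi).
  rewrite /step opprB addrC addrA subrK -vintB//.
  rewrite (le_trans (@vint_norm_le _ _ _ _ _ (L * c) _ _ _ _))//.
  - exact: vintegB.
  - exact: mulr_ge0.
  - move=> r /andP[ur rt]; have sr : s <= r <= t by rewrite rt (le_trans su ur).
    rewrite (le_trans (flip _ _ (yi.2 _ sr) (xi.2 _ sr)))//.
    by rewrite ler_wpM2l// distrC xyc.
  - rewrite mulrA ler_wpM2r// (le_trans _ stL)// ler_wpM2r//.
(* Starting at the constant [p] makes the first increment at most 1, so the k-th one is at most
   2^-k. *)
pose X k := iter k step (fun=> p).
have Xi k : inv (X k).
  elim: k => [|k ih]; last exact: stepi.
  by split=> [|u _]; [exact: vmeas_cst|rewrite subrr normr0].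
have Xc k : forall u, s <= u <= t -> `|X k.+1 u - X k u| <= 2^-1 ^+ k.
  elim: k => [|k ih] u sut; first by rewrite expr0; exact: (Xi 1%N).2.
  have p0 : 0 <= 2^-1 ^+ k :> R by rewrite exprn_ge0// invr_ge0.
  by rewrite exprS; exact: (stepc _ _ _ p0 (Xi k.+1) (Xi k) ih).
have lim u i : s <= u <= t ->
    exists l, (fun k => X k u i 0) @ \oo --> l /\
      forall k, `|l - X k u i 0| <= 2 * 2^-1 ^+ k.
  move=> sut; apply: geometric_cvg => k; rewrite (le_trans _ (Xc k u sut))//.
  by have := ler_mx_norm (X k.+1 u - X k u) i 0; rewrite !mxE.
(* The limit is extended by an arbitrary value outside [s, t], so that a total function can be
   chosen. *)
have limT u i : exists l, s <= u <= t -> (fun k => X k u i 0) @ \oo --> l /\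
      forall k, `|l - X k u i 0| <= 2 * 2^-1 ^+ k.
  have [/lim-/(_ i)[l hl]|nsut] := boolP (s <= u <= t); first by exists l.
  by exists 0.
pose x u : 'cV[R]_n := \col_i sval (cid (limT u i)).
have xX u k : s <= u <= t -> `|x u - X k u| <= 2 * 2^-1 ^+ k.
  move=> sut; apply: mx_norm_le; first by rewrite mulr_ge0// exprn_ge0// invr_ge0.
  move=> i j; rewrite (ord1 j) !mxE; case: cid => l /= hl; exact: (hl sut).2.
have xi : inv x.
  split=> [i|u sut].
    apply: (measurable_fun_cvg (h := fun k u => X k u i 0)) => [k|u /=].
      exact: (Xi k).1.
    by rewrite in_itv/= => sut; rewrite mxE; case: cid => l /= hl; exact: (hl sut).1.
  apply: (@geometric_le0 2) => k; rewrite -[x u](subrK (X k u)) -addrA addrC.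
  rewrite (le_trans (ler_normD _ _))// lerD//; first exact: (Xi k).2.
  exact: xX.
exists x; split; [exact: xi.1|exact: xi.2|] => u sut.
suff : `|p - x u - vint u t (fun r => f (x r))| <= 0.
  by rewrite normr_le0 subr_eq0 => /eqP.
apply: (@geometric_le0 2) => k; rewrite add0r.
(* The defect of [x] is compared with two successive iterates; each of the two differences is at
   most 2^-k. *)
have -> : p - x u - vint u t (fun r => f (x r)) =
    (step x u - X k.+1 u) + (X k.+1 u - x u).
  by rewrite addrA subrK addrAC.
rewrite (le_trans (ler_normD _ _))//.
have h1 : `|step x u - X k.+1 u| <= 2^-1 * (2 * 2^-1 ^+ k).
  have p0 : 0 <= 2 * 2^-1 ^+ k :> R by rewrite mulr_ge0// exprn_ge0// invr_ge0.
  by apply: (stepc x (X k) _ p0 xi (Xi k)) => // v; exact: xX.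
have h2 := xX u k.+1 sut; rewrite distrC exprS in h2; lra.
Qed.

End picard.

(** * Trajectories near the nominal one *)

Section trajectories.
Context {R : realType} {n m : nat}.
Local Notation mu := (@lebesgue_measure R).
Variables (A : 'M[R]_n) (G : 'M[R]_(n, n * n)) (F : 'M[R]_(n, m)).

Local Notation drift := (drift A G).

(* The equation is integrated back from [t], where the terminal condition is set. *)
Definition sol s t (x : R -> 'cV[R]_n) (v : R -> 'cV[R]_m) :=
  [/\ vmeas s t x, exists M, forall r, s <= r <= t -> `|x r| <= M, vL2 s t v &
      forall u, s <= u <= t -> x t - x u = vint u t (fun r => drift (x r) + F *m v r)].

Lemma Rint_normsq_le k s t u u' (h : R -> 'cV[R]_k) : s <= u -> u <= u' -> u' <= t ->
  vL2 s t h -> \int[mu]_(r in `[u, u']) normsq (h r) <= \int[mu]_(r in `[s, t]) normsq (h r).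
Proof.
move=> su uu' u't hL; have hi := vL2_normsq hL.
rewrite (@Rint_split _ s t u)//; [|exact: le_trans u't].
rewrite (@Rint_split _ u t u')//; last exact: integS hi.
rewrite addrCA lerDl addr_ge0// Rint_ge0// => r _; exact: normsq_ge0.
Qed.

(** Cauchy-Schwarz on [u, u'], with the energy enlarged to all of [s, t]. This is the source of
    every Hölder-1/2 estimate. *)
Lemma vint_modulus k s t u u' (h : R -> 'cV[R]_k) : s <= u -> u <= u' -> u' <= t ->
  vL2 s t h -> `|vint u u' h| ^+ 2 <= (u' - u) * \int[mu]_(r in `[s, t]) normsq (h r).
Proof.
move=> su uu' u't hL; have hL' : vL2 u u' h by exact: vL2S hL.
rewrite (le_trans (normsq_norm_le _))// (le_trans (normsq_vint _ _))//.
by rewrite ler_wpM2l ?subr_ge0// (Rint_normsq_le su).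
Qed.

Lemma drift_vL2 s t (x : R -> 'cV[R]_n) M : vmeas s t x ->
  (forall r, s <= r <= t -> `|x r| <= M) -> vL2 s t (fun r => drift (x r)).
Proof.
move=> xm xM; apply: (vmeas_bounded_vL2
    (M := (lipA A + lipG G * M) * M)); first exact: vmeas_drift.
move=> r /xM xr; have := drift_lip A G (x r) 0.
have -> : drift 0 = 0.
  by rewrite /Defs.drift mulmx0 tens0mx mulmx0 addr0.
rewrite !subr0 normr0 addr0 => /le_trans; apply.
apply: ler_pM => //; first by rewrite addr_ge0 ?mulr_ge0 ?lipA_ge0 ?lipG_ge0.
by rewrite lerD2l ler_wpM2l// lipG_ge0.
Qed.

Lemma sol_drift_vinteg s t u u' x v : s <= u -> u' <= t -> sol s t x v ->
  vinteg u u' (fun r => drift (x r)).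
Proof.
move=> su ut [xm [M xM] _ _].
exact: vintegS (vL2_vinteg (drift_vL2 xm xM)).
Qed.

Lemma sol_vL2 s t x v : sol s t x v -> vL2 s t (fun r => drift (x r) + F *m v r).
Proof.
move=> [xm [M xM] vL _]; apply: vL2D; first exact: drift_vL2 xM.
exact: vL2_mulmx.
Qed.

Lemma sol_increment s t x v u u' : sol s t x v -> s <= u -> u <= u' -> u' <= t ->
  x u' - x u = vint u u' (fun r => drift (x r) + F *m v r).
Proof.
move=> xv su uu' u't; have hi := vL2_vinteg (sol_vL2 xv).
case: xv => _ _ _ xE.
have e1 : x t - x u = _ := xE u _; have e2 : x t - x u' = _ := xE u' _.
have {e1}e1 := e1 (introT andP (conj su (le_trans uu' u't))).
have {e2}e2 := e2 (introT andP (conj (le_trans su uu') u't)).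
have := vint_split uu' u't (vintegS su (lexx t) hi); rewrite -e1 -e2 => e3.
by apply: (addIr (x t - x u')); rewrite -e3 addrC addrA subrK.
Qed.

Lemma sol_modulus s t x v u u' : sol s t x v -> s <= u -> u <= u' -> u' <= t ->
  `|x u - x u'| ^+ 2 <= (u' - u) *
    \int[mu]_(r in `[s, t]) normsq (drift (x r) + F *m v r).
Proof.
move=> xv su uu' u't; rewrite distrC (sol_increment xv)//.
by apply: (vint_modulus su) => //; exact: sol_vL2.
Qed.

Lemma sol_uniform_continuous s t x v : sol s t x v -> forall e, 0 < e ->
  exists2 d, 0 < d & forall u u', s <= u -> u <= u' -> u' <= t -> u' - u <= d ->
    `|x u - x u'| <= e.
Proof.
move=> xv e e0.
set N := \int[mu]_(r in `[s, t]) normsq (drift (x r) + F *m v r).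
have N0 : 0 <= N by apply: Rint_ge0 => r _; exact: normsq_ge0.
exists (e ^+ 2 / (N + 1)); first by rewrite divr_gt0 ?exprn_gt0// ltr_wpDl.
move=> u u' su uu' u't; rewrite ler_pdivlMr ?ltr_wpDl// => d.
have := sol_modulus xv su uu' u't; rewrite -/N => h.
rewrite -(@ler_pXn2r _ 2)// ?nnegrE ?(ltW e0)// (le_trans h)//.
by rewrite (le_trans _ d)// ler_wpM2l ?subr_ge0// lerDl.
Qed.

Variables (T X X' : R) (xt : R -> 'cV[R]_n).
Hypothesis xt_sol : forall s t, 0 <= s -> s <= t -> t <= T -> sol s t xt (fun=> 0).
Hypothesis xt_le : forall r, 0 <= r <= T -> `|xt r| <= X.
Hypothesis xt_holder : forall u u' d, 0 <= u -> u <= u' -> u' <= T -> 0 <= d ->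
  u' - u <= d ^+ 2 -> `|xt u - xt u'| <= X' * d.

Lemma sol_sub_increment s t x v u u' : 0 <= s -> t <= T -> sol s t x v ->
  s <= u -> u <= u' -> u' <= t ->
  (x u' - xt u') - (x u - xt u) =
  vint u u' (fun r => drift (x r) - drift (xt r)) + F *m vint u u' v.
Proof.
move=> s0 tT xv su uu' u't.
have zv : sol s t xt (fun=> 0) by apply: xt_sol => //; lra.
have vL : vL2 u u' v by case: xv => _ _ + _; exact: vL2S.
have dx : vinteg u u' (fun r => drift (x r)).
  exact: sol_drift_vinteg xv.
have dz : vinteg u u' (fun r => drift (xt r)).
  exact: sol_drift_vinteg zv.
transitivity ((x u' - x u) - (xt u' - xt u)); first by apply/colP => i; rewrite !mxE; ring.
rewrite (sol_increment xv)// (sol_increment zv)//.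
rewrite (@vint_eq _ _ _ _ (fun r => drift (xt r) + F *m 0) (fun r => drift (xt r))); last first.
  by move=> r _; rewrite mulmx0 addr0.
rewrite vintD//; last exact/vinteg_mulmx/vL2_vinteg.
by rewrite vintB// vint_mulmx; [rewrite addrAC|exact: vL2_vinteg].
Qed.

Lemma X_ge0 : 0 <= T -> 0 <= X.
Proof. by move=> T0; rewrite (le_trans _ (xt_le (r := 0) _))// lexx. Qed.

(* If [v] has L^2 norm at most [k * `|xi|] on [s, t], the trajectory ending at
   [xt t + xi] moves by at most [sqrt (t - s) * apriori_cst k * `|xi|] relative to [xt],
   and [expansion_cst k] is the constant in its first-order expansion. *)
Definition lipD := lipA A + lipG G * (2 * X + 1).
Definition lipF := m%:R * `|F|.
Definition apriori_cst k := 3 * lipD + lipF * k.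
Definition expansion_cst k := (lipA A + 2 * lipG G * X) * apriori_cst k + 2 * lipG G * X' + 4 * lipG G.

Lemma lipD_ge0 : 0 <= X -> 0 <= lipD.
Proof.
by move=> X0; rewrite /lipD addr_ge0 ?lipA_ge0// mulr_ge0 ?lipG_ge0//; lra.
Qed.

Lemma lipF_ge0 : 0 <= lipF.
Proof. by rewrite mulr_ge0. Qed.

Lemma drift_sub_le r x : 0 <= r <= T -> `|x - xt r| <= 1 ->
  `|drift x - drift (xt r)| <= lipD * `|x - xt r|.
Proof.
move=> rT x1; rewrite (le_trans (drift_lip A G _ _))// ler_wpM2r//.
rewrite lerD2l ler_wpM2l ?lipG_ge0//.
have h := xt_le rT; have : `|x| <= `|x - xt r| + `|xt r|.
  by rewrite -[X in `|X| <= _](subrK (xt r)) ler_normD.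
lra.
Qed.

(* Descending from [t] in steps on which the trajectory moves by at most
   [`|xi|], the bound [2 * `|xi|] at the right end of a step gives [3 * `|xi|] on
   the step, which the equation improves to [2 * `|xi|]. *)
Lemma sol_apriori s t x v xi sg k : 0 <= s -> s <= t -> t <= T -> sol s t x v ->
  x t = xt t + xi -> 0 < `|xi| -> 3 * `|xi| <= 1 -> 0 <= sg -> sg <= 1 ->
  t - s <= sg ^+ 2 -> 0 <= k -> sg * apriori_cst k <= 1 ->
  \int[mu]_(r in `[s, t]) normsq (v r) <= (k * `|xi|) ^+ 2 ->
  forall u, s <= u <= t ->
    `|x u - xt u| <= 2 * `|xi| /\ `|x u - xt u - xi| <= sg * apriori_cst k * `|xi|.
Proof.
move=> s0 st tT xv xtE xi0 xi3 sg0 sg1 tsg k0 sgk vk.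
have X0 : 0 <= X by apply: X_ge0; lra.
pose y u := x u - xt u.
have yt : y t = xi by rewrite /y xtE addrAC subrr add0r.
have vL : vL2 s t v by case: xv.
have vle u : s <= u <= t -> `|vint u t v| <= sg * k * `|xi|.
  move=> /andP[su ut]; rewrite -(@ler_pXn2r _ 2)// ?nnegrE ?mulr_ge0//.
  rewrite (le_trans (vint_modulus su ut (lexx t) vL))//.
  rewrite -mulrA exprMn ler_pM//; first by rewrite subr_ge0.
    by apply: Rint_ge0 => r _; exact: normsq_ge0.
  by rewrite (le_trans _ tsg)// lerD2l lerN2.
have step u : s <= u <= t -> (forall r, u <= r <= t -> `|y r| <= 3 * `|xi|) ->
    `|y u - xi| <= sg * apriori_cst k * `|xi|.
  move=> /andP[su ut] yu.
  have := sol_sub_increment s0 tT xv su ut (lexx t); rewrite -/(y t) -/(y u) yt => h.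
  rewrite distrC h (le_trans (ler_normD _ _))//.
  have h1 : `|vint u t (fun r => drift (x r) - drift (xt r))| <= (t - u) * (lipD * (3 * `|xi|)).
    apply: vint_norm_le => //.
    - apply: vintegB; first exact: sol_drift_vinteg xv.
      exact: sol_drift_vinteg (xt_sol s0 st tT).
    - by rewrite !mulr_ge0// lipD_ge0.
    - move=> r /andP[ur rt]; have yr := yu r (introT andP (conj ur rt)).
      rewrite (le_trans (drift_sub_le _ _))//.
      + by rewrite (le_trans s0 (le_trans su ur)) (le_trans rt).
      + by rewrite (le_trans yr).
      + by rewrite ler_wpM2l ?lipD_ge0.
  have h2 : `|F *m vint u t v| <= lipF * (sg * k * `|xi|).
    rewrite (le_trans (ler_norm_mulmx _ _))// ler_wpM2l ?lipF_ge0//.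
    by apply: vle; rewrite su.
  rewrite (le_trans (lerD h1 h2))// /apriori_cst.
  have : (t - u) * (lipD * (3 * `|xi|)) <= sg * (lipD * (3 * `|xi|)).
    rewrite ler_wpM2r//; first by rewrite !mulr_ge0// lipD_ge0.
    by rewrite (le_trans (_ : _ <= t - s)) ?lerD2l ?lerN2// (le_trans tsg)// expr2 ler_piMr.
  by have := lipF_ge0; lra.
have step2 u : s <= u <= t -> (forall r, u <= r <= t -> `|y r| <= 3 * `|xi|) ->
    `|y u| <= 2 * `|xi|.
  move=> su /(step _ su) h; rewrite -[y u](subrK xi) (le_trans (ler_normD _ _))//.
  rewrite mulr_natl mulr2n lerD2r (le_trans h)//.
  by rewrite -[leRHS]mul1r ler_wpM2r// ltW.
have xi20 : 0 < `|xi| / 2 by rewrite divr_gt0.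
(* The step length depends on [xi] and on the trajectory. This is harmless, since the number of
   steps does not enter the bound. *)
have [d1 d10 hd1] := sol_uniform_continuous xv xi20.
have [d2 d20 hd2] := sol_uniform_continuous (xt_sol s0 st tT) xi20.
pose d := Num.min d1 d2.
have d0 : 0 < d by rewrite lt_min d10.
have yd u u' : s <= u -> u <= u' -> u' <= t -> u' - u <= d -> `|y u - y u'| <= `|xi|.
  move=> su uu' u't; rewrite le_min => /andP[ud1 ud2].
  rewrite (_ : y u - y u' = (x u - x u') - (xt u - xt u')).
    rewrite (le_trans (ler_normB _ _))// [leRHS]splitr lerD//; first exact: hd1.
    exact: hd2.
  by apply/colP => i; rewrite !mxE; ring.
have ind N : forall u, s <= u <= t -> t - u <= N%:R * d -> `|y u| <= 2 * `|xi|.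
  elim: N => [|N ih] u sut.
    rewrite mul0r subr_le0 => tu; have -> : u = t by apply/eqP; rewrite eq_le tu andbT; case/andP: sut.
    by rewrite yt ler_peMl// ?ler1n// ltW.
  move=> tuN; have /andP[su ut] := sut.
  apply: step2 => // r /andP[ur rt].
  (* [r'] lies one step to the right of [r], truncated at [t]; the induction hypothesis applies
     there. *)
  pose r' := Num.min t (r + d).
  have rr' : r <= r' by rewrite le_min rt lerDl ltW.
  have r't : r' <= t by rewrite ge_min lexx.
  have r'd : r' - r <= d by rewrite lerBlDl ge_min lexx orbT.
  have : `|y r'| <= 2 * `|xi|.
    apply: ih; first by rewrite r't (le_trans su)// (le_trans ur).
    move: tuN; rewrite -[N.+1]addn1 natrD mulrDl mul1r /r' minEle; case: ifP => _.
      by rewrite subrr => _; rewrite mulr_ge0 ?ler0n// ltW.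
    lra.
  have := yd r r' (le_trans su ur) rr' r't r'd.
  have : `|y r| <= `|y r - y r'| + `|y r'| by rewrite -[X in `|X| <= _](subrK (y r')) ler_normD.
  lra.
have y2 u : s <= u <= t -> `|y u| <= 2 * `|xi|.
  move=> sut; apply: (ind (Num.Def.archi_bound ((t - u) / d))) => //.
  rewrite -ler_pdivrMr//; apply/ltW/archi_boundP; rewrite divr_ge0 ?(ltW d0)//.
  by rewrite subr_ge0; case/andP: sut.
move=> u sut; split; first exact: y2.
apply: step => // r /andP[ur rt]; rewrite (le_trans (y2 _ _))//.
  by rewrite rt andbT (le_trans _ ur)//; case/andP: sut.
by rewrite ler_pM2r// ler_nat.
Qed.

(** Integrates [drift_linearize] with [z = xt r] and [h = x r - xt r]. Its three errors give the
    three summands of [expansion_cst]: the a priori bound and the Hölder bound of [xt] contribute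
    the part with [sg], the quadratic remainder the part with [|xi|]. *)
Lemma sol_expansion s t x v xi sg k : 0 <= s -> s <= t -> t <= T -> sol s t x v ->
  x t = xt t + xi -> 0 < `|xi| -> 3 * `|xi| <= 1 -> 0 <= sg -> sg <= 1 ->
  t - s <= sg ^+ 2 -> 0 <= k -> sg * apriori_cst k <= 1 ->
  \int[mu]_(r in `[s, t]) normsq (v r) <= (k * `|xi|) ^+ 2 ->
  `|x s - xt s - (xi + (t - s) *: (Bmx A G xt t *m xi) - F *m vint s t v)| <=
  (t - s) * (expansion_cst k * (sg + `|xi|) * `|xi|).
Proof.
move=> s0 st tT xv xtE xi0 xi3 sg0 sg1 tsg k0 sgk vk.
have X0 : 0 <= X by apply: X_ge0; lra.
have X'0 : 0 <= X'.
  (* The sign of [X'] is read off the Hölder bound on [0, t], with 1 + t as a positive number whose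
     square is at least t. *)
  have := xt_holder (lexx 0) (le_trans s0 st) tT (d := 1 + t) _ _.
  have t0 := le_trans s0 st.
  have t1 : 0 < 1 + t by rewrite ltr_wpDr.
  move=> /(_ (ltW t1)) h; rewrite -(pmulr_lge0 _ t1) (le_trans _ (h _))//; nra.
have ap := sol_apriori s0 st tT xv xtE xi0 xi3 sg0 sg1 tsg k0 sgk vk.
have := sol_sub_increment s0 tT xv (lexx s) st (lexx t).
rewrite {1}xtE (addrAC (xt t)) subrr add0r => h.
have -> : x s - xt s - (xi + (t - s) *: (Bmx A G xt t *m xi) - F *m vint s t v) =
   - (vint s t (fun r => drift (x r) - drift (xt r)) + vint s t (fun=> Bmx A G xt t *m xi)).
  rewrite vint_cst// (_ : x s - xt s = xi - (xi - (x s - xt s))); last first.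
    by rewrite subKr.
  by rewrite h; apply/colP => i; rewrite !mxE; ring.
have dz : vinteg s t (fun r => drift (x r) - drift (xt r)).
  apply: vintegB; first exact: sol_drift_vinteg xv.
  exact: sol_drift_vinteg (xt_sol s0 st tT).
have cz : vinteg s t (fun=> Bmx A G xt t *m xi) by move=> i; exact: integ_cst.
have k1 : 0 <= apriori_cst k by rewrite addr_ge0 ?mulr_ge0// ?lipD_ge0.
have e0 : 0 <= expansion_cst k.
  by rewrite !addr_ge0 ?mulr_ge0// ?addr_ge0 ?lipA_ge0 ?lipG_ge0 ?mulr_ge0 ?lipG_ge0.
rewrite -vintD// normrN; apply: vint_norm_le => //.
- exact: vintegD.
- by rewrite !mulr_ge0// addr_ge0// ltW.
move=> r srt; have /andP[sr rt] := srt; have [y2 ye] := ap r srt.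
rewrite -[x r](subrK (xt r)) (addrC _ (xt r)).
rewrite (le_trans (drift_linearize A G xt t (xt r) _ xi))//.
have xr : `|xt r| <= X by apply: xt_le; lra.
have xh : `|xt r - xt t| <= X' * sg by apply: xt_holder => //; lra.
have A0 := lipA_ge0 A; have G0 := lipG_ge0 G.
have h1 : (lipA A + 2 * lipG G * `|xt r|) * `|x r - xt r - xi| <=
  (lipA A + 2 * lipG G * X) * (sg * apriori_cst k * `|xi|).
  rewrite ler_pM//; first by rewrite addr_ge0 ?mulr_ge0.
  by rewrite lerD2l ler_wpM2l// mulr_ge0.
have h2 : 2 * lipG G * `|xt r - xt t| * `|xi| <= 2 * lipG G * (X' * sg) * `|xi|.
  by rewrite ler_wpM2r// ler_wpM2l// mulr_ge0.
have h3 : lipG G * `|x r - xt r| ^+ 2 <= lipG G * (4 * `|xi| ^+ 2).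
  rewrite ler_wpM2l//; have := normr_ge0 (x r - xt r); nra.
rewrite (le_trans (lerD (lerD h1 h2) h3))// -subr_ge0 /expansion_cst.
rewrite [X in 0 <= X](_ : _ = (4 * lipG G * sg + ((lipA A + 2 * lipG G * X) * apriori_cst k + 2 * lipG G * X') * `|xi|) * `|xi|); last by ring.
by rewrite mulr_ge0// addr_ge0 ?mulr_ge0// !addr_ge0 ?mulr_ge0// addr_ge0// !mulr_ge0.
Qed.

End trajectories.

(** * Concatenation and dynamic programming *)

Section pasting.
Context {R : realType}.
Local Notation mu := (@lebesgue_measure R).

(** The value at [s] is that of [f], so on [[s, b]] the pasted function agrees with [g] only almost
    everywhere. *)
Definition paste (T : Type) (s : R) (f g : R -> T) r := if r <= s then f r else g r.

Lemma measurable_paste (a s b : R) (f g : R -> R) : a <= s -> s <= b ->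
  measurable_fun `[a, s] f -> measurable_fun `[s, b] g ->
  measurable_fun `[a, b] (paste s f g).
Proof.
move=> as_ sb fm gm; rewrite (@itv_bndbnd_setU _ _ _ (BRight s)) ?bnd_simp//.
apply/measurable_funU => //; split.
  apply: eq_measurable_fun fm => r; rewrite inE/= in_itv/= => /andP[_ rs].
  by rewrite /paste rs.
apply: (@eq_measurable_fun _ _ _ _ _ g).
  move=> r; rewrite inE/= in_itv/= => /andP[rs _].
  by rewrite /paste leNgt rs.
by apply: measurable_funS gm => // r /=; rewrite !in_itv/= => /andP[/ltW -> ->].
Qed.

Lemma paste_ae (T : Type) (s b : R) (f g : R -> T) :
  {ae mu, forall r, s <= r <= b -> paste s f g r = g r}.
Proof.
exists [set s]; split => //; first exact: lebesgue_measure_set1.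
move=> r /=; apply: contra_notP => rs.
move=> /andP[sr _]; rewrite /paste leNgt; move: sr; rewrite le_eqVlt => /predU1P[sr|-> //].
by case: rs.
Qed.

(** The pasted function is the sum of the extensions by zero of [f] from [a, s] and of [g] from ]s,
    b]. *)
Lemma integ_paste (a s b : R) (f g : R -> R) : a <= s -> s <= b ->
  integ a s f -> integ s b g -> integ a b (paste s f g).
Proof.
move=> as_ sb fi gi.
have fi' : integ a b (fun r => paste s f (fun=> 0) r).
  apply: (@eq_integrable _ _ _ mu _ _ ((EFin \o f) \_ `[a, s])) => //.
    move=> r; rewrite inE/= in_itv/= patchE /paste => /andP[ar rb].
    case: ifPn; rewrite ?inE ?notin_setE/= in_itv/= ar/=; first by move=> ->.
    by move/negP/negbTE => ->.
  apply/integrable_restrict => //; apply: integrableS fi => //; exact: measurableI.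
have gi' : integ a b (fun r => paste s (fun=> 0) g r).
  apply: (@eq_integrable _ _ _ mu _ _ ((EFin \o g) \_ `]s, b])) => //.
    move=> r; rewrite inE/= in_itv/= patchE /paste => /andP[ar rb].
    case: ifPn; rewrite ?inE ?notin_setE/= in_itv/= rb andbT; first by rewrite leNgt => ->.
    by move/negP; rewrite -leNgt => ->.
  apply/integrable_restrict => //; apply: integrableS gi => //; first exact: measurableI.
  by move=> r /=; rewrite !in_itv/= => -[_ /andP[/ltW -> ->]].
have -> : paste s f g = (fun r => paste s f (fun=> 0) r + paste s (fun=> 0) g r).
  by apply/funext => r; rewrite /paste; case: ifP => _; rewrite ?addr0 ?add0r.
exact: integD fi' gi'.
Qed.

Lemma Rint_paste (a s b : R) (f g : R -> R) : a <= s -> s <= b ->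
  integ a s f -> integ s b g ->
  \int[mu]_(r in `[a, b]) paste s f g r =
  \int[mu]_(r in `[a, s]) f r + \int[mu]_(r in `[s, b]) g r.
Proof.
move=> as_ sb fi gi; have fgi := integ_paste as_ sb fi gi.
rewrite (@Rint_split _ a b s)//; congr (_ + _).
  by apply: Rint_eq => r /andP[_ rs]; rewrite /paste rs.
apply: Rint_ae; last exact: paste_ae.
  exact: (integ_measurable (integS as_ (lexx b) fgi)).
exact: integ_measurable.
Qed.

Lemma vL2_paste k (a s b : R) (f g : R -> 'cV[R]_k) : a <= s -> s <= b ->
  vL2 a s f -> vL2 s b g -> vL2 a b (paste s f g).
Proof.
move=> as_ sb [fm fi] [gm gi]; split=> i.
  rewrite [X in measurable_fun _ X](_ : _ = paste s (fun r => f r i 0) (fun r => g r i 0)).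
    exact: measurable_paste (fm i) (gm i).
  by apply/funext => r; rewrite /paste; case: ifP.
rewrite [X in integ _ _ X](_ : _ = paste s (fun r => f r i 0 ^+ 2) (fun r => g r i 0 ^+ 2)).
  exact: integ_paste (fi i) (gi i).
by apply/funext => r; rewrite /paste; case: ifP.
Qed.

Lemma vint_paste_left k (a s b : R) (f g : R -> 'cV[R]_k) : b <= s ->
  vint a b (paste s f g) = vint a b f.
Proof.
move=> bs; apply: vint_eq => r /andP[_ rb].
by rewrite /paste (le_trans rb bs).
Qed.

Lemma vint_paste_right k (s b : R) (f g : R -> 'cV[R]_k) : s <= b ->
  vmeas s b (paste s f g) -> vmeas s b g -> vint s b (paste s f g) = vint s b g.
Proof. by move=> sb m1 m2; apply: vint_ae => //; exact: paste_ae. Qed.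

End pasting.

(** * From H^1 solutions to the integral equation *)

Section absolutely_continuous.
Context {R : realType} {n m : nat}.
Local Notation mu := (@lebesgue_measure R).
Variables (A : 'M[R]_n) (G : 'M[R]_(n, n * n)) (F : 'M[R]_(n, m)).
Local Notation drift := (drift A G).

Lemma is_L2E k t (w : R -> 'cV[R]_k) : is_L2 t w <-> vL2 0 t w.
Proof. by split=> [h|[h1 h2] i]; [split=> i; case: (h i)|split; [exact: h1|exact: h2]]. Qed.

Lemma is_H1E k t (x dx : R -> 'cV[R]_k) : is_H1 t x dx <->
  vL2 0 t dx /\ forall s, 0 <= s <= t -> x s = x 0 + vint 0 s dx.
Proof.
split=> -[L xE]; split; try exact/is_L2E.
  by move=> s /xE h; apply/colP => i; rewrite h !mxE.
by move=> s /xE h i; rewrite h !mxE.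
Qed.

(** By Cauchy-Schwarz [x] is Hölder-1/2 with the energy of [dx] as constant, hence uniformly
    continuous and bounded. *)
Lemma H1_regular k t (x dx : R -> 'cV[R]_k) : 0 <= t -> is_H1 t x dx ->
  vmeas 0 t x /\ exists M, forall r, 0 <= r <= t -> `|x r| <= M.
Proof.
move=> t0 /is_H1E[L xE].
have [N N0 hN] : exists2 N, 0 <= N & forall u u', 0 <= u -> u <= u' -> u' <= t ->
    `|x u - x u'| ^+ 2 <= (u' - u) * N.
  exists (\int[mu]_(r in `[0, t]) normsq (dx r)).
    by apply: Rint_ge0 => r _; exact: normsq_ge0.
  move=> u u' u0 uu' u't.
  have -> : x u - x u' = - vint u u' dx.
    rewrite (xE u) ?u0 ?(le_trans uu')// (xE u') ?u't ?(le_trans u0)//.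
    rewrite (@vint_split _ _ 0 u' u)//.
      by apply/colP => i; rewrite !mxE; ring.
    exact: vintegS (lexx 0) u't (vL2_vinteg L).
  by rewrite normrN; exact: (vint_modulus u0).
split=> [i|].
  apply: within_continuous_measurable => e e0; exists (e ^+ 2 / (N + 1)).
    by rewrite divr_gt0 ?exprn_gt0// ltr_wpDl.
  move=> u v ut vt; rewrite ltr_pdivlMr ?ltr_wpDl// => uv.
  have {uv} : `|x u - x v| ^+ 2 < e ^+ 2.
    wlog uv' : u v ut vt uv / u <= v.
      move=> H; case: (leP u v) => [|/ltW] ?; first exact: H.
      by rewrite distrC; apply: H => //; rewrite distrC.
    move: ut vt => /andP[u0 ut] /andP[v0 vt].
    rewrite (le_lt_trans (hN _ _ u0 uv' vt))//.
    by move: uv; rewrite distrC ger0_norm ?subr_ge0//; nra.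
  rewrite ltr_pXn2r ?nnegrE ?(ltW e0)//; apply: le_lt_trans.
  by have := ler_mx_norm (x u - x v) i 0; rewrite !mxE.
(* The inequality a <= a^2 + 1 turns the bound on the squared increment into one without square
   roots. *)
exists (`|x 0| + (t * N + 1)) => r /andP[r0 rt].
rewrite -[x r](subrK (x 0)) addrC (le_trans (ler_normD _ _))// lerD2l distrC.
have := hN _ _ (lexx 0) r0 rt; rewrite subr0 => h.
have : r * N <= t * N by rewrite ler_wpM2r.
have := normr_ge0 (x 0 - x r); nra.
Qed.

(** Integrating the equation removes the weak derivative: the trajectory estimates only use the
    integral form [sol]. *)
Lemma H1_solution_sol t x v : 0 <= t -> vL2 0 t v ->
  H1_solution t (fun s y => drift y + F *m v s) x -> sol A G F 0 t x v.
Proof.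
move=> t0 vL [dx xH dxE]; have [xm [M xM]] := H1_regular t0 xH.
split=> //; first by exists M.
move/is_H1E : xH => [L xE] u /andP[u0 ut].
have -> : x t - x u = vint u t dx.
  rewrite (xE u) ?u0// (xE t) ?t0 ?lexx//.
  rewrite (@vint_split _ _ 0 t u)//; last exact: vL2_vinteg.
  by apply/colP => i; rewrite !mxE; ring.
apply: vint_ae.
- by case: L => dm _; exact: vmeasS dm.
- apply: vmeasS u0 (lexx t) _; apply: vmeasD; first exact: vmeas_drift.
  by apply: vmeas_mulmx; case: vL.
- apply: ae_imply dxE => r h /andP[ur rt]; apply: h.
  by rewrite rt (le_trans u0 ur).
Qed.

End absolutely_continuous.

(** * The dynamic programming principle between two times *)

Section dynamic_programming.
Context {R : realType} {n m q : nat}.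
Local Notation mu := (@lebesgue_measure R).
Variables (T alpha : R) (A : 'M[R]_n) (G : 'M[R]_(n, n * n)) (F : 'M[R]_(n, m)).
Variables (C : 'M[R]_(q, n)) (x0 : 'cV[R]_n) (xt : R -> 'cV[R]_n).
Hypotheses (T_gt0 : 0 < T) (alpha_gt0 : 0 < alpha) (xt_nominal : nominal A G x0 T xt).

Local Notation drift := (drift A G).
Local Notation sol := (sol A G F).
Local Notation admissible := (admissible A G F xt).
Local Notation cost t p := (@Defs.cost R n m q alpha C x0 xt t (fun=> 0) p).
Local Notation V t xi := (fine (value alpha A G F C x0 xt t xi (fun=> 0))).

Lemma vL2_0 k a b : vL2 a b (fun=> 0 : 'cV[R]_k).
Proof.
by apply: (vmeas_bounded_vL2 (M := 0)) => [|r _]; [exact: vmeas_cst|rewrite normr0].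
Qed.

Lemma sol_sub s s' t' t x v : s <= s' -> s' <= t' -> t' <= t ->
  sol s t x v -> sol s' t' x v.
Proof.
move=> ss st tt xv; have [xm [M xM] vL _] := xv; split.
- exact: vmeasS xm.
- by exists M => r /andP[sr rt]; apply: xM; rewrite (le_trans rt) ?(le_trans ss).
- exact: vL2S vL.
- by move=> u /andP[su ut]; apply: (sol_increment xv) => //; exact: le_trans su.
Qed.

Lemma nominal_sol s t : 0 <= s -> s <= t -> t <= T -> sol s t xt (fun=> 0).
Proof.
move=> s0 st tT; apply: sol_sub s0 st tT _.
apply: H1_solution_sol; [exact: ltW|exact: vL2_0|].
have [[dx xH dxE] _] := xt_nominal; exists dx => //.
by apply: ae_imply dxE => r h /h ->; rewrite mulmx0 addr0.
Qed.

Lemma nominal_bounded : exists X, forall r, 0 <= r <= T -> `|xt r| <= X.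
Proof. by have [_ ? _ _] := nominal_sol (lexx 0) (ltW T_gt0) (lexx T). Qed.

(** The constant is the square root of the energy of the nominal velocity on [0, T]. The bound
    [d ^+ 2] on the time difference keeps square roots out of the estimates. *)
Lemma nominal_holder : exists X', forall u u' d, 0 <= u -> u <= u' -> u' <= T ->
  0 <= d -> u' - u <= d ^+ 2 -> `|xt u - xt u'| <= X' * d.
Proof.
have sT := nominal_sol (lexx 0) (ltW T_gt0) (lexx T).
pose N := \int[mu]_(r in `[0, T]) normsq (drift (xt r) + F *m 0).
have N0 : 0 <= N by apply: Rint_ge0 => r _; exact: normsq_ge0.
exists (Num.sqrt N) => u u' d u0 uu' u'T d0 ud.
rewrite -(@ler_pXn2r _ 2)// ?nnegrE ?mulr_ge0 ?sqrtr_ge0//.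
rewrite (le_trans (sol_modulus sT u0 uu' u'T))// exprMn sqr_sqrtr// mulrC.
by rewrite ler_wpM2l.
Qed.

Definition stage_cost (x : R -> 'cV[R]_n) (v : R -> 'cV[R]_m) r :=
  normsq (v r) + alpha * normsq (C *m (x r - xt r)).

Lemma stage_cost_ge0 x v r : 0 <= stage_cost x v r.
Proof. by rewrite addr_ge0 ?mulr_ge0 ?normsq_ge0// ltW. Qed.

Lemma costE t p : cost t p =
  2^-1 * normsq (p.1 0 - x0) + 2^-1 * \int[mu]_(r in `[0, t]) stage_cost p.1 p.2 r.
Proof.
rewrite /Defs.cost; congr (_ + _ * _); apply: Rint_eq => r _.
by rewrite sub0r normsqN.
Qed.

Lemma cost_ge0 t p : 0 <= cost t p.
Proof.
rewrite costE addr_ge0// mulr_ge0 ?normsq_ge0// Rint_ge0// => r _.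
exact: stage_cost_ge0.
Qed.

Lemma sol_vL2_sub s t x v : 0 <= s -> s <= t -> t <= T -> sol s t x v ->
  vL2 s t (fun r => x r - xt r).
Proof.
move=> s0 st tT [xm [M xM] _ _]; have [zm [X zX] _ _] := nominal_sol s0 st tT.
apply: (vmeas_bounded_vL2 (M := M + X)); first exact: vmeasB.
by move=> r sr; rewrite (le_trans (ler_normB _ _))// lerD ?xM ?zX.
Qed.

Lemma stage_cost_integ s t x v : 0 <= s -> s <= t -> t <= T -> sol s t x v ->
  integ s t (stage_cost x v).
Proof.
move=> s0 st tT xv; have [_ _ vL _] := xv.
apply: integD; first exact: vL2_normsq.
by apply: integZ; apply: vL2_normsq; apply: vL2_mulmx; exact: sol_vL2_sub xv.
Qed.

Lemma admissible_sol t xi p : 0 <= t -> admissible t xi p -> sol 0 t p.1 p.2.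
Proof. by move=> t0 [/is_L2E vL xH _]; exact: H1_solution_sol. Qed.

Lemma admissible_restrict s t xi p : 0 <= s -> s <= t -> admissible t xi p ->
  admissible s (p.1 s - xt s) p.
Proof.
move=> s0 st [/is_L2E vL [dx /is_H1E[dL xE] dxE] _]; split.
- by apply/is_L2E; exact: vL2S vL.
- exists dx.
    apply/is_H1E; split; first exact: vL2S dL.
    by move=> r /andP[r0 rs]; apply: xE; rewrite r0 (le_trans rs).
  by apply: ae_imply dxE => r h /andP[r0 rs]; apply: h; rewrite r0 (le_trans rs).
- by rewrite addrC subrK.
Qed.

Lemma cost_split s t xi p : 0 <= s -> s <= t -> t <= T -> admissible t xi p ->
  cost t p = cost s p + 2^-1 * \int[mu]_(r in `[s, t]) stage_cost p.1 p.2 r.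
Proof.
move=> s0 st tT pa; have t0 := le_trans s0 st.
have pi := stage_cost_integ (lexx 0) t0 tT (admissible_sol t0 pa).
by rewrite !costE (@Rint_split _ 0 t s)// mulrDr addrA.
Qed.

(** The two pieces have the same state at [s], so the pasted derivatives integrate to the pasted
    state and no jump arises. *)
Lemma admissible_extend s t zeta p x v : 0 <= s -> s <= t -> t <= T ->
  admissible s zeta p -> sol s t x v -> x s = xt s + zeta ->
  exists2 p', admissible t (x t - xt t) p' &
    cost t p' = cost s p + 2^-1 * \int[mu]_(r in `[s, t]) stage_cost x v r.
Proof.
move=> s0 st tT pa xv xs; have [/is_L2E vL [dx xH dxE] p1s] := pa.
have /is_H1E[dL xE] := xH.
pose x' := paste s p.1 x; pose v' := paste s p.2 v.
pose dx' := paste s dx (fun r => drift (x r) + F *m v r).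
have d2L : vL2 s t (fun r => drift (x r) + F *m v r) := sol_vL2 xv.
have dL' : vL2 0 t dx' by exact: vL2_paste.
have x's : x' s = x s by rewrite /x' /paste lexx p1s xs.
have x't : x' t = x t.
  move: st; rewrite le_eqVlt => /predU1P[<- //|st].
  by rewrite /x' /paste leNgt st.
have p'a : admissible t (x t - xt t) (x', v').
  split.
  - by apply/is_L2E; apply: vL2_paste => //; case: xv.
  - exists dx'; last first.
      apply: ae_imply dxE => r h /andP[r0 rt]; rewrite /dx' /x' /= /paste /v' /paste.
      by have [rs|//] := leP r s; apply: h; rewrite r0.
    apply/is_H1E; split=> // r /andP[r0 rt] /=.
    have x'0 : x' 0 = p.1 0 by rewrite /x' /paste s0.
    have [rs|sr] := leP r s.
      rewrite x'0 vint_paste_left// -xE ?r0//.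
      by rewrite /x' /paste rs.
    rewrite (@vint_split _ _ 0 r s)//; [|exact: ltW|]; last first.
      exact: vintegS (lexx 0) rt (vL2_vinteg dL').
    rewrite x'0 vint_paste_left// addrA -xE ?s0 ?lexx//.
    rewrite vint_paste_right; [|exact: ltW| |]; last 2 first.
    + by case: dL' => dm' _; exact: vmeasS dm'.
    + by case: d2L => dm' _; exact: vmeasS dm'.
    rewrite -(sol_increment xv)//; last exact: ltW.
    by rewrite /x' /paste leNgt sr/= p1s xs addrC subrK.
  - by rewrite /= x't addrC subrK.
exists (x', v') => //.
rewrite !costE /= -addrA -[X in _ = _ + X]mulrDr -Rint_paste//; last 2 first.
- exact: (stage_cost_integ (lexx 0) s0 (le_trans st tT) (admissible_sol s0 pa)).
- exact: stage_cost_integ.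
congr (_ * normsq (_ - _) + _ * _).
- by rewrite /x' /paste s0.
- by apply: Rint_eq => r _; rewrite /stage_cost /x' /v' /paste; case: ifP.
Qed.

Variable delta : R.
Hypothesis exactly_one : forall t : R, 0 < t <= T ->
  forall xi w, data_ball t delta (xi, w) ->
    ocp_exactly_one alpha A G F C x0 xt t xi w.

Lemma data_normE t (xi : 'cV[R]_n) : data_norm t (xi, fun=> 0 : 'cV[R]_q) = enorm xi.
Proof.
rewrite /data_norm /= /L2norm (@Rint_eq _ _ _ _ (fun=> 0)); last first.
  by move=> r _; exact: normsq0.
by rewrite (Rintegral_cst) // mul0r sqrtr0 max_l// sqrtr_ge0.
Qed.

Lemma data_space0 t (xi : 'cV[R]_n) : data_space t (xi, fun=> 0 : 'cV[R]_q).
Proof. exact/is_L2E/vL2_0. Qed.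

(** The existence half of [exactly_one] provides a minimiser. The infimum is therefore attained and
    finite, and [fine] does not alter it. *)
Lemma value_optimal t xi : 0 < t <= T -> enorm xi < delta ->
  exists p, [/\ admissible t xi p, V t xi = cost t p &
                forall p', admissible t xi p' -> V t xi <= cost t p'].
Proof.
move=> tT xid; have tg : 0 < t by case/andP: tT.
have := exactly_one tT (xi := xi) (w := fun=> 0).
case; first by split; [exact: data_space0|rewrite data_normE].
move=> p [pa pmin] _; exists p.
suff -> : V t xi = cost t p by split.
rewrite /value tg; set S := [set _ | _ in _].
suff -> : ereal_inf S = (cost t p)%:E by [].
apply/eqP; rewrite eq_le; apply/andP; split.
  by apply: ereal_inf_lbound; exists p.
by apply: le_ereal_inf_tmp => _ [p' p'a <-]; rewrite lee_fin; exact: pmin.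
Qed.

Lemma value_ge0 t xi : 0 < t <= T -> enorm xi < delta -> 0 <= V t xi.
Proof. by move=> tT xid; have [p [_ -> _]] := value_optimal tT xid; exact: cost_ge0. Qed.

(** The nominal trajectory with zero control costs nothing. *)
Lemma value0 t : 0 < t <= T -> 0 < delta -> V t 0 = 0.
Proof.
move=> tT d0; have e0 : enorm (0 : 'cV[R]_n) < delta by rewrite /enorm normsq0 sqrtr0.
apply/eqP; rewrite eq_le value_ge0// andbT.
have [p [_ _ h]] := value_optimal tT e0; have /andP[tg tT'] := tT.
have pa : admissible t 0 (xt, fun=> 0).
  split; [exact/is_L2E/vL2_0| |by rewrite addr0].
  have [[dx /is_H1E[dL xE] dxE] _] := xt_nominal; exists dx.
    apply/is_H1E; split; first exact: vL2S dL.
    by move=> r /andP[r0 rt]; apply: xE; rewrite r0 (le_trans rt).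
  apply: ae_imply dxE => r hr /andP[r0 rt]; rewrite mulmx0 addr0; apply: hr.
  by rewrite r0 (le_trans rt).
rewrite (le_trans (h _ pa))// costE /= (xt_nominal.2) subrr normsq0 mulr0 add0r.
rewrite (@Rint_eq _ _ _ _ (fun=> 0)); first by rewrite Rintegral_cst// mul0r mulr0.
by move=> r _; rewrite /stage_cost subrr mulmx0 !normsq0 mulr0 addr0.
Qed.

(** An optimal pair for (t, xi), restricted to [0, s], competes in the problem at [s]. The energy
    bound holds because the control energy enters the cost with factor 1/2 next to nonnegative
    terms. *)
Lemma value_dpp_ge s t xi : 0 < s -> s <= t -> t <= T -> enorm xi < delta ->
  exists x v, [/\ sol s t x v, x t = xt t + xi,
    \int[mu]_(r in `[s, t]) normsq (v r) <= 2 * V t xi &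
    enorm (x s - xt s) < delta ->
    V s (x s - xt s) + 2^-1 * \int[mu]_(r in `[s, t]) stage_cost x v r <= V t xi].
Proof.
move=> s0 st tT xid; have tT' : 0 < t <= T by rewrite (lt_le_trans s0 st).
have [[x v] [pa VE _]] := value_optimal tT' xid.
have t0 : 0 <= t by case/andP: tT' => /ltW.
have xv := admissible_sol t0 pa.
have c := cost_split (ltW s0) st tT pa.
have xv' : sol s t x v := sol_sub (ltW s0) st (lexx t) xv.
have ei := stage_cost_integ (ltW s0) st tT xv'.
exists x, v; split => //; first by case: pa.
  have : \int[mu]_(r in `[s, t]) normsq (v r) <= \int[mu]_(r in `[s, t]) stage_cost x v r.
    apply: Rint_le => //; first by apply: vL2_normsq; case: xv'.
    by move=> r _; rewrite lerDl mulr_ge0 ?normsq_ge0// ltW.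
  by move: c; rewrite -VE /=; have := cost_ge0 s (x, v); lra.
move=> xs; have sT : 0 < s <= T by rewrite s0 (le_trans st).
have [p' [_ _ h]] := value_optimal sT xs.
rewrite VE c lerD2r; apply: h.
exact: admissible_restrict (ltW s0) st pa.
Qed.

(** The given arc is appended to an optimal pair of the problem at [s]. *)
Lemma value_dpp_le s t xi x v : 0 < s -> s <= t -> t <= T -> enorm xi < delta ->
  sol s t x v -> x t = xt t + xi -> enorm (x s - xt s) < delta ->
  V t xi <= V s (x s - xt s) + 2^-1 * \int[mu]_(r in `[s, t]) stage_cost x v r.
Proof.
move=> s0 st tT xid xv xtE xs; have sT : 0 < s <= T by rewrite s0 (le_trans st).
have tT' : 0 < t <= T by rewrite (lt_le_trans s0 st).
have [p [pa -> _]] := value_optimal sT xs.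
have [_ [_ _ h]] := value_optimal tT' xid.
have := admissible_extend (ltW s0) st tT pa xv.
rewrite addrC subrK => /(_ erefl)[p' p'a <-]; apply: h.
by move: p'a; rewrite xtE addrAC subrr add0r.
Qed.

End dynamic_programming.

(** * Second-order expansion of the value function *)

Section second_order_taylor.
Context {R : realType}.

(** Used to fit a tolerance to a norm [c] that may vanish, whence the division by [c + 1]. *)
Lemma ler_divD1_mul (e c h : R) : 0 <= e -> 0 <= c -> 0 <= h ->
  e / (c + 1) * (h * c) <= e * h.
Proof.
move=> e0 c0 h0; have c1 : 0 < c + 1 by rewrite ltr_wpDl.
rewrite mulrAC ler_pdivrMr// -mulrA ler_wpM2l//; nra.
Qed.

Lemma is_derive_le (U : normedModType R) (g : U -> R) a v l :
  (forall e, 0 < e -> exists2 d, 0 < d & forall h : R, `|h| < d ->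
    `|g (h *: v + a) - g a - h * l| <= e * `|h|) -> is_derive a v g l.
Proof.
move=> H.
have c : h^-1 *: ((g \o shift a) (h *: v) - g a) @[h --> 0^'] --> l.
  apply/cvgrPdist_le => e /H[d d0 gd]; near=> h.
  have h0 : h != 0 by near: h; exact: nbhs_dnbhs_neq.
  have hd : `|h| < d by near: h; exact: dnbhs0_lt.
  rewrite /= -(ler_pM2l (_ : 0 < `|h|)) ?normr_gt0// -normrM mulrC [leRHS]mulrC.
  rewrite (le_trans _ (gd h hd))// distrC /GRing.scale/= mulrC mulrBr mulrA divff//.
  by rewrite mul1r.
by apply: DeriveDef; [apply/cvg_ex; exists l|exact: cvg_lim c].
Unshelve. all: by end_near. Qed.

Lemma linear_form_delta n (L : 'cV[R]_n -> R) :
  (forall a u v, L (a *: u + v) = a * L u + L v) ->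
  forall k, L k = \sum_j k j 0 * L (delta_mx j 0).
Proof.
move=> Llin k.
have kE : k = \sum_j k j 0 *: delta_mx j 0.
  rewrite {1}(matrix_sum_delta k); apply: eq_bigr => j _.
  by rewrite big_ord1.
have L0 : L 0 = 0.
  by have := Llin 1 0 0; rewrite scale1r addr0 mul1r => h; lra.
rewrite [in LHS]kE; elim/big_rec2 : _ => [//|j y1 y2 _ <-]; exact: Llin.
Qed.

Lemma bilinear_form_mx n (D : 'cV[R]_n -> 'cV[R]_n -> R) :
  (forall a u v k, D (a *: u + v) k = a * D u k + D v k) ->
  (forall a u v h, D h (a *: u + v) = a * D h u + D h v) ->
  forall h k, D h k = (h^T *m (\matrix_(i, j) D (delta_mx i 0) (delta_mx j 0)) *m k) 0 0.
Proof.
move=> Dl Dr h k; rewrite (linear_form_delta (fun a u v => Dr a u v h)) !mxE.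
apply: eq_bigr => j _; rewrite mulrC; congr (_ * _).
rewrite (linear_form_delta (L := fun h => D h (delta_mx j 0))) => [|a u v]; last exact: Dl.
by rewrite mxE; apply: eq_bigr => i _; rewrite !mxE.
Qed.

Variables (n : nat) (f : 'cV[R]_n -> R) (D1 D2 : 'cV[R]_n -> 'cV[R]_n -> R) (delta : R).
Hypothesis delta_gt0 : 0 < delta.
Hypothesis f_ge0 : forall x, `|x| < delta -> 0 <= f x.
Hypothesis f0 : f 0 = 0.
Hypothesis D1_linear : forall x a u v, `|x| < delta ->
  D1 x (a *: u + v) = a * D1 x u + D1 x v.
Hypothesis D2_linearl : forall a u v k, D2 (a *: u + v) k = a * D2 u k + D2 v k.
Hypothesis D2_linearr : forall a u v h, D2 h (a *: u + v) = a * D2 h u + D2 h v.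
Hypothesis f_diff : forall x, `|x| < delta -> forall e, 0 < e ->
  exists2 d, 0 < d & forall h, `|h| < d -> `|f (x + h) - f x - D1 x h| <= e * `|h|.
Hypothesis D1_diff : forall e, 0 < e ->
  exists2 d, 0 < d & forall h, `|h| < d -> forall k,
    `|D1 h k - D1 0 k - D2 h k| <= e * `|h| * `|k|.

Lemma D1Z x a u : `|x| < delta -> D1 x (a *: u) = a * D1 x u.
Proof.
move=> xd; have D0 : D1 x 0 = 0.
  by have := D1_linear 1 0 0 xd; rewrite scale1r addr0 mul1r => h; lra.
by have := D1_linear a u 0 xd; rewrite addr0 D0 addr0.
Qed.

Lemma D2Zl a u k : D2 (a *: u) k = a * D2 u k.
Proof.
have D0 : D2 0 k = 0.
  by have := D2_linearl 1 0 0 k; rewrite scale1r addr0 mul1r => h; lra.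
by have := D2_linearl a u 0 k; rewrite addr0 D0 addr0.
Qed.

Lemma D2Zr a u h : D2 h (a *: u) = a * D2 h u.
Proof.
have D0 : D2 h 0 = 0.
  by have := D2_linearr 1 0 0 h; rewrite scale1r addr0 mul1r => h'; lra.
by have := D2_linearr a u 0 h; rewrite addr0 D0 addr0.
Qed.

Lemma D2Dl u v k : D2 (u + v) k = D2 u k + D2 v k.
Proof. by have := D2_linearl 1 u v k; rewrite scale1r mul1r. Qed.

Lemma D2Dr u v h : D2 h (u + v) = D2 h u + D2 h v.
Proof. by have := D2_linearr 1 u v h; rewrite scale1r mul1r. Qed.

Lemma f_is_derive x v : `|x| < delta -> is_derive x v f (D1 x v).
Proof.
move=> xd; apply: is_derive_le => e e0.
have e1 : 0 < e / (`|v| + 1) by rewrite divr_gt0// ltr_wpDl.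
have [d d0 hd] := f_diff xd e1; exists (d / (`|v| + 1)).
  by rewrite divr_gt0// ltr_wpDl.
move=> h; rewrite ltr_pdivlMr ?ltr_wpDl// => hvd.
have hv : `|h *: v| < d.
  by rewrite normrZ (le_lt_trans _ hvd)// ler_wpM2l// lerDl.
have := hd _ hv; rewrite D1Z// (addrC x) => /le_trans; apply.
by rewrite normrZ ler_divD1_mul// ltW.
Qed.

Lemma norm_lt_near (a v : 'cV[R]_n) : `|a| < delta ->
  exists2 d : R, 0 < d & forall h : R, `|h| < d -> `|h *: v + a| < delta.
Proof.
have v1 : 0 < `|v| + 1 by rewrite ltr_wpDl.
move=> ad; exists ((delta - `|a|) / (`|v| + 1)); first by rewrite divr_gt0// subr_gt0.
move=> h; rewrite ltr_pdivlMr// => hv.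
rewrite (le_lt_trans (ler_normD _ _))// normrZ.
by have := normr_ge0 h; nra.
Qed.

(** [hessian] iterates directional derivatives, so the inner one has to be identified with [D1] at
    all points near 0 before the outer one can be taken. *)
Lemma hessianE : hessian f 0 = \matrix_(i, j) D2 (delta_mx i 0) (delta_mx j 0).
Proof.
apply/matrixP => i j; rewrite !mxE; set v := delta_mx i 0; set u := delta_mx j 0.
suff : is_derive (0 : 'cV[R]_n) v ('D_u f) (D2 v u) by move=> [].
have d0 : `|0 : 'cV[R]_n| < delta by rewrite normr0.
apply: is_derive_le => e e0.
have e1 : 0 < e / (`|v| * `|u| + 1) by rewrite divr_gt0// ltr_wpDl// mulr_ge0.
have [d1 d10 h1] := D1_diff e1.
have [d2 d20 h2] := norm_lt_near v d0.
exists (Num.min (d1 / (`|v| + 1)) d2); first by rewrite lt_min d20 andbT divr_gt0// ltr_wpDl.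
move=> h; rewrite lt_min => /andP[hd1 hd2].
have hv : `|h *: v| < d1.
  move: hd1; rewrite ltr_pdivlMr ?ltr_wpDl// normrZ; apply: le_lt_trans.
  by rewrite ler_wpM2l// lerDl.
have hd := h2 _ hd2.
have /@derive_val -> := f_is_derive u hd; have /@derive_val -> := f_is_derive u d0.
rewrite addr0.
have := h1 _ hv u; rewrite D2Zl => /le_trans; apply.
by rewrite normrZ -mulrA -(mulrA `|h|) ler_divD1_mul ?mulr_ge0// ltW.
Qed.

(** 0 is a minimum: a negative slope D1 0 k would force f (t k) <= t (D1 0 k) / 2 < 0 for small t >
    0. *)
Lemma D1_0 k : D1 0 k = 0.
Proof.
have d0 : `|0 : 'cV[R]_n| < delta by rewrite normr0.
wlog : k / D1 0 k < 0.
  move=> H; have [k0|k0|//] := ltgtP (D1 0 k) 0; first exact: H.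
  have := H (-1 *: k); rewrite D1Z// mulN1r oppr_lt0 => /(_ k0) /eqP.
  by rewrite oppr_eq0 => /eqP.
move=> k0; exfalso.
have e0 : 0 < - D1 0 k / (2 * (`|k| + 1)).
  by rewrite divr_gt0 ?oppr_gt0// mulr_gt0// ltr_wpDl.
have [d1 d10 h1] := f_diff d0 e0.
have [d2 d20 h2] := norm_lt_near k d0.
pose t := Num.min (d1 / (`|k| + 1)) d2 / 2.
have m0 : 0 < Num.min (d1 / (`|k| + 1)) d2.
  by rewrite lt_min d20 andbT divr_gt0// ltr_wpDl.
have t0 : 0 < t by rewrite divr_gt0.
have tm : t < Num.min (d1 / (`|k| + 1)) d2 by rewrite /t ltr_pdivrMr// ltr_pMr// ltr1n.
move: tm; rewrite lt_min => /andP[t1 t2].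
have tk : `|t *: k| < d1.
  move: t1; rewrite ltr_pdivlMr ?ltr_wpDl// normrZ gtr0_norm//; apply: le_lt_trans.
  by rewrite ler_wpM2l ?(ltW t0)// lerDl.
have := h1 _ tk; rewrite add0r f0 subr0 D1Z//.
have ft : 0 <= f (t *: k).
  by apply: f_ge0; have := h2 t; rewrite addr0; apply; rewrite gtr0_norm.
rewrite normrZ gtr0_norm// ler_norml => /andP[_].
have : - D1 0 k / (2 * (`|k| + 1)) * (t * `|k|) <= t * (- D1 0 k / 2).
  have -> : - D1 0 k / (2 * (`|k| + 1)) = - D1 0 k / 2 / (`|k| + 1).
    by rewrite invfM mulrA.
  rewrite [leRHS]mulrC ler_divD1_mul// ?(ltW t0)//.
  by rewrite divr_ge0// oppr_ge0 ltW.
have : t * D1 0 k < 0 by rewrite pmulr_rlt0.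
nra.
Qed.

(* The mean value theorem applied to [s |-> f (h + s k) - s D2 h k - s^2 / 2 D2 k k]. *)
Lemma f_increment e : 0 < e -> exists2 d, 0 < d & forall h k, `|h| < d -> `|k| < d ->
  `|f (h + k) - f h - D2 h k - 2^-1 * D2 k k| <= e * (`|h| + `|k|) * `|k|.
Proof.
move=> e0; have [d1 d10 hd1] := D1_diff e0.
exists (Num.min d1 delta / 2); first by rewrite divr_gt0// lt_min d10.
move=> h k hd kd.
have inb s : 0 <= s -> s <= 1 -> `|h + s *: k| < Num.min d1 delta /\ `|h + s *: k| <= `|h| + `|k|.
  move=> s0 s1; have : `|h + s *: k| <= `|h| + `|k|.
    by rewrite (le_trans (ler_normD _ _))// lerD2l normrZ ger0_norm// ler_piMl.
  by move=> hk; split=> //; lra.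
pose psi s := f (h + s *: k) - s * D2 h k - s ^+ 2 / 2 * D2 k k.
pose dpsi s := D1 (h + s *: k) k - D2 h k - s * D2 k k.
have psiD (s : R) : 0 <= s -> s <= 1 -> is_derive s 1 psi (dpsi s).
  move=> s0 s1; have [] := inb s s0 s1; rewrite lt_min => /andP[_ skd] _.
  apply: is_derive_le => e' e'0; have e'2 : 0 < e' / 2 by rewrite divr_gt0.
  have e1 : 0 < e' / 2 / (`|k| + 1) by rewrite divr_gt0// ltr_wpDl.
  have [d2 d20 h2] := f_diff skd e1.
  exists (Num.min (d2 / (`|k| + 1)) (e' / (`|D2 k k| + 1))).
    by rewrite lt_min !divr_gt0// ltr_wpDl.
  move=> t; rewrite lt_min => /andP[t1 t2].
  have tk : `|t *: k| < d2.
    move: t1; rewrite ltr_pdivlMr ?ltr_wpDl// normrZ; apply: le_lt_trans.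
    by rewrite ler_wpM2l// lerDl.
  have := h2 _ tk; rewrite D1Z// => h3.
  have -> : psi (t *: 1 + s) - psi s - t * dpsi s =
     (f (h + s *: k + t *: k) - f (h + s *: k) - t * D1 (h + s *: k) k) - t ^+ 2 / 2 * D2 k k.
    have -> : h + s *: k + t *: k = h + (t *: 1 + s) *: k.
      by rewrite [t *: 1]mulr1 scalerDl -addrA (addrC (s *: k)).
    by rewrite /psi /dpsi [t *: 1]mulr1; field.
  rewrite (le_trans (ler_normB _ _))//.
  have h4 : e' / 2 / (`|k| + 1) * `|t *: k| <= e' / 2 * `|t|.
    by rewrite normrZ ler_divD1_mul// ltW.
  have h5 : `|t ^+ 2 / 2 * D2 k k| <= e' / 2 * `|t|.
    rewrite normrM normrM normrX (ger0_norm (_ : 0 <= 2^-1))//.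
    move: t2; rewrite ltr_pdivlMr ?ltr_wpDl// => t2.
    have := normr_ge0 t; have := normr_ge0 (D2 k k); nra.
  by rewrite (le_trans (lerD (le_trans h3 h4) h5))// -mulrDl -splitr.
have psic : {within `[0, 1], continuous psi}.
  apply: derivable_within_continuous => s; rewrite in_itv/= => /andP[s0 s1].
  by have [] := psiD s s0 s1.
have psiD' (s : R) : s \in `]0, 1[ -> is_derive s 1 psi (dpsi s).
  by rewrite in_itv/= => /andP[/ltW s0 /ltW s1]; exact: psiD.
have [c] := MVT ltr01 psiD' psic; rewrite in_itv/= => /andP[/ltW c0 /ltW c1].
rewrite subr0 mulr1 /psi scale0r scale1r addr0 expr1n expr0n/= !mul0r !mul1r !subr0 => E.
rewrite (_ : _ - _ - _ - _ = dpsi c); last by rewrite -E; ring.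
have [] := inb c c0 c1; rewrite lt_min => /andP[cd _] cle.
have := hd1 _ cd k; rewrite D1_0 subr0 D2Dl D2Zl opprD addrA => /le_trans; apply.
by rewrite ler_wpM2r// ler_wpM2l// ltW.
Qed.

Lemma f_taylor e : 0 < e -> exists2 d, 0 < d & forall k, `|k| < d ->
  `|f k - 2^-1 * D2 k k| <= e * `|k| ^+ 2.
Proof.
move=> /f_increment[d d0 hd]; exists d => // k kd.
have D0 : D2 0 k = 0 by have := D2Zl 0 0 k; rewrite scale0r mul0r.
have := hd 0 k; rewrite normr0 add0r f0 D0 !subr0 add0r => /(_ d0 kd).
by rewrite expr2 mulrA.
Qed.

(** The difference f (s h + s k) - f (s h) is expanded in two ways: from s h in the direction s k,
    which produces D2 h k, and as a difference of two expansions at 0, which produces the mean of D2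
    h k and D2 k h. The two agree up to o(s^2). *)
Lemma D2_sym h k : D2 h k = D2 k h.
Proof.
suff H e : 0 < e -> `|D2 h k - D2 k h| <= e.
  apply/eqP; rewrite -subr_eq0 -normr_le0; apply/ler_addgt0Pl => e e0.
  by rewrite addr0 H.
(* Three errors, each at most e1 s^2 (|h| + |k| + 1)^2, have to add up to at most s^2 e / 2. *)
move=> e0; pose M := 4 * (`|h| + `|k| + 1) ^+ 2.
have hk0 : 0 < `|h| + `|k| + 1 by rewrite ltr_wpDl// addr_ge0.
have M0 : 0 < M by rewrite mulr_gt0// exprn_gt0.
pose e1 := e / (2 * M).
have e10 : 0 < e1 by rewrite divr_gt0// mulr_gt0.
have [d1 d10 h1] := f_increment e10.
have [d2 d20 h2] := f_taylor e10.
pose s := Num.min d1 d2 / 2 / (`|h| + `|k| + 1).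
have m0 : 0 < Num.min d1 d2 by rewrite lt_min d10.
have s0 : 0 < s by rewrite !divr_gt0.
have sE : s * (`|h| + `|k| + 1) = Num.min d1 d2 / 2 by rewrite /s divfK// gt_eqF.
have small x : `|x| <= `|h| + `|k| -> `|s *: x| < d1 /\ `|s *: x| < d2.
  move=> xhk; have : `|s *: x| < Num.min d1 d2.
    by rewrite normrZ gtr0_norm//; nra.
  by rewrite lt_min => /andP[].
have [sh1 sh2] : `|s *: h| < d1 /\ `|s *: h| < d2 by apply: small; rewrite lerDl.
have [sk1 _] : `|s *: k| < d1 /\ `|s *: k| < d2 by apply: small; rewrite lerDr.
have [_ shk2] : `|s *: (h + k)| < d1 /\ `|s *: (h + k)| < d2.
  by apply: small; exact: ler_normD.
have i1 := h1 _ _ sh1 sk1; have i2 := h2 _ sh2; have i3 := h2 _ shk2.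
rewrite -scalerDr in i1.
have nh : `|h + k| <= `|h| + `|k| := ler_normD _ _.
rewrite !(D2Zl, D2Zr, D2Dl, D2Dr, normrZ, gtr0_norm s0) in i1 i2 i3.
have hh := normr_ge0 h; have hk := normr_ge0 k; have hhk := normr_ge0 (h + k).
have ab := mulr_ge0 hh hk.
have es0 : 0 <= e1 * s ^+ 2 by rewrite mulr_ge0 ?sqr_ge0// ltW.
have b1 : e1 * (s * `|h| + s * `|k|) * (s * `|k|) <= e1 * s ^+ 2 * (`|h| + `|k| + 1) ^+ 2.
  rewrite (_ : e1 * (s * `|h| + s * `|k|) * (s * `|k|) = e1 * s ^+ 2 * ((`|h| + `|k|) * `|k|)); last by ring.
  by apply: ler_wpM2l => //; nra.
have b2 : e1 * (s * `|h|) ^+ 2 <= e1 * s ^+ 2 * (`|h| + `|k| + 1) ^+ 2.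
  by rewrite exprMn mulrA; apply: ler_wpM2l => //; nra.
have b3 : e1 * (s * `|h + k|) ^+ 2 <= e1 * s ^+ 2 * (`|h| + `|k| + 1) ^+ 2.
  by rewrite exprMn mulrA; apply: ler_wpM2l => //; nra.
have key : `|s ^+ 2 * (2^-1 * (D2 h k - D2 k h))| <= 3 * (e1 * s ^+ 2 * (`|h| + `|k| + 1) ^+ 2).
  move: i1 i2 i3; rewrite !ler_norml => /andP[i11 i12] /andP[i21 i22] /andP[i31 i32].
  by apply/andP; split; lra.
have eE : 3 * (e1 * s ^+ 2 * (`|h| + `|k| + 1) ^+ 2) <= s ^+ 2 * (e / 2).
  have -> : 3 * (e1 * s ^+ 2 * (`|h| + `|k| + 1) ^+ 2) = s ^+ 2 * (3 / 8 * e).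
    by rewrite /e1 /M; field; rewrite gt_eqF.
  by rewrite ler_wpM2l ?sqr_ge0//; lra.
have := le_trans key eE; rewrite normrM ger0_norm ?sqr_ge0// ler_pM2l ?exprn_gt0//.
by rewrite normrM ger0_norm//; lra.
Qed.

Lemma hessian_sym : (hessian f 0)^T = hessian f 0.
Proof. by rewrite hessianE; apply/matrixP => i j; rewrite !mxE D2_sym. Qed.

Lemma hessian_taylor e : 0 < e -> exists2 d, 0 < d & forall k, `|k| < d ->
  `|f k - 2^-1 * (k^T *m hessian f 0 *m k) 0 0| <= e * `|k| ^+ 2.
Proof.
move=> /f_taylor[d d0 hd]; exists d => // k /hd.
by rewrite hessianE -bilinear_form_mx.
Qed.

End second_order_taylor.

(** * Taylor expansion of the value function *)

Section value_taylor.
Context {R : realType} {n m q : nat}.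
Variables (T alpha : R) (A : 'M[R]_n) (G : 'M[R]_(n, n * n)) (F : 'M[R]_(n, m)).
Variables (C : 'M[R]_(q, n)) (x0 : 'cV[R]_n) (xt : R -> 'cV[R]_n) (delta : R).
Hypotheses (alpha_gt0 : 0 < alpha) (xt_nominal : nominal A G x0 T xt).
Hypothesis delta_gt0 : 0 < delta.
Hypothesis exactly_one : forall t : R, 0 < t <= T ->
  forall xi w, data_ball t delta (xi, w) ->
    ocp_exactly_one alpha A G F C x0 xt t xi w.
Hypothesis value_smooth : forall t : R, 0 < t <= T ->
  smooth_on (data_space t) (data_norm t) (data_ball t delta)
    (fun p => fine (value alpha A G F C x0 xt t p.1 p.2)).

Local Notation V t xi := (fine (value alpha A G F C x0 xt t xi (fun=> 0))).
Local Notation P := (value_hessian alpha A G F C x0 xt).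
Local Notation inj u := ((u, fun=> 0) : 'cV[R]_n * (R -> 'cV[R]_q)).

Lemma inj_lin a (u v : 'cV[R]_n) : a *: inj u + inj v = inj (a *: u + v).
Proof.
congr pair; apply/funext => r /=.
by change (a *: (0 : 'cV[R]_q) + 0 = 0); rewrite scaler0 addr0.
Qed.

Lemma enorm_lt (x : 'cV[R]_n) : `|x| < delta / (n%:R + 1) -> enorm x < delta.
Proof.
rewrite ltr_pdivlMr ?ltr_wpDl// mulrC; apply: le_lt_trans; exact: enorm_le.
Qed.

Lemma data_ball_inj t x : enorm x < delta -> data_ball t delta (inj x).
Proof. by move=> xd; split; [exact: data_space0|rewrite data_normE]. Qed.

(** The derivatives in (xi, omega) are restricted to the slice omega = 0. There [data_norm] is the
    Euclidean norm, and passing to the sup norm costs a factor [n + 1] for each vector argument. *)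
Lemma value_hessian_taylor t : 0 < t <= T -> (P t)^T = P t /\
  forall e, 0 < e -> exists2 d, 0 < d & forall xi, `|xi| < d ->
    `|V t xi - 2^-1 * (xi^T *m P t *m xi) 0 0| <= e * `|xi| ^+ 2.
Proof.
move=> tT; have [D [D0 Dlin _ Ddiff]] := value_smooth tT.
pose f xi := V t xi.
pose D1 x h := D (inj x) [:: inj h].
(* [smooth_on] puts the newest direction at the head: [h] is the increment of the base point and [k]
   the direction of the first derivative. *)
pose D2 h k := D (inj 0) [:: inj h; inj k].
pose d' := delta / (n%:R + 1).
have n1 : 0 < n%:R + 1 :> R by rewrite ltr_wpDl.
have d'0 : 0 < d' by rewrite divr_gt0.
have ball x : `|x| < d' -> data_ball t delta (inj x).
  by move=> /enorm_lt; exact: data_ball_inj.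
have ball0 : data_ball t delta (inj 0) by apply: ball; rewrite normr0.
have L x : data_space t (inj x) by exact: data_space0.
have f_ge0 x : `|x| < d' -> 0 <= f x.
  move=> /enorm_lt xd.
  exact: (value_ge0 alpha_gt0 exactly_one tT xd).
have f0 : f 0 = 0 by exact: (value0 alpha_gt0 xt_nominal exactly_one tT delta_gt0).
have D1l x a u v : `|x| < d' -> D1 x (a *: u + v) = a * D1 x u + D1 x v.
  by move=> /ball xb; have := Dlin _ xb [::] [::] a (inj u) (inj v); rewrite inj_lin; apply.
have D2l a u v k : D2 (a *: u + v) k = a * D2 u k + D2 v k.
  have := Dlin _ ball0 [::] [:: inj k] a (inj u) (inj v); rewrite inj_lin; apply => //.
  by move=> w; rewrite inE => /eqP ->.
have D2r a u v h : D2 h (a *: u + v) = a * D2 h u + D2 h v.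
  have := Dlin _ ball0 [:: inj h] [::] a (inj u) (inj v); rewrite inj_lin; apply => //.
  by move=> w; rewrite inE => /eqP ->.
have injD x h : inj x + inj h = inj (x + h).
  by rewrite -[inj x]scale1r inj_lin scale1r.
have f_diff x : `|x| < d' -> forall e, 0 < e -> exists2 d, 0 < d & forall h,
    `|h| < d -> `|f (x + h) - f x - D1 x h| <= e * `|h|.
  move=> xd e e0; have e1 : 0 < e / (n%:R + 1) by rewrite divr_gt0.
  have [d d0 hd] := Ddiff _ (ball _ xd) 0%N _ e1.
  exists (Num.min (d / (n%:R + 1)) (d' - `|x|)); first by rewrite lt_min divr_gt0// subr_gt0.
  move=> h; rewrite lt_min => /andP[h1 h2].
  have xh : `|x + h| < d' by rewrite (le_lt_trans (ler_normD _ _))// addrC -ltrBrDr.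
  have hN : data_norm t (inj h) < d.
    rewrite data_normE (le_lt_trans (enorm_le _))// mulrC -ltr_pdivlMr//.
  have := hd _ (L h) hN; rewrite injD => /(_ (ball _ xh) [::] erefl).
  rewrite D0; last exact: ball.
  rewrite D0; last exact: ball.
  rewrite big_nil mulr1 data_normE => H; rewrite (le_trans (H _))//.
  rewrite mulrAC ler_pdivrMr// -mulrA ler_wpM2l ?(ltW e0)// mulrC; exact: enorm_le.
have D1_diff e : 0 < e -> exists2 d, 0 < d & forall h, `|h| < d -> forall k,
    `|D1 h k - D1 0 k - D2 h k| <= e * `|h| * `|k|.
  move=> e0; have e1 : 0 < e / (n%:R + 1) ^+ 2 by rewrite divr_gt0// exprn_gt0.
  have [d d0 hd] := Ddiff _ ball0 1%N _ e1.
  exists (Num.min (d / (n%:R + 1)) d'); first by rewrite lt_min divr_gt0.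
  move=> h; rewrite lt_min => /andP[h1 h2] k.
  have hN : data_norm t (inj h) < d.
    by rewrite data_normE (le_lt_trans (enorm_le _))// mulrC -ltr_pdivlMr.
  have := hd _ (L h) hN; rewrite injD add0r => /(_ (ball _ h2) [:: inj k] erefl) H.
  have Lk w : w \in [:: inj k] -> data_space t w by rewrite inE => /eqP ->.
  have {}H := H Lk.
  rewrite (le_trans H)//.
  rewrite big_seq1 !data_normE.
  have -> : e * `|h| * `|k| =
      e / (n%:R + 1) ^+ 2 * ((n%:R + 1) * `|h|) * ((n%:R + 1) * `|k|).
    by field; rewrite gt_eqF.
  apply: ler_pM; [|exact: sqrtr_ge0| |exact: enorm_le].
    by apply: mulr_ge0; [exact: ltW|exact: sqrtr_ge0].
  by apply: ler_wpM2l; [exact: ltW|exact: enorm_le].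
have sym := hessian_sym d'0 f_ge0 f0 D1l D2l D2r f_diff D1_diff.
split; first exact: sym.
exact: (hessian_taylor d'0 f_ge0 f0 D1l D2l D2r f_diff D1_diff).
Qed.

End value_taylor.

(** * Quadratic and bilinear forms in the sup norm *)

Section quadratic_forms.
Context {R : realType}.

Definition qf k (M : 'M[R]_k) (x : 'cV[R]_k) : R := (x^T *m M *m x) 0 0.
Definition bf k (M : 'M[R]_k) (x y : 'cV[R]_k) : R := (x^T *m M *m y) 0 0.

Lemma qfB k (M N : 'M[R]_k) x : qf (M - N) x = qf M x - qf N x.
Proof. by rewrite /qf mulmxBr mulmxBl !mxE. Qed.

Lemma qfD k (M N : 'M[R]_k) x : qf (M + N) x = qf M x + qf N x.
Proof. by rewrite /qf mulmxDr mulmxDl !mxE. Qed.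

Lemma qfZ k a (M : 'M[R]_k) x : qf (a *: M) x = a * qf M x.
Proof. by rewrite /qf -scalemxAr -scalemxAl !mxE. Qed.

Lemma qf_scale k a (M : 'M[R]_k) x : qf M (a *: x) = a ^+ 2 * qf M x.
Proof.
have xaT : (a *: x)^T = a *: x^T by apply/matrixP => i j; rewrite !mxE.
by rewrite /qf xaT -!scalemxAl -scalemxAr !mxE mulrA.
Qed.

Lemma bfDr k (M : 'M[R]_k) x y z : bf M x (y + z) = bf M x y + bf M x z.
Proof. by rewrite /bf mulmxDr !mxE. Qed.

Lemma bfNr k (M : 'M[R]_k) x y : bf M x (- y) = - bf M x y.
Proof. by rewrite /bf mulmxN !mxE. Qed.

Lemma bfZr k a (M : 'M[R]_k) x y : bf M x (a *: y) = a * bf M x y.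
Proof. by rewrite /bf -scalemxAr !mxE. Qed.

Lemma bf_sym k (M : 'M[R]_k) x y : M^T = M -> bf M x y = bf M y x.
Proof.
move=> Ms; have -> : bf M x y = ((x^T *m M *m y)^T) 0 0 by rewrite mxE.
by rewrite !trmx_mul trmxK Ms mulmxA.
Qed.

Lemma qf_add k (M : 'M[R]_k) x h : M^T = M ->
  qf M (x + h) = qf M x + 2 * bf M x h + qf M h.
Proof.
move=> Ms; have hx := bf_sym h x Ms.
have -> : qf M (x + h) = qf M x + bf M h x + (bf M x h + qf M h).
  have xhT : (x + h)^T = x^T + h^T by apply/matrixP => i j; rewrite !mxE.
  rewrite /qf /bf xhT mulmxDr !mulmxDl !mxE; ring.
by rewrite hx; ring.
Qed.

Lemma bf_le k (M : 'M[R]_k) x y : `|bf M x y| <= k%:R ^+ 2 * `|M| * `|x| * `|y|.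
Proof.
rewrite /bf (le_trans (ler_mx_norm _ _ _))// (le_trans (ler_norm_mulmx _ _))//.
rewrite (_ : k%:R ^+ 2 * `|M| * `|x| * `|y| = k%:R * (k%:R * `|x| * `|M|) * `|y|); last by ring.
rewrite ler_wpM2r// ler_wpM2l//.
by have := ler_norm_mulmx x^T M; rewrite norm_trmx.
Qed.

Lemma qf_le k (M : 'M[R]_k) x : `|qf M x| <= k%:R ^+ 2 * `|M| * `|x| ^+ 2.
Proof. by rewrite expr2 mulrA; exact: bf_le. Qed.

Lemma norm_delta_mx k l (i : 'I_k) (j : 'I_l) : `|delta_mx i j : 'M[R]_(k, l)| <= 1.
Proof.
by apply: mx_norm_le => // a b; rewrite mxE; case: (_ && _); rewrite ?normr1// normr0.
Qed.

Lemma bf_delta k (M : 'M[R]_k) i j : bf M (delta_mx i 0) (delta_mx j 0) = M i j.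
Proof. by rewrite /bf trmx_delta -rowE -colE !mxE. Qed.

(** Polarisation on unit vectors: twice an entry is qf (u + v) - qf u - qf v with |u + v| <= 2, and
    (4 + 1 + 1) / 2 = 3. *)
Lemma sym_norm_le k (M : 'M[R]_k) c : 0 <= c -> M^T = M ->
  (forall x, `|qf M x| <= c * `|x| ^+ 2) -> `|M| <= 3 * c.
Proof.
move=> c0 Ms H; apply: mx_norm_le => [|i j]; first by rewrite mulr_ge0.
set u : 'cV[R]_k := delta_mx i 0; set v : 'cV[R]_k := delta_mx j 0.
have u1 : `|u| <= 1 by exact: norm_delta_mx.
have v1 : `|v| <= 1 by exact: norm_delta_mx.
have uv : `|u + v| <= 2 by rewrite (le_trans (ler_normD _ _))//; lra.
have := qf_add u v Ms; rewrite bf_delta => E.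
have := H u; have := H v; have := H (u + v).
have u2 : c * `|u| ^+ 2 <= c * 1.
  by rewrite ler_wpM2l// expr_le1.
have v2 : c * `|v| ^+ 2 <= c * 1.
  by rewrite ler_wpM2l// expr_le1.
have uv2 : c * `|u + v| ^+ 2 <= c * 4.
  by rewrite ler_wpM2l//; have := normr_ge0 (u + v); nra.
by rewrite !ler_norml => /andP[? ?] /andP[? ?] /andP[? ?]; apply/andP; split; lra.
Qed.

Lemma sym_lin k a (M1 M2 M3 : 'M[R]_k) : M1^T = M1 -> M2^T = M2 -> M3^T = M3 ->
  (M1 + a *: M2 - M3)^T = M1 + a *: M2 - M3.
Proof.
have e (M : 'M[R]_k) i j : M^T = M -> M j i = M i j by move=> h; rewrite -[in RHS]h mxE.
move=> h1 h2 h3; apply/matrixP => i j.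
by rewrite !mxE (e M1 i j h1) (e M2 i j h2) (e M3 i j h3).
Qed.

(** Both sides are homogeneous of degree two, so arbitrarily small vectors decide. The radius may
    depend on [e] and on everything else held fixed, which is how Taylor expansions that are not
    uniform in time become usable. *)
Lemma qf_small k (M : 'M[R]_k) c :
  (forall e, 0 < e -> exists2 d, 0 < d & forall x, 0 < `|x| -> `|x| < d ->
    qf M x <= (c + e) * `|x| ^+ 2) ->
  forall x, qf M x <= c * `|x| ^+ 2.
Proof.
move=> H x; have [->|x0] := eqVneq x 0.
  by rewrite normr0 expr0n mulr0 /qf mulmx0 mxE.
have nx : 0 < `|x| by rewrite normr_gt0.
have x2 : 0 < `|x| ^+ 2 by rewrite exprn_gt0.
rewrite -ler_pdivrMr//; apply/ler_addgt0Pl => e e0.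
have [d d0 hd] := H _ e0.
pose a := d / 2 / `|x|.
have a0 : 0 < a by rewrite !divr_gt0.
have nax : `|a *: x| = d / 2 by rewrite normrZ gtr0_norm// divfK// gt_eqF.
clearbody a; have := hd (a *: x); rewrite nax => h.
have h1 : 0 < d / 2 by rewrite divr_gt0.
have h2 : d / 2 < d by rewrite ltr_pdivrMr// ltr_pMr// ltr1n.
have := h h1 h2; rewrite qf_scale -nax normrZ gtr0_norm// exprMn mulrCA ler_pM2l ?exprn_gt0//.
by rewrite ler_pdivrMr// addrC.
Qed.

End quadratic_forms.

(** * One step of the Riccati equation *)

Section step_arithmetic.
Context {R : realType}.
Implicit Types (a b c e g p r v x : R).

(* [v] and [vs] stand for the values at [(t, xi)] and [(s, y)], where [y] is the
   state at [s]; [p], [a] and [qy] for the quadratic forms of [P t] at [xi], [P s] at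
   [xi] and [P s] at [y]; [I] and [J] for the integrated stage cost and control
   energy; [x] for [`|xi| ^+ 2]. *)
Lemma double_value_le a e p v x : `|v - 2^-1 * p| <= e * x -> p <= a * x ->
  e <= 1 -> 0 <= x -> 2 * v <= (a + 2) * x.
Proof.
move=> /ler_normlP[_ vp] pa e1 x0; have : e * x <= 1 * x by rewrite ler_wpM2r.
lra.
Qed.

(** The 10 is 2 (1 + 4): the Taylor error at [xi] plus the one at [y], where |y| <= 2 |xi|, both
    doubled to clear the factor 1/2. *)
Lemma lower_arith a b c g gw p r v vs qy bq qh (J I tau e x k : R) :
  `|v - 2^-1 * p| <= e * x -> `|vs - 2^-1 * qy| <= 4 * e * x ->
  vs + 2^-1 * I <= v -> `|I - (J + tau * c)| <= tau * r ->
  qy = a + 2 * (tau * b - gw + bq) + qh -> 0 <= qh -> 2 * gw - tau * g <= J ->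
  2 * `|bq| <= k * x ->
  a + tau * (2 * b - g + c) - p <= k * x + tau * r + 10 * e * x.
Proof.
move=> /ler_normlP[_ h1] /ler_normlP[h2 _] h3 /ler_normlP[h4 _] h5 h6 h7 h8.
have := ler_norm (- bq); rewrite normrN; lra.
Qed.

(** [e1] occurs eleven times, which a tolerance of [20 * e1] covers. The [k3] term is added for free
    here, so that the lower and the upper bound share one constant. *)
Lemma step_err_arith (k1 k2 k3 alpha' tau sg kp e1 e x : R) :
  0 <= k3 * (tau * sg) * x -> 20 * e1 * x <= e * x -> 0 <= e1 * x ->
  (2 * k1 * (tau * sg) + e1) * x + tau * (alpha' * (k2 * (sg * kp) * x)) + 10 * e1 * x <=
  ((2 * k1 + alpha' * k2 * kp + k3) * (tau * sg) + e) * x.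
Proof. by lra. Qed.

Lemma step_err_arith' (k1 k2 k3 alpha' tau sg kp e1 e x : R) :
  20 * e1 * x <= e * x -> 0 <= e1 * x ->
  (2 * k1 * (tau * sg) + e1) * x + tau * (alpha' * (k2 * (sg * kp) * x))
    + k3 * (tau * sg) * x + 10 * e1 * x <=
  ((2 * k1 + alpha' * k2 * kp + k3) * (tau * sg) + e) * x.
Proof. by lra. Qed.

Lemma upper_arith a b c g gw p r v vs qy bq qh h (J I tau e x k : R) :
  `|v - 2^-1 * p| <= e * x -> `|vs - 2^-1 * qy| <= 4 * e * x ->
  v <= vs + 2^-1 * I -> `|I - (J + tau * c)| <= tau * r ->
  qy = a + 2 * (tau * b - gw + bq) + qh -> qh <= h -> J = tau * g -> gw = tau * g ->
  2 * `|bq| <= k * x ->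
  p - (a + tau * (2 * b - g + c)) <= k * x + tau * r + h + 10 * e * x.
Proof.
move=> /ler_normlP[h1 _] /ler_normlP[_ h2] h3 /ler_normlP[_ h4] h5 h6 h7 h8 h9.
have := ler_norm bq; lra.
Qed.

(** The case of zero control: 4 [a] comes from |y| <= 2 |xi|, and 4 [b] from the tracking cost at
    [xi] together with its error of at most 3 [b]. *)
Lemma bound_arith a b c p v vs qy (I J tau e x r : R) :
  `|v - 2^-1 * p| <= e * x -> `|vs - 2^-1 * qy| <= 4 * e * x ->
  v <= vs + 2^-1 * I -> `|I - (J + tau * c)| <= tau * r -> J = 0 ->
  qy <= a * (4 * x) -> 0 <= tau -> tau <= 1 -> c <= b * x -> r <= 3 * b * x -> 0 <= b * x ->
  p <= (4 * a + 4 * b + 10 * e) * x.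
Proof.
move=> /ler_normlP[h1 _] /ler_normlP[_ h2] h3 /ler_normlP[_ h4] h5 h6 h7 h8 h9 h10 h11.
have t1 : tau * (c + r) <= tau * (4 * b * x) by rewrite ler_wpM2l//; lra.
have t2 : tau * (4 * b * x) <= 4 * b * x by rewrite ler_piMl//; lra.
lra.
Qed.

End step_arithmetic.

Section riccati_step.
Context {R : realType} {n m q : nat}.
Local Notation mu := (@lebesgue_measure R).
Variables (T alpha : R) (A : 'M[R]_n) (G : 'M[R]_(n, n * n)) (F : 'M[R]_(n, m)).
Variables (C : 'M[R]_(q, n)) (x0 : 'cV[R]_n) (xt : R -> 'cV[R]_n) (delta X X' : R).
Hypotheses (T_gt0 : 0 < T) (alpha_gt0 : 0 < alpha) (xt_nominal : nominal A G x0 T xt).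
Hypothesis delta_gt0 : 0 < delta.
Hypothesis exactly_one : forall t : R, 0 < t <= T ->
  forall xi w, data_ball t delta (xi, w) ->
    ocp_exactly_one alpha A G F C x0 xt t xi w.
Hypothesis value_smooth : forall t : R, 0 < t <= T ->
  smooth_on (data_space t) (data_norm t) (data_ball t delta)
    (fun p => fine (value alpha A G F C x0 xt t p.1 p.2)).
Hypothesis xt_le : forall r, 0 <= r <= T -> `|xt r| <= X.
Hypothesis xt_holder : forall u u' d, 0 <= u -> u <= u' -> u' <= T -> 0 <= d ->
  u' - u <= d ^+ 2 -> `|xt u - xt u'| <= X' * d.

Local Notation V t xi := (fine (value alpha A G F C x0 xt t xi (fun=> 0))).
Local Notation P := (value_hessian alpha A G F C x0 xt).
Local Notation B := (Bmx A G xt).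
Local Notation sol := (sol A G F).
Local Notation stage_cost := (stage_cost alpha C xt).
Local Notation apriori_cst := (apriori_cst A G F X).
Local Notation expansion_cst := (expansion_cst A G F X X').

Let xt_sol s t : 0 <= s -> s <= t -> t <= T -> sol s t xt (fun=> 0) :=
  @nominal_sol _ _ _ T A G F x0 xt T_gt0 xt_nominal s t.

Let X0 : 0 <= X.
Proof. by apply: le_trans (normr_ge0 (xt 0)) (xt_le _); rewrite lexx ltW. Qed.

Let X'0 : 0 <= X'.
Proof.
have := xt_holder (lexx 0) (lexx 0) (ltW T_gt0) (@ler01 R).
rewrite subrr => /(_ _)/(le_trans (normr_ge0 _)); rewrite mulr1; apply.
by rewrite expr1n.
Qed.

(** The matrix and the time are separate arguments because a step evaluates this with [P s] and
    [B t]. *)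
Definition riccati (Q : 'M[R]_n) t : 'M[R]_n :=
  Q *m B t + (B t)^T *m Q - Q *m F *m F^T *m Q + alpha *: (C^T *m C).

Definition lipC := n%:R * `|C|.
Definition lipB := lipA A + 2 * lipG G * X.
Definition feedback (Q : 'M[R]_n) (x : 'cV[R]_n) : 'cV[R]_m := F^T *m Q *m x.

Let A0 := lipA_ge0 A.
Let G0 := lipG_ge0 G.
Let F0 := lipF_ge0 F.

Let lipC0 : 0 <= lipC. Proof. by rewrite mulr_ge0. Qed.
Let lipB0 : 0 <= lipB. Proof. by rewrite addr_ge0// !mulr_ge0. Qed.

Let apriori_cst_ge0 k : 0 <= k -> 0 <= apriori_cst k.
Proof.
by move=> k0; rewrite addr_ge0 ?mulr_ge0// ?lipD_ge0.
Qed.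

Let expansion_cst_ge0 k : 0 <= k -> 0 <= expansion_cst k.
Proof.
by move=> k0; rewrite !addr_ge0 ?mulr_ge0 ?apriori_cst_ge0 ?addr_ge0 ?mulr_ge0.
Qed.

Lemma norm_BmxM t (xi : 'cV[R]_n) : 0 <= t <= T -> `|B t *m xi| <= lipB * `|xi|.
Proof.
move=> tT; rewrite BmxM normrN (le_trans (ler_normD _ _))//.
rewrite (le_trans (lerD (ler_normD _ _) (lexx _)))//.
have h1 := ler_norm_mulmx A xi; have h2 := norm_quad G (xt t) xi.
have h3 := norm_quad G xi (xt t); have xX := xt_le tT.
rewrite (le_trans (lerD (lerD h1 h2) h3))// -/(lipA A) /lipB.
have h4 : lipG G * `|xt t| * `|xi| <= lipG G * X * `|xi| by rewrite ler_wpM2r// ler_wpM2l.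
rewrite [lipG G * `|xi| * _]mulrAC; lra.
Qed.

Lemma normsq_mulC (x : 'cV[R]_n) : normsq (C *m x) <= q%:R * lipC ^+ 2 * `|x| ^+ 2.
Proof.
rewrite (le_trans (normsq_le _))// -mulrA ler_wpM2l// -exprMn lerXn2r ?nnegrE ?mulr_ge0//.
exact: ler_norm_mulmx.
Qed.

Lemma qf_riccati Q t x : Q^T = Q -> qf (riccati Q t) x =
  2 * bf Q x (B t *m x) - normsq (feedback Q x) + alpha * normsq (C *m x).
Proof.
move=> Qs; rewrite /riccati !qfD qfZ -[- _]scaleN1r qfZ.
have -> : qf (Q *m B t) x = bf Q x (B t *m x) by rewrite /qf /bf !mulmxA.
have -> : qf ((B t)^T *m Q) x = bf Q x (B t *m x).
  by rewrite (bf_sym _ _ Qs) /qf /bf trmx_mul !mulmxA.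
have -> : qf (Q *m F *m F^T *m Q) x = normsq (feedback Q x).
  by rewrite normsqE /qf /feedback !trmx_mul trmxK Qs !mulmxA.
have -> : qf (C^T *m C) x = normsq (C *m x).
  by rewrite normsqE /qf trmx_mul !mulmxA.
by ring.
Qed.

Lemma bf_feedback Q x (w : 'cV[R]_m) : Q^T = Q -> bf Q x (F *m w) = ((feedback Q x)^T *m w) 0 0.
Proof. by move=> Qs; rewrite /bf /feedback !trmx_mul trmxK Qs !mulmxA. Qed.

Lemma riccati_sym Q t : Q^T = Q -> (riccati Q t)^T = riccati Q t.
Proof.
move=> Qs; have trD (M N : 'M[R]_n) : (M + N)^T = M^T + N^T.
  by apply/matrixP => i j; rewrite !mxE.
have trN (M : 'M[R]_n) : (- M)^T = - M^T by apply/matrixP => i j; rewrite !mxE.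
have trZ a (M : 'M[R]_n) : (a *: M)^T = a *: M^T.
  by apply/matrixP => i j; rewrite !mxE.
rewrite /riccati; move: (B t) => Bt; rewrite !trD trN trZ !trmx_mul !trmxK Qs !mulmxA.
by congr (_ - _ + _); rewrite addrC.
Qed.

(* Completing the square: [normsq (w - tau g) >= 0] with [w] the integral of [v]. *)
Lemma control_energy_ge k s t (g : 'cV[R]_k) v : s < t -> vL2 s t v ->
  2 * (g^T *m vint s t v) 0 0 - (t - s) * normsq g <=
  \int[mu]_(r in `[s, t]) normsq (v r).
Proof.
move=> st vL; have := normsq_vint (ltW st) vL; set w := vint s t v.
set J := \int[mu]_(r in _) _; set tau := t - s => hw.
have tau0 : 0 < tau by rewrite subr_gt0.
have := normsq_ge0 (w - tau *: g).
have -> : normsq (w - tau *: g) =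
    normsq w - 2 * tau * (g^T *m w) 0 0 + tau ^+ 2 * normsq g.
  rewrite mxE /normsq !mulr_sumr -sumrB -big_split/=.
  by apply: eq_bigr => i _; rewrite !mxE; ring.
have -> : normsq w - 2 * tau * (g^T *m w) 0 0 + tau ^+ 2 * normsq g =
  normsq w - tau * (2 * (g^T *m w) 0 0 - tau * normsq g) by ring.
rewrite subr_ge0 => h; rewrite -(ler_pM2l tau0).
exact: le_trans h hw.
Qed.

(** Only the tracking term is approximated, by its value at [xi]; the control energy stays exact, to
    be used in completing the square. The 3 is 2 + 1, from |x - xt| <= 2 |xi|. *)
Lemma stage_cost_integral s t x v xi sg k : 0 <= s -> s <= t -> t <= T -> sol s t x v ->
  0 <= k -> 0 <= sg -> sg * apriori_cst k <= 1 ->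
  (forall u, s <= u <= t ->
    `|x u - xt u| <= 2 * `|xi| /\ `|x u - xt u - xi| <= sg * apriori_cst k * `|xi|) ->
  `|\int[mu]_(r in `[s, t]) stage_cost x v r -
    (\int[mu]_(r in `[s, t]) normsq (v r) + (t - s) * (alpha * normsq (C *m xi)))| <=
  (t - s) * (alpha * (3 * q%:R * lipC ^+ 2 * (sg * apriori_cst k) * `|xi| ^+ 2)).
Proof.
move=> s0 st tT xv k0 sg0 sgk ap.
have [_ _ vL _] := xv.
have yL : vL2 s t (fun r => C *m (x r - xt r)).
  apply: vL2_mulmx; exact: (sol_vL2_sub T_gt0 xt_nominal s0 st tT xv).
have i1 := vL2_normsq vL; have i2 := vL2_normsq yL.
have i3 := integZ alpha i2.
have i4 := @integ_cst _ s t (alpha * normsq (C *m xi)).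
rewrite RintegralD// -Rint_cst// opprD addrACA subrr add0r -RintegralB//.
apply: Rint_norm_le => //; first exact: integB.
move=> r srt; have [h1 h2] := ap r srt.
rewrite -mulrBr normrM gtr0_norm// ler_wpM2l ?(ltW alpha_gt0)//.
rewrite (le_trans (normsq_normB _ _))// -mulmxBr.
have c1 := ler_norm_mulmx C (x r - xt r); have c2 := ler_norm_mulmx C xi.
have c3 := ler_norm_mulmx C (x r - xt r - xi); rewrite -/lipC in c1 c2 c3.
have c4 : `|C *m (x r - xt r)| + `|C *m xi| <= 3 * lipC * `|xi|.
  rewrite (le_trans (lerD c1 c2))//.
  have : lipC * `|x r - xt r| <= lipC * (2 * `|xi|) by rewrite ler_wpM2l.
  lra.
have c5 : `|C *m (x r - xt r - xi)| <= lipC * (sg * apriori_cst k * `|xi|).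
  by rewrite (le_trans c3)// ler_wpM2l.
rewrite (_ : 3 * q%:R * lipC ^+ 2 * (sg * apriori_cst k) * `|xi| ^+ 2 =
  q%:R * (3 * lipC * `|xi|) * (lipC * (sg * apriori_cst k * `|xi|))); last by ring.
by apply: ler_pM => //; rewrite ler_wpM2l.
Qed.

(** [L0] is a Lipschitz constant of [drift] on the ball of radius X + 2, which contains the unit
    ball around any [p] with |p| <= X + 1; [M0] bounds the controlled field at [p] for |g| <= 1.
    Doubling their sum in [step_cst] yields both smallness conditions of [picard]. *)
Let L0 := lipA A + lipG G * (2 * (X + 2)).
Let M0 := (lipA A + lipG G * (X + 1)) * (X + 1) + lipF F.
Definition step_cst := 2 * (M0 + L0).

(** Existence is established only on the short interval [s, t]; on [0, s] an optimal trajectory of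
    the problem at [s] takes over. *)
Lemma constant_control s t p (g : 'cV[R]_m) sg : 0 <= s -> s <= t -> t <= T ->
  `|p| <= X + 1 -> `|g| <= 1 -> 0 <= sg -> sg <= 1 -> t - s = sg ^+ 2 ->
  sg * step_cst <= 1 -> exists2 x, sol s t x (fun=> g) & x t = p.
Proof.
move=> s0 st tT pX g1 sg0 sg1 tsg sgc.
have X1 : 0 <= X + 1 by rewrite addr_ge0.
have M00 : 0 <= M0 by rewrite addr_ge0 ?lipF_ge0 ?mulr_ge0 ?addr_ge0 ?mulr_ge0.
have L00 : 0 <= L0 by rewrite addr_ge0 ?mulr_ge0 ?addr_ge0.
have step_cst0 : 0 <= step_cst by rewrite mulr_ge0// addr_ge0.
have tc : (t - s) * step_cst <= 1.
  by rewrite tsg expr2 -mulrA (le_trans _ sgc)// ler_piMl// mulr_ge0.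
have Fg : `|F *m g| <= lipF F.
  by rewrite (le_trans (ler_norm_mulmx _ _))// -[leRHS]mulr1 ler_wpM2l ?lipF_ge0.
have := @picard _ _ (fun z => drift A G z + F *m g) p s t L0 M0 st L00 M00.
case.
- by move=> h hm; apply: vmeasD; [exact: vmeas_drift|exact: vmeas_cst].
- move=> z z' zp z'p; rewrite opprD addrACA subrr addr0.
  rewrite (le_trans (drift_lip A G z z'))// ler_wpM2r// lerD2l ler_wpM2l//.
  have h1 : `|z| <= `|z - p| + `|p| by rewrite -[X in `|X| <= _](subrK p) ler_normD.
  have h2 : `|z'| <= `|z' - p| + `|p| by rewrite -[X in `|X| <= _](subrK p) ler_normD.
  lra.
- rewrite (le_trans (ler_normD _ _))// lerD//.
  have := drift_lip A G p 0.
  have -> : drift A G 0 = 0 by rewrite /drift mulmx0 tens0mx mulmx0 addr0.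
  rewrite !subr0 normr0 addr0 => /le_trans; apply.
  apply: ler_pM => //; first by rewrite addr_ge0 ?mulr_ge0.
  by rewrite lerD2l ler_wpM2l.
- move: tc; rewrite /step_cst; have ts0 : 0 <= t - s by rewrite subr_ge0.
  have := mulr_ge0 ts0 M00; have := mulr_ge0 ts0 L00; lra.
- move: tc; rewrite /step_cst; have ts0 : 0 <= t - s by rewrite subr_ge0.
  have := mulr_ge0 ts0 M00; have := mulr_ge0 ts0 L00; lra.
move=> x [xm xb xE]; have xp : x t = p.
  have := xE t; rewrite st lexx vint_pt => /(_ erefl)/eqP.
  by rewrite subr_eq0 => /eqP.
exists x => //; split=> //.
- exists (`|p| + 1) => r /xb h.
  by rewrite -[x r](subrK p) addrC (le_trans (ler_normD _ _))// lerD2l.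
- by apply: (vmeas_bounded_vL2 (M := `|g|)); first exact: vmeas_cst.
- by move=> u /xE; rewrite xp.
Qed.

Lemma hess_sym t : 0 < t <= T -> (P t)^T = P t.
Proof.
move=> tT; have [] := value_hessian_taylor alpha_gt0 xt_nominal delta_gt0
  exactly_one value_smooth tT.
by [].
Qed.

Lemma hess_taylor t e : 0 < t <= T -> 0 < e -> exists2 d, 0 < d & forall xi, `|xi| < d ->
  `|V t xi - 2^-1 * qf (P t) xi| <= e * `|xi| ^+ 2.
Proof.
move=> tT; have [_] := value_hessian_taylor alpha_gt0 xt_nominal delta_gt0
  exactly_one value_smooth tT.
exact.
Qed.

(** Collects the smallness conditions on [xi] at fixed [s] and [t]. The factor 4 and the halved
    radii allow for states [y] of size up to 2 |xi|. *)
Lemma local_data s t e c : 0 < s <= T -> 0 < t <= T -> 0 < e -> 0 <= c ->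
  exists2 d, 0 < d & forall xi, `|xi| < d ->
    [/\ 3 * `|xi| <= 1, c * `|xi| <= e, enorm xi < delta,
      `|V t xi - 2^-1 * qf (P t) xi| <= e * `|xi| ^+ 2 &
      forall y, `|y| <= 2 * `|xi| -> enorm y < delta /\
        `|V s y - 2^-1 * qf (P s) y| <= 4 * e * `|xi| ^+ 2].
Proof.
move=> sT tT e0 c0.
have [d1 d10 h1] := hess_taylor tT e0; have [d2 d20 h2] := hess_taylor sT e0.
have n1 : 0 < n%:R + 1 :> R by rewrite ltr_wpDl.
have c1 : 0 < c + 1 by rewrite ltr_wpDl.
pose d3 := delta / (n%:R + 1) / 2; have d30 : 0 < d3 by rewrite !divr_gt0.
exists (Num.min (Num.min (3^-1) (e / (c + 1))) (Num.min d3 (Num.min d1 (d2 / 2)))).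
  by rewrite !lt_min d30 d10 !divr_gt0// invr_gt0 ltr0n.
move=> xi; rewrite !lt_min => /andP[/andP[k1 k2] /andP[k3 /andP[k4 k5]]].
have x0' := normr_ge0 xi.
have d3E : d3 * 2 = delta / (n%:R + 1) by rewrite /d3 divfK.
split.
- by move: k1; rewrite -[3^-1]mul1r ltr_pdivlMr// => /ltW; rewrite mulrC.
- move: k2; rewrite ltr_pdivlMr// => /ltW; rewrite mulrDr mulr1 mulrC; lra.
- apply: enorm_lt; rewrite -d3E; lra.
- exact: h1.
- move=> y y2; split; first by apply: enorm_lt; rewrite -d3E; lra.
  have yd : `|y| < d2 by lra.
  have yy : `|y| ^+ 2 <= 4 * `|xi| ^+ 2 by have := normr_ge0 y; nra.
  by rewrite (le_trans (h2 _ yd))// (mulrC 4) -mulrA ler_wpM2l// ltW.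
Qed.

(** The value is nonnegative and Taylor's formula has error [e]; apply [qf_small] to -P with c =
    0. *)
Lemma hess_ge0 t x : 0 < t <= T -> 0 <= qf (P t) x.
Proof.
move=> tT; rewrite -oppr_le0 -mulN1r -qfZ -[leRHS](mul0r (`|x| ^+ 2)).
apply: qf_small => e e0; have e2 : 0 < e / 2 by rewrite divr_gt0.
have [d d0 hd] := local_data tT tT e2 (lexx 0); exists d => // xi xi0 xid.
have [_ _ xd xT _] := hd _ xid.
have := value_ge0 alpha_gt0 exactly_one tT xd.
by move: xT; rewrite qfZ ler_norml => /andP[_]; lra.
Qed.


Let N2 : R := n%:R ^+ 2.
Let N20 : 0 <= N2. Proof. exact: sqr_ge0. Qed.

(* [effort K * `|xi|] bounds the L^2 norm of the optimal control and of the feedback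
   control [F^T P(s) xi] when [P s] and [P t] are bounded by [K]; a step is short
   enough when [sqrt (t - s) * step_rate K <= 1]. *)
Definition gain K := n%:R * (n%:R * `|F| * K).
Definition effort K := n%:R ^+ 2 * K + 2 + m%:R * gain K ^+ 2.
Definition step_rate K := apriori_cst (effort K) + step_cst.
(** The summands bound, in order, the expansion remainder paired with [xi], the variation of the
    tracking cost, and the quadratic form of the displacement under a constant control. *)
Definition step_err K := 2 * (n%:R ^+ 2 * K * expansion_cst (effort K))
  + alpha * (3 * q%:R * lipC ^+ 2) * apriori_cst (effort K)
  + n%:R ^+ 2 * K * (lipB + lipF F * gain K + 2 * expansion_cst (effort K)) ^+ 2.

Let step_cst0 : 0 <= step_cst.
Proof.
rewrite mulr_ge0// addr_ge0 ?addr_ge0 ?mulr_ge0// ?addr_ge0// ?mulr_ge0// ?addr_ge0//.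
Qed.

Lemma gain_ge0 K : 0 <= K -> 0 <= gain K.
Proof. by move=> K0; rewrite !mulr_ge0. Qed.

Lemma effort_ge2 K : 0 <= K -> 2 <= effort K.
Proof.
move=> K0; have h1 : 0 <= n%:R ^+ 2 * K by rewrite mulr_ge0.
have h2 : 0 <= m%:R * gain K ^+ 2 by rewrite mulr_ge0// sqr_ge0.
rewrite /effort; lra.
Qed.

Lemma step_rate_ge0 K : 0 <= K -> 0 <= step_rate K.
Proof.
move=> K0; rewrite addr_ge0// apriori_cst_ge0//.
exact: le_trans (ler0n _ _) (effort_ge2 K0).
Qed.

Lemma step_err_ge0 K : 0 <= K -> 0 <= step_err K.
Proof.
move=> K0; have k0 : 0 <= effort K := le_trans (ler0n _ _) (effort_ge2 K0).
rewrite /step_err; apply: addr_ge0; last by apply: mulr_ge0; [exact: mulr_ge0|exact: sqr_ge0].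
apply: addr_ge0.
  by apply: mulr_ge0 => //; apply: mulr_ge0; [exact: mulr_ge0|exact: expansion_cst_ge0].
apply: mulr_ge0; last exact: apriori_cst_ge0.
apply: mulr_ge0; first exact: ltW.
by apply: mulr_ge0; [exact: mulr_ge0|exact: sqr_ge0].
Qed.

Lemma norm_feedback Q (xi : 'cV[R]_n) K : `|Q| <= K -> `|feedback Q xi| <= gain K * `|xi|.
Proof.
move=> QK; rewrite (le_trans (ler_norm_mulmx _ _))// ler_wpM2r// ler_wpM2l//.
by rewrite (le_trans (ler_norm_mulmx _ _))// norm_trmx ler_wpM2l.
Qed.

Lemma qf_step s t (xi : 'cV[R]_n) : 0 < s <= T ->
  qf (P s + (t - s) *: riccati (P s) t - P t) xi =
  qf (P s) xi + (t - s) * (2 * bf (P s) xi (B t *m xi) -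
    normsq (feedback (P s) xi) + alpha * normsq (C *m xi)) - qf (P t) xi.
Proof. by move=> sT; rewrite qfB qfD qfZ qf_riccati//; exact: hess_sym. Qed.

Lemma qf_expand Q (xi : 'cV[R]_n) tau (z : 'cV[R]_n) (w : 'cV[R]_m) q0 : Q^T = Q ->
  qf Q (xi + (tau *: z - F *m w + q0)) =
  qf Q xi + 2 * (tau * bf Q xi z - ((feedback Q xi)^T *m w) 0 0 + bf Q xi q0)
  + qf Q (tau *: z - F *m w + q0).
Proof. by move=> Qs; rewrite qf_add// !bfDr bfNr bfZr bf_feedback. Qed.

(** The remainder is tau (sg + |xi|) |xi| up to a constant. The [sg] part is the genuine error of
    the step; the [|xi|] part is absorbed into [e] by taking [xi] small. *)
Lemma remainder_le K Q (xi q0 : 'cV[R]_n) tau sg E e : `|Q| <= K -> 0 <= K -> 0 <= tau -> tau <= 1 ->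
  0 <= E -> 0 <= sg -> 2 * (N2 * K * E) * `|xi| <= e ->
  `|q0| <= tau * (E * (sg + `|xi|) * `|xi|) ->
  2 * `|bf Q xi q0| <= (2 * (N2 * K * E) * (tau * sg) + e) * `|xi| ^+ 2.
Proof.
move=> QK K0 tau0 tau1 E0 sg0 xie q0le.
have x0' := normr_ge0 xi.
have h1 : `|bf Q xi q0| <= N2 * K * `|xi| * (tau * (E * (sg + `|xi|) * `|xi|)).
  rewrite (le_trans (bf_le _ _ _))//; apply: ler_pM => //.
  by rewrite ler_wpM2r// ler_wpM2l.
have h2 : tau * (2 * (N2 * K * E) * `|xi|) <= e.
  by rewrite (le_trans _ xie)// ler_piMl// !mulr_ge0.
have h3 : tau * (2 * (N2 * K * E) * `|xi|) * `|xi| ^+ 2 <= e * `|xi| ^+ 2.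
  by rewrite ler_wpM2r// sqr_ge0.
move: h1 h3; lra.
Qed.

Section one_step.
Variables (s t K sg : R).
Hypotheses (s_gt0 : 0 < s) (st : s < t) (tT : t <= T).
Hypotheses (K_ge0 : 0 <= K) (sg_gt0 : 0 < sg) (sg_le1 : sg <= 1).
Hypotheses (tsE : t - s = sg ^+ 2) (sg_rate : sg * step_rate K <= 1).

Let s_in : 0 < s <= T. Proof. by rewrite s_gt0 (le_trans (ltW st)). Qed.
Let t_in : 0 < t <= T. Proof. by rewrite tT (lt_trans s_gt0). Qed.
Let tau0 : 0 <= t - s. Proof. by rewrite subr_ge0 ltW. Qed.
Let tau_le_sg : t - s <= sg. Proof. by rewrite tsE expr2 ler_piMl// ltW. Qed.
Let tau1 : t - s <= 1. Proof. exact: le_trans tau_le_sg sg_le1. Qed.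
Let k0 : 0 <= effort K. Proof. exact: le_trans (effort_ge2 K_ge0). Qed.

Let sg_apriori : sg * apriori_cst (effort K) <= 1.
Proof.
apply: le_trans sg_rate; rewrite ler_wpM2l ?(ltW sg_gt0)//.
by rewrite /step_rate lerDl.
Qed.

Let sg_cst : sg * step_cst <= 1.
Proof.
apply: le_trans sg_rate; rewrite ler_wpM2l ?(ltW sg_gt0)//.
by rewrite /step_rate lerDr apriori_cst_ge0.
Qed.

Let third_ge0 : 0 <= n%:R ^+ 2 * K * (lipB + lipF F * gain K + 2 * expansion_cst (effort K)) ^+ 2.
Proof. by rewrite mulr_ge0 ?sqr_ge0// mulr_ge0. Qed.

Lemma step_lower : `|P s| <= K -> `|P t| <= K ->
  forall x, qf (P s + (t - s) *: riccati (P s) t - P t) x <=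
    step_err K * ((t - s) * sg) * `|x| ^+ 2.
Proof.
move=> PsK PtK; apply: qf_small => e e0; set k := effort K.
have k2 : 2 <= k by exact: effort_ge2.
pose e1 := Num.min 1 (e / 20).
have e10 : 0 < e1 by rewrite lt_min ltr01 divr_gt0.
have e11 : e1 <= 1 by rewrite ge_min lexx.
have e1e : 20 * e1 <= e by rewrite mulrC -ler_pdivlMr// ge_min lexx orbT.
have c0 : 0 <= 2 * (N2 * K * expansion_cst k) by rewrite !mulr_ge0// expansion_cst_ge0.
have [d d0 hd] := local_data s_in t_in e10 c0; exists d => // xi xi0 xid.
have [xi3 cxi xidel Vt Vs] := hd _ xid.
have [x [v [xv xtE Ev dpp]]] :=
  value_dpp_ge T_gt0 alpha_gt0 xt_nominal exactly_one s_gt0 (ltW st) tT xidel.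
have xi2 : 0 <= `|xi| ^+ 2 by exact: sqr_ge0.
(* The energy is at most twice the value at (t, xi), which the bound on [P t] makes O(|xi|^2). *)
have Ek : \int[mu]_(r in `[s, t]) normsq (v r) <= (k * `|xi|) ^+ 2.
  rewrite (le_trans Ev)// exprMn.
  have h1 : qf (P t) xi <= N2 * K * `|xi| ^+ 2.
    rewrite (le_trans (ler_norm _))// (le_trans (qf_le _ _))//.
    by rewrite ler_wpM2r// ler_wpM2l.
  have h2 := double_value_le Vt h1 e11 xi2.
  rewrite (le_trans h2)// ler_wpM2r//.
  have : N2 * K + 2 <= k by rewrite /k /effort lerDl mulr_ge0// sqr_ge0.
  by move=> /le_trans; apply; rewrite expr2 ler_peMr// (le_trans _ k2)// ler1n.
have ap := sol_apriori xt_sol xt_le (ltW s_gt0) (ltW st) tT xv xtE xi0 xi3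
  (ltW sg_gt0) sg_le1 _ k0 sg_apriori Ek.
rewrite {1}tsE in ap; have {}ap := ap (lexx _).
have ex := sol_expansion xt_sol xt_le xt_holder (ltW s_gt0) (ltW st) tT xv xtE xi0 xi3
  (ltW sg_gt0) sg_le1 _ k0 sg_apriori Ek.
rewrite {1}tsE in ex; have {}ex := ex (lexx _).
have rc := stage_cost_integral (ltW s_gt0) (ltW st) tT xv k0 (ltW sg_gt0) sg_apriori ap.
have [y2 _] : `|x s - xt s| <= 2 * `|xi| /\ `|x s - xt s - xi| <= sg * apriori_cst k * `|xi|.
  by apply: ap; rewrite lexx ltW.
have [yd Vsy] := Vs _ y2; have {}dpp := dpp yd.
set w := vint s t v in ex; set y := x s - xt s in ex y2 yd Vsy dpp.
set q0 := y - _ in ex.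
have yE : y = xi + ((t - s) *: (B t *m xi) - F *m w + q0).
  by rewrite /q0; apply/colP => i; rewrite !mxE; ring.
have vL : vL2 s t v by case: xv.
have ce := control_energy_ge (feedback (P s) xi) st vL; rewrite -/w in ce.
have Pss := hess_sym s_in.
have qe := qf_expand xi (t - s) (B t *m xi) w q0 Pss; rewrite -yE in qe.
(* This form is of the same order in [t - s] as the main term; its sign is all that is used. *)
have qh := hess_ge0 ((t - s) *: (B t *m xi) - F *m w + q0) s_in.
have rem := remainder_le PsK K_ge0 tau0 tau1 (expansion_cst_ge0 k0) (ltW sg_gt0) cxi ex.
have := lower_arith Vt Vsy dpp rc qe qh ce rem; rewrite -qf_step// => /le_trans; apply.
have th := third_ge0; rewrite -/k in th.
have th' : 0 <= n%:R ^+ 2 * K * (lipB + lipF F * gain K + 2 * expansion_cst k) ^+ 2 *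
    ((t - s) * sg) * `|xi| ^+ 2.
  by apply: mulr_ge0 => //; apply: mulr_ge0 => //; rewrite mulr_ge0// ltW.
have e1x : 20 * e1 * `|xi| ^+ 2 <= e * `|xi| ^+ 2 by rewrite ler_wpM2r.
have e1x0 : 0 <= e1 * `|xi| ^+ 2 by rewrite mulr_ge0// ltW.
exact: step_err_arith.
Qed.

Let constant_energy (g : 'cV[R]_m) (xi : 'cV[R]_n) : `|g| <= gain K * `|xi| ->
  \int[mu]_(r in `[s, t]) normsq g <= (effort K * `|xi|) ^+ 2.
Proof.
move=> gxi; have k2 := effort_ge2 K_ge0.
rewrite Rint_cst ?(ltW st)// (le_trans (_ : _ <= 1 * normsq g))//.
  by rewrite ler_wpM2r// normsq_ge0.
rewrite mul1r (le_trans (normsq_le _))// exprMn.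
have h1 : m%:R * `|g| ^+ 2 <= m%:R * gain K ^+ 2 * `|xi| ^+ 2.
  by rewrite -mulrA ler_wpM2l// -exprMn lerXn2r ?nnegrE// mulr_ge0// gain_ge0.
rewrite (le_trans h1)// ler_wpM2r ?sqr_ge0//.
have : m%:R * gain K ^+ 2 <= effort K.
  by rewrite /effort lerDr addr_ge0// mulr_ge0.
by move=> /le_trans; apply; rewrite expr2 ler_peMr// (le_trans _ k2)// ler1n.
Qed.

Let norm_terminal (xi : 'cV[R]_n) : 3 * `|xi| <= 1 -> `|xt t + xi| <= X + 1.
Proof.
move=> xi3; rewrite (le_trans (ler_normD _ _))// lerD//.
  by apply: xt_le; rewrite tT andbT (le_trans (ltW s_gt0))// ltW.
by have := normr_ge0 xi; lra.
Qed.

Lemma step_upper : `|P s| <= K ->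
  forall x, qf (- (P s + (t - s) *: riccati (P s) t - P t)) x <=
    step_err K * ((t - s) * sg) * `|x| ^+ 2.
Proof.
move=> PsK; apply: qf_small => e e0; set k := effort K.
have k2 : 2 <= k by exact: effort_ge2.
pose e1 := Num.min 1 (e / 20).
have e10 : 0 < e1 by rewrite lt_min ltr01 divr_gt0.
have e11 : e1 <= 1 by rewrite ge_min lexx.
have e1e : 20 * e1 <= e by rewrite mulrC -ler_pdivlMr// ge_min lexx orbT.
have c0 : 0 <= 2 * (N2 * K * expansion_cst k) by rewrite !mulr_ge0// expansion_cst_ge0.
have gK0 := gain_ge0 K_ge0.
(* Adding [gain K] to the constant makes the feedback control at most 1 in norm, as
   [constant_control] requires. *)
have c0' : 0 <= 2 * (N2 * K * expansion_cst k) + gain K by rewrite addr_ge0.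
have [d d0 hd] := local_data s_in t_in e10 c0'; exists d => // xi xi0 xid.
have [xi3 cxi' xidel Vt Vs] := hd _ xid.
have xi2 : 0 <= `|xi| ^+ 2 by exact: sqr_ge0.
have cxi : 2 * (N2 * K * expansion_cst k) * `|xi| <= e1.
  by rewrite (le_trans _ cxi')// ler_wpM2r// lerDl.
have gxi : gain K * `|xi| <= 1.
  by rewrite (le_trans _ e11)// (le_trans _ cxi')// ler_wpM2r// lerDr.
pose g := feedback (P s) xi.
have gle : `|g| <= gain K * `|xi| by exact: norm_feedback.
have [x xv xtE] := constant_control (ltW s_gt0) (ltW st) tT (norm_terminal xi3)
  (le_trans gle gxi) (ltW sg_gt0) sg_le1 tsE sg_cst.
have Ek := constant_energy gle.
have ap := sol_apriori xt_sol xt_le (ltW s_gt0) (ltW st) tT xv xtE xi0 xi3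
  (ltW sg_gt0) sg_le1 _ k0 sg_apriori Ek.
rewrite {1}tsE in ap; have {}ap := ap (lexx _).
have ex := sol_expansion xt_sol xt_le xt_holder (ltW s_gt0) (ltW st) tT xv xtE xi0 xi3
  (ltW sg_gt0) sg_le1 _ k0 sg_apriori Ek.
rewrite {1}tsE in ex; have {}ex := ex (lexx _).
have rc := stage_cost_integral (ltW s_gt0) (ltW st) tT xv k0 (ltW sg_gt0) sg_apriori ap.
have [y2 _] : `|x s - xt s| <= 2 * `|xi| /\ `|x s - xt s - xi| <= sg * apriori_cst k * `|xi|.
  by apply: ap; rewrite lexx ltW.
have [yd Vsy] := Vs _ y2.
have dpp := value_dpp_le T_gt0 xt_nominal exactly_one s_gt0 (ltW st) tT xidel xv xtE yd.
rewrite vint_cst ?(ltW st)// in ex.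
set w := (t - s) *: g in ex; set y := x s - xt s in ex y2 yd Vsy dpp.
set q0 := y - _ in ex.
have yE : y = xi + ((t - s) *: (B t *m xi) - F *m w + q0).
  by rewrite /q0; apply/colP => i; rewrite !mxE; ring.
have Pss := hess_sym s_in.
have qe := qf_expand xi (t - s) (B t *m xi) w q0 Pss; rewrite -yE in qe.
have JE : \int[mu]_(r in `[s, t]) normsq g = (t - s) * normsq g by rewrite Rint_cst// ltW.
have gwE : (g^T *m w) 0 0 = (t - s) * normsq g by rewrite /w -scalemxAr mxE normsqE.
have rem := remainder_le PsK K_ge0 tau0 tau1 (expansion_cst_ge0 k0) (ltW sg_gt0) cxi ex.
(* With [w = (t - s) g] the whole displacement is at most (t - s) H |xi|. The 2 bounds sg + |xi|,
   and the square of t - s is then estimated by (t - s) sg. *)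
pose H := lipB + lipF F * gain K + 2 * expansion_cst k.
have ek0 := expansion_cst_ge0 k0; rewrite -/k in ek0.
have tI : 0 <= t <= T by rewrite tT andbT (le_trans (ltW s_gt0))// ltW.
have hH : `|(t - s) *: (B t *m xi) - F *m w + q0| <= (t - s) * (H * `|xi|).
  rewrite (le_trans (ler_normD _ _))//.
  rewrite (le_trans (lerD (ler_normB _ _) (lexx _)))//.
  have h1 : `|(t - s) *: (B t *m xi)| <= (t - s) * (lipB * `|xi|).
    by rewrite normrZ ger0_norm// ler_wpM2l// norm_BmxM.
  have h2 : `|F *m w| <= (t - s) * (lipF F * (gain K * `|xi|)).
    rewrite /w -scalemxAr normrZ ger0_norm// ler_wpM2l//.
    by rewrite (le_trans (ler_norm_mulmx _ _))// ler_wpM2l.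
  have h3 : (t - s) * (expansion_cst k * (sg + `|xi|) * `|xi|) <= (t - s) * (expansion_cst k * 2 * `|xi|).
    rewrite ler_wpM2l// ler_wpM2r// ler_wpM2l// (_ : 2 = 1 + 1)// lerD//.
    by rewrite (le_trans _ xi3)// ler_peMl// ler1n.
  rewrite (le_trans (lerD (lerD h1 h2) (le_trans ex h3)))// /H.
  by rewrite le_eqVlt; apply/orP; left; apply/eqP; ring.
have H0 : 0 <= H.
  by apply: addr_ge0; [apply: addr_ge0 => //; exact: mulr_ge0|exact: mulr_ge0].
have qh : qf (P s) ((t - s) *: (B t *m xi) - F *m w + q0) <=
    n%:R ^+ 2 * K * H ^+ 2 * ((t - s) * sg) * `|xi| ^+ 2.
  rewrite (le_trans (ler_norm _))// (le_trans (qf_le _ _))//.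
  rewrite (le_trans (_ : _ <= N2 * K * ((t - s) * (H * `|xi|)) ^+ 2))//.
    apply: ler_pM => //; first by rewrite ler_wpM2l.
    by rewrite lerXn2r ?nnegrE// mulr_ge0// mulr_ge0.
  rewrite (_ : N2 * K * ((t - s) * (H * `|xi|)) ^+ 2 =
    N2 * K * H ^+ 2 * ((t - s) * (t - s)) * `|xi| ^+ 2); last by rewrite /N2; ring.
  rewrite ler_wpM2r// ler_wpM2l ?ler_wpM2l// mulr_ge0 ?sqr_ge0// mulr_ge0//.
have := upper_arith Vt Vsy dpp rc qe qh JE gwE rem => up.
rewrite -scaleN1r qfZ mulN1r qf_step// opprB (le_trans up)//.
have third : 0 <= n%:R ^+ 2 * K * H ^+ 2 * ((t - s) * sg) * `|xi| ^+ 2.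
  by apply: mulr_ge0 => //; apply: mulr_ge0 => //; rewrite mulr_ge0// ltW.
have e1x : 20 * e1 * `|xi| ^+ 2 <= e * `|xi| ^+ 2 by rewrite ler_wpM2r.
have e1x0 : 0 <= e1 * `|xi| ^+ 2 by rewrite mulr_ge0// ltW.
exact: step_err_arith'.
Qed.

(** Zero control. Neither [P s] nor [P t] is assumed bounded: [K] enters only through the admissible
    step length, so the growth bound is not circular. *)
Lemma step_bound :
  `|P t| <= 3 * (4 * (n%:R ^+ 2 * `|P s|) + 4 * (alpha * (q%:R * lipC ^+ 2))).
Proof.
set cb := alpha * (q%:R * lipC ^+ 2).
have cb0 : 0 <= cb by rewrite mulr_ge0 ?(ltW alpha_gt0)// mulr_ge0// sqr_ge0.
have a0 : 0 <= n%:R ^+ 2 * `|P s| by rewrite mulr_ge0.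
apply: sym_norm_le; [by apply: addr_ge0; exact: mulr_ge0|exact: hess_sym|].
move=> x; rewrite ger0_norm; last exact: hess_ge0.
move: x; apply: qf_small => e e0; set k := effort K.
have e10 : 0 < e / 10 by rewrite divr_gt0.
have [d d0 hd] := local_data s_in t_in e10 (lexx 0); exists d => // xi xi0 xid.
have [xi3 _ xidel Vt Vs] := hd _ xid.
have xi2 : 0 <= `|xi| ^+ 2 by exact: sqr_ge0.
have g1 : `|0 : 'cV[R]_m| <= 1 by rewrite normr0.
have [x xv xtE] := constant_control (ltW s_gt0) (ltW st) tT (norm_terminal xi3)
  g1 (ltW sg_gt0) sg_le1 tsE sg_cst.
have g2 : `|0 : 'cV[R]_m| <= gain K * `|xi| by rewrite normr0 mulr_ge0// gain_ge0.
have ap := sol_apriori xt_sol xt_le (ltW s_gt0) (ltW st) tT xv xtE xi0 xi3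
  (ltW sg_gt0) sg_le1 _ k0 sg_apriori (constant_energy g2).
rewrite {1}tsE in ap; have {}ap := ap (lexx _).
have rc := stage_cost_integral (ltW s_gt0) (ltW st) tT xv k0 (ltW sg_gt0) sg_apriori ap.
have [y2 _] : `|x s - xt s| <= 2 * `|xi| /\ `|x s - xt s - xi| <= sg * apriori_cst k * `|xi|.
  by apply: ap; rewrite lexx ltW.
have [yd Vsy] := Vs _ y2.
have dpp := value_dpp_le T_gt0 xt_nominal exactly_one s_gt0 (ltW st) tT xidel xv xtE yd.
have JE : \int[mu]_(r in `[s, t]) normsq (0 : 'cV[R]_m) = 0.
  by rewrite normsq0 Rint_cst ?mulr0// ltW.
have qy : qf (P s) (x s - xt s) <= n%:R ^+ 2 * `|P s| * (4 * `|xi| ^+ 2).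
  rewrite (le_trans (ler_norm _))// (le_trans (qf_le _ _))// ler_wpM2l ?mulr_ge0//.
  by have := normr_ge0 (x s - xt s); nra.
have cc : alpha * normsq (C *m xi) <= cb * `|xi| ^+ 2.
  by rewrite /cb -mulrA ler_wpM2l ?(ltW alpha_gt0)// normsq_mulC.
have rr : alpha * (3 * q%:R * lipC ^+ 2 * (sg * apriori_cst k) * `|xi| ^+ 2) <= 3 * cb * `|xi| ^+ 2.
  rewrite (_ : alpha * (3 * q%:R * lipC ^+ 2 * (sg * apriori_cst k) * `|xi| ^+ 2) =
    (3 * cb * `|xi| ^+ 2) * (sg * apriori_cst k)); last by rewrite /cb; ring.
  by rewrite ler_piMr// mulr_ge0// mulr_ge0.
have := bound_arith Vt Vsy dpp rc JE qy tau0 tau1 cc rr (mulr_ge0 cb0 xi2).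
by rewrite [10 * _]mulrC divfK.
Qed.

Lemma step_estimate : `|P s| <= K -> `|P t| <= K ->
  `|P t - P s - (t - s) *: riccati (P s) t| <= 3 * (step_err K * ((t - s) * sg)).
Proof.
move=> PsK PtK.
have -> : P t - P s - (t - s) *: riccati (P s) t =
    - (P s + (t - s) *: riccati (P s) t - P t) by rewrite opprB opprD addrA.
have se0 := step_err_ge0 K_ge0.
set M := P s + _ - _.
have Ms : M^T = M.
  apply: sym_lin; [exact: hess_sym| |exact: hess_sym].
  exact/riccati_sym/hess_sym.
rewrite normrN; apply: sym_norm_le => // [|x].
  by rewrite !mulr_ge0// ltW.
have lo := step_lower PsK PtK x; have up := step_upper PsK x.
rewrite ler_norml lo andbT; move: up; rewrite -/M -scaleN1r qfZ mulN1r.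
by rewrite lerNl.
Qed.

End one_step.

End riccati_step.

(** * Regularity of the Riccati right-hand side *)

Section riccati_regularity.
Context {R : realType} {n m q : nat}.
Variables (T alpha : R) (A : 'M[R]_n) (G : 'M[R]_(n, n * n)) (F : 'M[R]_(n, m)).
Variables (C : 'M[R]_(q, n)) (xt : R -> 'cV[R]_n) (X X' : R).
Hypotheses (T_gt0 : 0 < T) (alpha_gt0 : 0 < alpha).
Hypothesis xt_le : forall r, 0 <= r <= T -> `|xt r| <= X.
Hypothesis xt_holder : forall u u' d, 0 <= u -> u <= u' -> u' <= T -> 0 <= d ->
  u' - u <= d ^+ 2 -> `|xt u - xt u'| <= X' * d.

Local Notation B := (Bmx A G xt).
Local Notation ric := (riccati alpha A G F C xt).

Lemma mx_norm_mulmx_le k l (M : 'M[R]_(k, l)) c : 0 <= c ->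
  (forall x : 'cV[R]_l, `|M *m x| <= c * `|x|) -> `|M| <= c.
Proof.
move=> c0 H; apply: mx_norm_le => // i j.
have -> : M i j = (M *m (delta_mx j 0 : 'cV[R]_l)) i 0 by rewrite -colE mxE.
rewrite (le_trans (ler_mx_norm _ _ _))// (le_trans (H _))//.
by rewrite ler_piMr// norm_delta_mx.
Qed.

Let X0 : 0 <= X.
Proof. by apply: le_trans (normr_ge0 (xt 0)) (xt_le _); rewrite lexx ltW. Qed.

Lemma norm_Bmx t : 0 <= t <= T -> `|B t| <= lipB A G X.
Proof.
move=> tT; apply: mx_norm_mulmx_le => [|x]; last exact: (norm_BmxM A G xt_le).
by rewrite addr_ge0 ?lipA_ge0// !mulr_ge0// lipG_ge0.
Qed.

Lemma norm_BmxB s t d : 0 <= s -> s <= t -> t <= T -> 0 <= d -> t - s <= d ^+ 2 ->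
  `|B s - B t| <= 2 * lipG G * (X' * d).
Proof.
move=> s0 st tT d0 tsd; have h := xt_holder s0 st tT d0 tsd.
have G0 := lipG_ge0 G.
have X'd : 0 <= X' * d by exact: le_trans h.
apply: mx_norm_mulmx_le => [|x]; first by rewrite mulr_ge0// mulr_ge0.
have -> : (B s - B t) *m x = - (quad G (xt s - xt t) x + quad G x (xt s - xt t)).
  rewrite mulmxBl !BmxM quadDl quadDr quadNl quadNr.
  by apply/colP => i; rewrite !mxE; ring.
rewrite normrN (le_trans (ler_normD _ _))//.
rewrite (le_trans (lerD (norm_quad _ _ _) (norm_quad _ _ _)))//.
have : lipG G * `|xt s - xt t| * `|x| <= lipG G * (X' * d) * `|x|.
  by rewrite ler_wpM2r// ler_wpM2l.
rewrite [lipG G * `|x| * _]mulrAC; lra.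
Qed.

Definition lip_riccati K :=
  2 * (n%:R * lipB A G X) + 2 * (n%:R * (n%:R * `|F *m F^T| * K)).

(** With S = F F^T, the quadratic term is split as Q S Q - Q' S Q' = (Q - Q') S Q + Q' S (Q -
    Q'). *)
Lemma riccati_lip K Q Q' t : 0 <= t <= T -> `|Q| <= K -> `|Q'| <= K ->
  `|ric Q t - ric Q' t| <= lip_riccati K * `|Q - Q'|.
Proof.
move=> tT QK Q'K; have Bt := norm_Bmx tT.
have -> : ric Q t - ric Q' t = (Q - Q') *m B t + (B t)^T *m (Q - Q') -
    (Q - Q') *m (F *m F^T *m Q) - (Q' *m (F *m F^T)) *m (Q - Q').
  rewrite /riccati; move: (B t) => Bt'; rewrite !(mulmxBl, mulmxBr) !mulmxA; move: (Q *m Bt') (Q' *m Bt') (Bt'^T *m Q) (Bt'^T *m Q').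
  move: (Q *m F *m F^T *m Q) (Q' *m F *m F^T *m Q) (Q' *m F *m F^T *m Q').
  move: (alpha *: _) => M1 M2 M3 M4 M5 M6 M7 M8.
  by apply/matrixP => i j; rewrite !mxE; ring.
have b1 := ler_norm_mulmx (Q - Q') (B t).
have b2 := ler_norm_mulmx (B t)^T (Q - Q'); rewrite norm_trmx in b2.
have b3 := ler_norm_mulmx (Q - Q') (F *m F^T *m Q).
have b4 := ler_norm_mulmx (Q' *m (F *m F^T)) (Q - Q').
have b5 := ler_norm_mulmx (F *m F^T) Q; have b6 := ler_norm_mulmx Q' (F *m F^T).
rewrite (le_trans (ler_normB _ _))// (le_trans (lerD (ler_normB _ _) b4))//.
rewrite (le_trans (lerD (lerD (ler_normD _ _) b3) (lexx _)))//.
rewrite (le_trans (lerD (lerD (lerD b1 b2) (lexx _)) (lexx _)))//.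
set D := `|Q - Q'|; have D0 : 0 <= D by exact: normr_ge0.
have c1 : n%:R * D * `|B t| <= n%:R * D * lipB A G X by rewrite ler_wpM2l// mulr_ge0.
have c2 : n%:R * `|B t| * D <= n%:R * lipB A G X * D by rewrite ler_wpM2r// ler_wpM2l.
have c3 : n%:R * D * `|F *m F^T *m Q| <= n%:R * D * (n%:R * `|F *m F^T| * K).
  by rewrite ler_wpM2l ?mulr_ge0// (le_trans b5)// ler_wpM2l// mulr_ge0.
have c4 : n%:R * `|Q' *m (F *m F^T)| * D <= n%:R * (n%:R * K * `|F *m F^T|) * D.
  by rewrite ler_wpM2r// ler_wpM2l// (le_trans b6)// ler_wpM2r// ler_wpM2l.
rewrite (le_trans (lerD (lerD (lerD c1 c2) c3) c4))// /lip_riccati.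
by rewrite le_eqVlt; apply/orP; left; apply/eqP; ring.
Qed.

Lemma riccati_holder K Q s t d : 0 <= s -> s <= t -> t <= T -> 0 <= d ->
  t - s <= d ^+ 2 -> `|Q| <= K ->
  `|ric Q t - ric Q s| <= 2 * (n%:R * K * (2 * lipG G * X')) * d.
Proof.
move=> s0 st tT d0 tsd QK; have h := norm_BmxB s0 st tT d0 tsd.
have -> : ric Q t - ric Q s = Q *m (B t - B s) + (B t - B s)^T *m Q.
  have -> : (B t - B s)^T = (B t)^T - (B s)^T by apply/matrixP => i j; rewrite !mxE.
  rewrite /riccati; move: (B t) (B s) => Bt Bs; rewrite mulmxBr mulmxBl; move: (Q *m Bt) (Q *m Bs) (Bt^T *m Q) (Bs^T *m Q).
  move: (Q *m F *m F^T *m Q) (alpha *: _) => M1 M2 M3 M4 M5 M6.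
  by apply/matrixP => i j; rewrite !mxE; ring.
rewrite distrC in h.
have b1 := ler_norm_mulmx Q (B t - B s).
have b2 := ler_norm_mulmx (B t - B s)^T Q; rewrite norm_trmx in b2.
rewrite (le_trans (ler_normD _ _))// (le_trans (lerD b1 b2))//.
have c1 : n%:R * `|Q| * `|B t - B s| <= n%:R * K * (2 * lipG G * (X' * d)).
  by apply: ler_pM => //; rewrite ler_wpM2l.
have c2 : n%:R * `|B t - B s| * `|Q| <= n%:R * K * (2 * lipG G * (X' * d)).
  by rewrite mulrAC.
by rewrite (le_trans (lerD c1 c2))// le_eqVlt; apply/orP; left; apply/eqP; ring.
Qed.

Lemma riccati_bound K Q t : 0 <= t <= T -> `|Q| <= K ->
  `|ric Q t| <= lip_riccati K * K + `|alpha *: (C^T *m C)|.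
Proof.
move=> tT QK; have K0 : 0 <= K by exact: le_trans QK.
have z : `|0 : 'M[R]_n| <= K by rewrite normr0.
have := riccati_lip tT QK z; rewrite subr0.
have -> : ric 0 t = alpha *: (C^T *m C).
  by rewrite /riccati !mul0mx !mulmx0 subr0 !add0r.
move=> h; rewrite -[ric Q t](subrK (alpha *: (C^T *m C))).
rewrite (le_trans (ler_normD _ _))// lerD// (le_trans h)// ler_wpM2l//.
rewrite addr_ge0// !mulr_ge0// addr_ge0 ?lipA_ge0// !mulr_ge0// lipG_ge0.
Qed.

End riccati_regularity.

(** * The derivative *)

Section derivative_from_increments.
Context {R : realType}.

Lemma quotient_split k l (a : R) (M N N' : 'M[R]_(k, l)) : a != 0 ->
  a^-1 *: M - N' = a^-1 *: (M - a *: N) + (N - N').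
Proof.
by move=> a0; rewrite [a^-1 *: (M - _)]scalerBr scalerA mulVf// scale1r addrA subrK.
Qed.

(** Bounding the square root by the inverse of [a + 1] keeps it below 1 and below the inverse of [a]
    at once, also when [a = 0]. *)
Lemma sqrt_step (r a : R) : 0 < r -> 0 <= a -> r <= (a + 1)^-1 ^+ 2 ->
  [/\ 0 < Num.sqrt r, Num.sqrt r <= 1, r = Num.sqrt r ^+ 2 & Num.sqrt r * a <= 1].
Proof.
move=> r0 a0 ra; have a1 : 0 < a + 1 by rewrite ltr_wpDl.
have sa : Num.sqrt r <= (a + 1)^-1.
  by rewrite -[leRHS]ger0_norm ?invr_ge0 ?(ltW a1)// -sqrtr_sqr ler_wsqrtr.
split; first by rewrite sqrtr_gt0.
- by rewrite (le_trans sa)// invf_le1// lerDr.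
- by rewrite sqr_sqrtr// ltW.
- rewrite (le_trans (ler_wpM2r a0 sa))// mulrC ler_pdivrMr// mul1r lerDl.
  exact: ler01.
Qed.

(* Increments of the form [(t - s) f (Q s) t + O((t - s)^(3/2))] on both sides of
   [t]; the a priori growth bound keeps [Q] bounded near [t]. *)
Lemma deriv_of_increments k (Q : R -> 'M[R]_k) (f : 'M[R]_k -> R -> 'M[R]_k) (T t : R)
  (rate E L H W : R -> R) (rate0 c1 c2 : R) : 0 < t <= T ->
  (forall K, 0 <= K -> [/\ 0 <= rate K, 0 <= E K, 0 <= L K, 0 <= H K & 0 <= W K]) ->
  0 <= rate0 -> 0 <= c1 ->
  (forall s u d, 0 < s -> s < u -> u <= T -> 0 < d -> d <= 1 -> u - s = d ^+ 2 ->
    d * rate0 <= 1 -> `|Q u| <= c1 * `|Q s| + c2) ->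
  (forall K s u d, 0 < s -> s < u -> u <= T -> 0 <= K -> 0 < d -> d <= 1 ->
    u - s = d ^+ 2 -> d * rate K <= 1 -> `|Q s| <= K -> `|Q u| <= K ->
    `|Q u - Q s - (u - s) *: f (Q s) u| <= E K * ((u - s) * d)) ->
  (forall K M N u, 0 <= u <= T -> `|M| <= K -> `|N| <= K ->
    `|f M u - f N u| <= L K * `|M - N|) ->
  (forall K M s u d, 0 <= s -> s <= u -> u <= T -> 0 <= d -> u - s <= d ^+ 2 ->
    `|M| <= K -> `|f M u - f M s| <= H K * d) ->
  (forall K M u, 0 <= u <= T -> `|M| <= K -> `|f M u| <= W K) ->
  has_deriv_within [set s | 0 < s <= T] Q t (f (Q t) t).
Proof.
move=> /andP[t0 tT] cst0 rate00 c10 growth incr flip fholder fbound.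
(* The [t / 2] keeps [t - eta] positive; the other term makes every interval of length at most [eta]
   a single growth step. *)
pose eta := Num.min (t / 2) ((rate0 + 1)^-1 ^+ 2).
have r1 : 0 < rate0 + 1 by rewrite ltr_wpDl.
have eta0 : 0 < eta by rewrite lt_min divr_gt0// exprn_gt0// invr_gt0.
have eta_t : eta < t by rewrite /eta gt_min ltr_pdivrMr// ltr_pMr// ltr1n.
have eta_r : eta <= (rate0 + 1)^-1 ^+ 2 by rewrite ge_min lexx orbT.
have grow s u : 0 < s -> s < u -> u <= T -> u - s <= eta -> `|Q u| <= c1 * `|Q s| + c2.
  move=> s0 su uT us; have us0 : 0 < u - s by rewrite subr_gt0.
  have [d0 d1 dE dr] := sqrt_step us0 rate00 (le_trans us eta_r).
  exact: growth d0 d1 dE dr.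
(* Times before [t] are reached in one step from [t - eta], times after [t] in one step from [t]
   itself. *)
pose K := Num.max (`|Q t|) (Num.max (c1 * `|Q (t - eta)| + c2) (c1 * `|Q t| + c2)).
have QtK : `|Q t| <= K by rewrite le_max lexx.
have K0 : 0 <= K by exact: le_trans QtK.
have QK s : 0 < s -> s <= T -> `|s - t| < eta -> `|Q s| <= K.
  move=> s0 sT; rewrite ltr_norml => /andP[h1 h2].
  have [->//|nst] := eqVneq s t.
  have te0 : 0 < t - eta by rewrite subr_gt0.
  rewrite 2!le_max; case: (ltP s t) => st.
    by rewrite (grow (t - eta))// ?orbT//; lra.
  rewrite (grow t s)// ?orbT//; last by lra.
  by rewrite lt_neqAle eq_sym nst.
have [rK EK LK HK WK] := cst0 _ K0.
have tT' : 0 <= t <= T by rewrite (ltW t0).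
pose D := E K + L K * (W K + E K) + H K.
have D0 : 0 <= D by rewrite !addr_ge0// mulr_ge0// addr_ge0.
have key s : 0 < s -> s <= T -> s != t -> `|s - t| < eta ->
    `|s - t| <= (rate K + 1)^-1 ^+ 2 ->
    `|(s - t)^-1 *: (Q s - Q t) - f (Q t) t| <= D * Num.sqrt `|s - t|.
  move=> s0 sT st seta srate; have QsK := QK s s0 sT seta.
  have st0 : 0 < `|s - t| by rewrite normr_gt0 subr_eq0.
  have [d0 d1 dE dr] := sqrt_step st0 rK srate.
  set d := Num.sqrt _ in d0 d1 dE dr *.
  case: (ltP s t) => [lst|]; last first.
    rewrite le_eqVlt eq_sym (negbTE st)/= => lts.
    have ts0 : 0 < s - t by rewrite subr_gt0.
    rewrite gtr0_norm// in dE.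
    have := incr K t s d t0 lts sT K0 d0 d1 dE dr QtK QsK => h1.
    (* After [t] the increment starts from [Q t] but evaluates [f] at time [s]; Hölder continuity in
       time corrects this. *)
    have h2 := fholder K (Q t) t s d (ltW t0) (ltW lts) sT (ltW d0) _ QtK.
    have {}h2 := h2 (eq_ind _ (fun z => s - t <= z) (lexx _) _ dE).
    rewrite (quotient_split _ (f (Q t) s)) ?gt_eqF//.
    rewrite (le_trans (ler_normD _ _))// normrZ gtr0_norm ?invr_gt0//.
    have h3 : (s - t)^-1 * `|Q s - Q t - (s - t) *: f (Q t) s| <= E K * d.
      by rewrite mulrC ler_pdivrMr// -mulrA (mulrC d).
    rewrite (le_trans (lerD h3 h2))// /D.
    have : 0 <= L K * (W K + E K) * d by rewrite mulr_ge0 ?(ltW d0)// mulr_ge0// addr_ge0.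
    lra.
  have ts0 : 0 < t - s by rewrite subr_gt0.
  rewrite distrC gtr0_norm// in dE.
  have := incr K s t d s0 lst tT K0 d0 d1 dE dr QsK QtK => h1.
  have h2 := flip K (Q s) (Q t) t tT' QsK QtK.
  have tsd : t - s <= d by rewrite dE expr2 ler_piMl// ltW.
  (* Before [t] the increment evaluates [f] at [Q s]. The increment estimate itself shows that [Q s]
     is close to [Q t], and the Lipschitz bound corrects the difference. *)
  have h4 : `|Q s - Q t| <= (W K + E K) * d.
    rewrite distrC -[Q t - Q s](subrK ((t - s) *: f (Q s) t)).
    rewrite (le_trans (ler_normD _ _))// normrZ gtr0_norm//.
    have w1 : (t - s) * `|f (Q s) t| <= d * W K.
      by apply: ler_pM => //; [exact: ltW|exact: fbound].
    have w2 : E K * ((t - s) * d) <= E K * d.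
      by rewrite ler_wpM2l// ler_piMl ?(ltW d0)// (le_trans tsd).
    lra.
  have -> : (s - t)^-1 *: (Q s - Q t) = (t - s)^-1 *: (Q t - Q s).
    by rewrite -opprB invrN -[Q s - _]opprB scalerN scaleNr opprK.
  rewrite (quotient_split _ (f (Q s) t)) ?gt_eqF//.
  rewrite (le_trans (ler_normD _ _))// normrZ gtr0_norm ?invr_gt0//.
  have h3 : (t - s)^-1 * `|Q t - Q s - (t - s) *: f (Q s) t| <= E K * d.
    by rewrite mulrC ler_pdivrMr// -mulrA (mulrC d).
  have h5 : L K * `|Q s - Q t| <= L K * ((W K + E K) * d) by rewrite ler_wpM2l.
  rewrite (le_trans (lerD h3 (le_trans h2 h5)))// /D.
  have : 0 <= H K * d by rewrite mulr_ge0 ?(ltW d0).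
  lra.
clearbody eta; apply/cvgrPdist_le => e e0.
have D1 : 0 < D + 1 by rewrite ltr_wpDl.
pose rad := Num.min eta (Num.min ((rate K + 1)^-1 ^+ 2) ((e / (D + 1)) ^+ 2)).
have rad0 : 0 < rad.
  rewrite !lt_min eta0 !exprn_gt0// ?divr_gt0// invr_gt0.
  by rewrite ltr_wpDl.
rewrite near_withinE; near=> s => /= /andP[s0 sT].
have st : s != t by near: s; exact: nbhs_dnbhs_neq.
have : `|s - t| < rad.
  rewrite distrC; near: s; apply: cvg_within; exact: (@nbhsx_ballx _ _ t rad).
rewrite !lt_min => /andP[h1 /andP[h2 h3]].
rewrite distrC (le_trans (key s s0 sT st h1 (ltW h2)))//.
have : Num.sqrt `|s - t| <= e / (D + 1).
  by rewrite -[leRHS]gtr0_norm ?divr_gt0// -[leRHS]sqrtr_sqr ler_wsqrtr// ltW.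
rewrite ler_pdivlMr// => h; apply: le_trans h.
by rewrite mulrC ler_wpM2l ?sqrtr_ge0// lerDl.
Unshelve. all: by end_near. Qed.

End derivative_from_increments.

Theorem proposition5p1 (R : realType) (n m r : nat) (T alpha : R)
    (A : 'M[R]_n) (G : 'M[R]_(n, n * n)) (F : 'M[R]_(n, m)) (C : 'M[R]_(r, n))
    (x0 : 'cV[R]_n) (xt : R -> 'cV[R]_n) (delta4 : R)
    (T_gt0 : 0 < T) (alpha_gt0 : 0 < alpha)
    (xt_nominal : nominal A G x0 T xt)
    (xt_unique : forall y, nominal A G x0 T y ->
      forall s : R, 0 <= s <= T -> y s = xt s)
    (delta4_gt0 : 0 < delta4)
    (exactly_one_solution : forall t : R, 0 < t <= T ->
      forall xi w, data_ball t delta4 (xi, w) ->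
        ocp_exactly_one alpha A G F C x0 xt t xi w)
    (value_smooth : forall t : R, 0 < t <= T ->
      smooth_on (data_space t) (data_norm t) (data_ball t delta4)
        (fun p => fine (value alpha A G F C x0 xt t p.1 p.2))) :
  let P := value_hessian alpha A G F C x0 xt in
  let B := Bmx A G xt in
  forall t : R, 0 < t <= T ->
    has_deriv_within [set s | 0 < s <= T] P t
      (P t *m B t + (B t)^T *m P t - P t *m F *m F^T *m P t
       + alpha *: (C^T *m C)).
Proof.
move=> P B t tT.
have [X xt_le] := nominal_bounded F T_gt0 xt_nominal.
have [X' xt_holder] := nominal_holder F T_gt0 xt_nominal.
have X0 : 0 <= X by apply: le_trans (normr_ge0 (xt 0)) (xt_le _ _); rewrite lexx ltW.
have X'0 : 0 <= X'.
  have := xt_holder 0 0 1 (lexx 0) (lexx 0) (ltW T_gt0) ler01.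
  rewrite subrr mulr1 expr1n => /(_ ler01); exact: le_trans.
have lB0 : 0 <= lipB A G X by rewrite addr_ge0 ?lipA_ge0// !mulr_ge0// lipG_ge0.
pose b := alpha * (r%:R * lipC C ^+ 2).
pose W K := lip_riccati A G F X K * K + `|alpha *: (C^T *m C)|.
pose H K := 2 * (n%:R * K * (2 * lipG G * X')).
pose E K := 3 * step_err alpha A G F C X X' K.
(* The growth bound holds for every nonnegative [K], so its rate is taken at [K = 0], independently
   of the bound on [P] that it yields. The 12 is the 3 of polarisation times the 4 of
   [bound_arith]. *)
apply: (deriv_of_increments (f := riccati alpha A G F C xt)
  (rate := step_rate A G F X) (E := E) (L := lip_riccati A G F X) (H := H) (W := W)
  (rate0 := step_rate A G F X 0) (c1 := 12 * n%:R ^+ 2) (c2 := 12 * b) tT).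
- move=> K K0.
  have L0 : 0 <= lip_riccati A G F X K by rewrite addr_ge0// !mulr_ge0.
  split.
  + exact: (step_rate_ge0 A G F T_gt0 xt_le K0).
  + by rewrite /E mulr_ge0// (step_err_ge0 A G F C T_gt0 alpha_gt0 xt_le xt_holder K0).
  + exact: L0.
  + by rewrite /H !mulr_ge0// lipG_ge0.
  + by rewrite /W addr_ge0// mulr_ge0.
- exact: (step_rate_ge0 A G F T_gt0 xt_le (lexx 0)).
- by rewrite mulr_ge0// sqr_ge0.
- move=> s u d s0 su uT d0 d1 dE dr.
  have := step_bound T_gt0 alpha_gt0 xt_nominal delta4_gt0 exactly_one_solution
    value_smooth xt_le s0 su uT (lexx 0) d0 d1 dE dr.
  by move=> /le_trans; apply; rewrite le_eqVlt; apply/orP; left; apply/eqP; rewrite /b; ring.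
- move=> K s u d s0 su uT K0 d0 d1 dE dr QsK QuK.
  have := step_estimate T_gt0 alpha_gt0 xt_nominal delta4_gt0 exactly_one_solution
    value_smooth xt_le xt_holder s0 su uT K0 d0 d1 dE dr QsK QuK.
  by rewrite mulrA.
- by move=> K M N u uT MK NK; exact: (riccati_lip alpha A G F C T_gt0 xt_le).
- by move=> K M s u d s0 su uT d0 us MK; exact: (riccati_holder alpha A G F C xt_holder).
- by move=> K M u uT MK; exact: (riccati_bound alpha A G F C T_gt0 xt_le).
Qed.
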